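(* Let a finite-horizon MDP, the primal approximations $V_{h,N}$ (built with $K_{\mathrm{pr}}$ basis functions), the projected martingale functions $\eta_{t+1,K}$ and their simulated, interpolated estimates $\widetilde\eta_{t+1,K,M}$ be as described in the context, and suppose that assumptions (B1)--(B4) of the context hold. Then there is an absolute constant $C>0$ such that for every $t\in\{0,\dots,H-1\}$, $$ \begin{aligned} &\mathbb{E}_{\mathcal P_{\mathsf E}\otimes\mathsf P}\Bigl[\sup_{(x,a)\in\mathsf S\times\mathsf A}\bigl|\eta_{t+1,K}(x,a,\cdot)-\widetilde\eta_{t+1,K,M}(x,a,\cdot)\bigr|^2\Bigr]\\ &\le C\Biggl(\varrho_{\psi,K}^2\,\frac{K\bigl(L_{V,K_{\mathrm{pr}}}L_{\mathcal K}I_{\mathcal D}(\mathsf S\times\mathsf A)+L_{V,K_{\mathrm{pr}}}L_{\mathcal K}\mathsf D(\mathsf S\times\mathsf A)+V_{\max}^\star\bigr)^2\Lambda_{\mathsf E,K}^2}{M}\\ &\quad+K\Lambda_{\mathsf E,K}^2\varrho_{\psi,K}^2\sup_{(x,a)\in\mathsf S\times\mathsf A}\Bigl\Vert\frac{dP_{t+1}(\cdot|x,a)}{d\mu_{t+1}(\cdot)}\Bigr\Vert_\infty\Vert V_{t+1}^\star-V_{t+1,N}\Vert_{L^2(\mu_{t+1}\otimes\mathsf P)}^2\\ &\quad+K\varrho_{\psi,K}^2L_{V,K_{\mathrm{pr}}}^2L_{\mathcal K}^2\Lambda_{\mathsf E,K}^2\,\rho_L^2(\mathsf S,\mathsf A)\Biggr),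 \end{aligned} $$ where $L_{V,K_{\mathrm{pr}}}:=L_R+V_{\max}^\star\Lambda_{K_{\mathrm{pr}}}L_{\gamma,K_{\mathrm{pr}}}\sqrt{K_{\mathrm{pr}}}$.
   Context: **MDP.** $\mathsf S$ (states) and $\mathsf A$ (actions) are measurable spaces, finite or infinite; $H\ge1$ is the horizon; $P_h(\cdot|x,a)$, $h=1,\dots,H$, are transition kernels from $\mathsf S\times\mathsf A$ to $\mathsf S$; $R_h:\mathsf S\times\mathsf A\to\mathbb R$, $h=0,\dots,H-1$, are rewards; $F:\mathsf S\to\mathbb R$ is the terminal reward. A policy is $\boldsymbol\pi=(\pi_0,\dots,\pi_{H-1})$ with $\pi_t:\mathsf S\to\mathcal P(\mathsf A)$; under $\boldsymbol\pi$, $A_t\sim\pi_t(S_t)$ and $S_{t+1}\sim P_{t+1}(\cdot|S_t,A_t)$. The optimal value functions are $V_h^\star(x):=\sup_{\boldsymbol\pi}\mathbb E_{\boldsymbol\pi}\bigl[\sum_{t=h}^{H-1}R_t(S_t,A_t)+F(S_H)\,|\,S_h=x\bigr]$; they satisfy $V_H^\star=F$ and $V_h^\star(x)=\sup_{a\in\mathsf A}(R_h(x,a)+P_{h+1}^aV_{h+1}^\star(x))$, where $P_{h+1}^aV(x):=\mathbb E_{S'\sim P_{h+1}(\cdot|x,a)}[V(S')]$. Suprema over uncountable families of random variables are understood as essential suprema. $|\cdot|$ is the Euclidean norm and $|\cdot|_\infty$ the $\ell_\infty$ norm. **Assumptions.** (B1) There are a measurable space $\mathsf E$, a probability measure $\mathcal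 P_{\mathsf E}$ on it, and measurable maps $\mathcal K_h:\mathsf S\times\mathsf A\times\mathsf E\to\mathsf S$, such that the chain is $S_t=\mathcal K_t(S_{t-1},a_{t-1},\varepsilon_t)$ with $\varepsilon_t$ i.i.d. $\sim\mathcal P_{\mathsf E}$; thus $P_h^af(x)=\mathbb E_{\varepsilon\sim\mathcal P_{\mathsf E}}[f(\mathcal K_h(x,a,\varepsilon))]$. Moreover $\mathsf S,\mathsf A$ carry metrics $\rho_{\mathsf S},\rho_{\mathsf A}$, $\mathsf S\times\mathsf A$ carries the metric $\rho((x,a),(x',a'))=\Vert(\rho_{\mathsf S}(x,x'),\rho_{\mathsf A}(a,a'))\Vert$ for a fixed norm on $\mathbb R^2$, and for a constant $L_{\mathcal K}$ independent of $h$, $\rho_{\mathsf S}(\mathcal K_h(x,a,\varepsilon),\mathcal K_h(x',a',\varepsilon))\le L_{\mathcal K}\,\rho((x,a),(x',a'))$ for all $(x,a),(x',a'),\varepsilon$. (B2) $|R_h(x,a)|\le R_{\max}$ and $|F(x)|\le R_{\max}$ for all $x,a,h$, and $\sup_{a}|R_h(x,a)-R_h(x',a)|\le L_R\,\rho_{\mathsf S}(x,x')$, with $R_{\max},L_R$ independent of $h$. (B3) The primal basis $\boldsymbol\gamma_{K_{\mathrm{pr}}}=(\gamma_1,\dots,\gamma_{K_{\mathrm{pr}}})^\top$, $\gamma_k:\mathsf S\to\mathbb R$, and probability measures $\mu_h$ on $\mathsf S$ (with $P_h(\cdot|x,a)$ absolutely continuous w.r.t. $\mu_h$ for all $h\in\{1,\dots,H\}$,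 $x$, $a$) are such that $\Sigma_{h,K_{\mathrm{pr}}}:=\mathbb E_{X\sim\mu_h}[\boldsymbol\gamma_{K_{\mathrm{pr}}}(X)\boldsymbol\gamma_{K_{\mathrm{pr}}}^\top(X)]$ is invertible, $|\Sigma_{h,K_{\mathrm{pr}}}^{-1}\boldsymbol\gamma_{K_{\mathrm{pr}}}(x)|_\infty\le\Lambda_{K_{\mathrm{pr}}}$ for all $x\in\mathsf S$, $h\in\{0,\dots,H-1\}$, and $|\boldsymbol\gamma_{K_{\mathrm{pr}}}(x)-\boldsymbol\gamma_{K_{\mathrm{pr}}}(x')|\le L_{\gamma,K_{\mathrm{pr}}}\,\rho_{\mathsf S}(x,x')$ with $L_{\gamma,K_{\mathrm{pr}}}>0$. (B4) $\boldsymbol\psi_K=(\psi_1,\dots,\psi_K)^\top$ with $\psi_k\in L^2(\mathsf E,\mathcal P_{\mathsf E})$, $\int\psi_k\,d\mathcal P_{\mathsf E}=0$; $\Sigma_{\mathsf E,K}:=\mathbb E_{\varepsilon\sim\mathcal P_{\mathsf E}}[\boldsymbol\psi_K(\varepsilon)\boldsymbol\psi_K^\top(\varepsilon)]$ is invertible; $|\Sigma_{\mathsf E,K}^{-1}\boldsymbol\psi_K(\varepsilon)|_\infty\le\Lambda_{\mathsf E,K}$ for all $\varepsilon\in\mathsf E$; and $\mathbb E_{\varepsilon\sim\mathcal P_{\mathsf E}}[|\boldsymbol\psi_K(\varepsilon)|^2]\le\varrho_{\psi,K}^2$. **Primal algorithm.** $\widetilde L_h:=(H-h+1)R_{\max}$,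 $V_{\max}^\star:=\widetilde L_0=(H+1)R_{\max}$, $\mathcal T_L[g](x):=\max(-L,\min(L,g(x)))$. Draw independent pairs $(X_i^h,\varepsilon_i^h)\sim\mu_h\otimes\mathcal P_{\mathsf E}$, $h=0,\dots,H-1$, $i=1,\dots,N$. Set $V_{H,N}:=F$ and, backwards for $h=H-1,\dots,0$, $$V_{h,N}(x):=\sup_{a\in\mathsf A}\bigl(R_h(x,a)+\mathcal T_{\widetilde L_{h+1}}[\beta_{N,a}^\top\boldsymbol\gamma_{K_{\mathrm{pr}}}](x)\bigr),\quad \beta_{N,a}:=\frac1N\sum_{i=1}^N V_{h+1,N}(Y_i^a)\,\Sigma_{h,K_{\mathrm{pr}}}^{-1}\boldsymbol\gamma_{K_{\mathrm{pr}}}(X_i^h),$$ with $Y_i^a:=\mathcal K_{h+1}(X_i^h,a,\varepsilon_i^h)$. **Dual algorithm.** For each $t\in\{0,\dots,H-1\}$ draw $\widetilde\varepsilon_1^{t+1},\dots,\widetilde\varepsilon_M^{t+1}$ i.i.d. $\sim\mathcal P_{\mathsf E}$, independent of everything else (the same draws for all $(x,a)$), and set $$\mathbf c_{K,M}(x,a)=[c_{1,M}(x,a),\dots,c_{K,M}(x,a)]^\top:=\frac1M\sum_{m=1}^M V_{t+1,N}(\mathcal K_{t+1}(x,a,\widetilde\varepsilon_m^{t+1}))\,\Sigma_{\mathsf E,K}^{-1}\boldsymbol\psi_K(\widetilde\varepsilon_m^{t+1}).$$ Let $\mathsf S_L=\{x_1,\dots,x_L\}\subset\mathsf S$ and $\mathsf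 A_L=\{a_1,\dots,a_L\}\subset\mathsf A$ be fixed grids. For $f$ on $\mathsf S\times\mathsf A$ that is $\mathcal L$-Lipschitz w.r.t. $\rho$, the optimal central interpolant is $I[f]:=(H_f^{\mathrm{low}}+H_f^{\mathrm{up}})/2$ with $$H_f^{\mathrm{low}}(x,a):=\max_{(x',a')\in\mathsf S_L\times\mathsf A_L}\bigl(f(x',a')-\mathcal L\rho((x,a),(x',a'))\bigr),\quad H_f^{\mathrm{up}}(x,a):=\min_{(x',a')\in\mathsf S_L\times\mathsf A_L}\bigl(f(x',a')+\mathcal L\rho((x,a),(x',a'))\bigr).$$ Set $\widetilde c_{k,M}:=I[c_{k,M}]$ (with $\mathcal L=L_{V,K_{\mathrm{pr}}}L_{\mathcal K}\Lambda_{\mathsf E,K}$) and $\widetilde\eta_{t+1,K,M}(x,a,\varepsilon):=\sum_{k=1}^K\widetilde c_{k,M}(x,a)\psi_k(\varepsilon)$. The covering radius is $\rho_L(\mathsf S,\mathsf A):=\sup_{(x,a)\in\mathsf S\times\mathsf A}\min_{(x',a')\in\mathsf S_L\times\mathsf A_L}\rho((x,a),(x',a'))$. $\mathsf P$ is the joint law of all simulations (primal $(X_i^h,\varepsilon_i^h)$ and dual $\widetilde\varepsilon_m^{t+1}$), and $\mathbb E_{\mathcal P_{\mathsf E}\otimes\mathsf P}$ averages over an independent $\varepsilon\sim\mathcal P_{\mathsf E}$ (the argument ''$\cdot$'') and the simulations. **Projection.** $\mathbf c_K(x,a)=[c_1(x,a),\dots,c_K(x,a)]^\top$ is the unique minimizer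 of $\inf_{c_1,\dots,c_K}\mathbb E_{\varepsilon\sim\mathcal P_{\mathsf E}}\bigl[(V_{t+1}^\star(\mathcal K_{t+1}(x,a,\varepsilon))-\sum_{k=1}^Kc_k\psi_k(\varepsilon))^2\bigr]$, and $\eta_{t+1,K}(x,a,\varepsilon):=\mathbf c_K^\top(x,a)\boldsymbol\psi_K(\varepsilon)$. **Metric quantities.** For a metric space $(\mathsf X,\rho)$: $\mathsf D(\mathsf X)$ is its diameter, $\mathcal N(\mathsf X,\rho,u)$ the smallest number of $\rho$-balls of radius $u$ covering $\mathsf X$, and $I_{\mathcal D}(\mathsf X):=\int_0^{\mathsf D(\mathsf X)}\sqrt{\log\mathcal N(\mathsf X,\rho,u)}\,du$. For $\mathsf S\times\mathsf A$ the metric is $\rho$ above.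
   Formalization: For t=H-1 it is additionally assumed that almost surely all c_{k,M} are Lipschitz with constant L_{V,K_pr} L_K Λ_{E,K}, the domain condition of I; since (B2) only bounds F, the bound can fail there otherwise. V*_h is assumed measurable. *)

(* Defs.v *)
From HB Require Import structures.
From mathcomp Require Import all_boot all_order all_algebra.
From mathcomp Require Import all_classical all_reals all_analysis measurable_realfun.

Set Implicit Arguments.
Unset Strict Implicit.
Unset Printing Implicit Defensive.

Import Order.TTheory GRing.Theory Num.Theory.
Import numFieldNormedType.Exports.

Local Open Scope classical_set_scope.
Local Open Scope ring_scope.

(* A measurable space that also carries a metric [mdist]; no compatibility
   between the sigma-algebra and the metric topology is imposed. *)
#[short(type="metricMeasurableType")]
HB.structure Definition MetricMeasurable (d : measure_display) (R : realType) :=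
  { T of Measurable d T & Metric R T }.

Section kernel_at.
Context d d' (X : measurableType d) (Y : measurableType d') (R : realType).
Variables (k : R.-pker X ~> Y) (x : X).

(* The measure [k x], with the probability structure that the library does not
   attach to it and that Radon-Nikodym derivatives require. *)
Definition kernel_at : set Y -> \bar R := k x.

HB.instance Definition _ := Measure.on kernel_at.
HB.instance Definition _ :=
  Measure_isProbability.Build _ _ _ kernel_at (prob_kernel x).

End kernel_at.

Definition enorm (R : realType) n (v : 'cV[R]_n) : R :=
  Num.sqrt (\sum_(i < n) v i 0 ^+ 2).

Definition dot (R : realType) n (u v : 'cV[R]_n) : R :=
  \sum_(i < n) u i 0 * v i 0.

Definition gram d (T : measurableType d) (R : realType)
    (mu : probability T R) n (f : T -> 'cV[R]_n) : 'M[R]_n :=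
  \matrix_(i, j) \int[mu]_x (f x i 0 * f x j 0).

Definition is_norm_R2 (R : realType) (nu : R * R -> R) : Prop :=
  [/\ forall u v, nu (u.1 + v.1, u.2 + v.2) <= nu u + nu v,
      forall c u, nu (c * u.1, c * u.2) = `|c| * nu u
    & forall u, nu u = 0 -> u = (0, 0)].

Section metric_quantities.
Local Open Scope ereal_scope.
Context (R : realType) (T : Type) (rho : T -> T -> R).

Definition diameter : \bar R := ereal_sup [set (rho z.1 z.2)%:E | z in [set: T * T]].

Definition ball_cover (u : R) (n : nat) : Prop :=
  exists c : 'I_n -> T, forall z, exists i, (rho (c i) z < u)%R.

(* [+oo] when no finite cover exists. *)
Definition covering_number (u : R) : \bar R :=
  ereal_inf [set n%:R%:E | n in ball_cover u].

Definition entropy_integral : \bar R :=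
  \int[lebesgue_measure]_(u in [set u : R | (0 < u)%R /\ u%:E <= diameter])
    (lne (covering_number u) `^ 2^-1).

Definition lipschitz_wrt (L : R) (f : T -> R) : Prop :=
  forall z z', (`|f z - f z'| <= L * rho z z')%R.

Section grid.
Context (I : finType) (g : I -> T).

Definition interp_low (L : R) (f : T -> R) (z : T) : R :=
  sup [set (f (g i) - L * rho z (g i))%R | i in [set: I]].

Definition interp_up (L : R) (f : T -> R) (z : T) : R :=
  inf [set (f (g i) + L * rho z (g i))%R | i in [set: I]].

Definition central_interpolant (L : R) (f : T -> R) (z : T) : R :=
  ((interp_low L f z + interp_up L f z) / 2)%R.

Definition covering_radius : \bar R :=
  ereal_sup [set (inf [set rho z (g i) | i in [set: I]])%:E | z in [set: T]].

End grid.
End metric_quantities.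

(* [Y] is (a version of) the essential supremum of the arbitrary family [Z] of
   random variables: the almost surely least measurable almost sure upper bound. *)
Definition is_ess_sup d (T : measurableType d) (R : realType)
    (mu : {measure set T -> \bar R}) (I : Type) (Z : I -> T -> \bar R)
    (Y : T -> \bar R) : Prop :=
  [/\ measurable_fun [set: T] Y,
      forall i, {ae mu, forall w, (Z i w <= Y w)%E}
    & forall Y', measurable_fun [set: T] Y' ->
        (forall i, {ae mu, forall w, (Z i w <= Y' w)%E}) ->
        {ae mu, forall w, (Y w <= Y' w)%E}].

(* All the data. Time-indexed families are indexed by [nat]; only the following
   indices are constrained or used: [trans], [step], [mu] (in the absolute
   continuity assumption) at 1..H, [reward], [prX], [prE], [mu] (in the primal
   algorithm) at 0..H-1, and [duE] at 1..H. *)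
Record setting (R : realType) (dS dA dE dO : measure_display)
    (S : metricMeasurableType dS R) (A : metricMeasurableType dA R)
    (E : measurableType dE) (Omega : measurableType dO) := Setting {
  horizon : nat ;
  trans : nat -> R.-pker (S * A)%type ~> S ;
  reward : nat -> S * A -> R ;
  term : S -> R ;
  PE : probability E R ;
  step : nat -> S * A * E -> S ;
  norm2 : R * R -> R ;
  LK : R ;
  Rmax : R ;
  LR : R ;
  Kpr : nat ;
  gamma : S -> 'cV[R]_Kpr ;
  mu : nat -> probability S R ;
  Lambda_pr : R ;
  Lgamma : R ;
  Kdu : nat ;
  psi : E -> 'cV[R]_Kdu ;
  Lambda_du : R ;
  varrho : R ;
  n_pr : nat ;
  n_du : nat ;
  PP : probability Omega R ;
  prX : nat -> 'I_n_pr -> Omega -> S ;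
  prE : nat -> 'I_n_pr -> Omega -> E ;
  duE : nat -> 'I_n_du -> Omega -> E ;
  n_grid : nat ;
  gridS : 'I_n_grid -> S ;
  gridA : 'I_n_grid -> A
}.
Arguments prX {R dS dA dE dO S A E Omega} s _ _ _.
Arguments prE {R dS dA dE dO S A E Omega} s _ _ _.
Arguments duE {R dS dA dE dO S A E Omega} s _ _ _.
Arguments gridS {R dS dA dE dO S A E Omega} s _.
Arguments gridA {R dS dA dE dO S A E Omega} s _.

Section theory.
Context (R : realType) (dS dA dE dO : measure_display).
Context (S : metricMeasurableType dS R) (A : metricMeasurableType dA R).
Context (E : measurableType dE) (Omega : measurableType dO).
Variable D : setting S A E Omega.

Local Notation H := (horizon D).

(* Policies are Markov; [pi t] is a measurable map from S to P(A). *)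
Definition policy := nat -> R.-pker S ~> A.

(* [return_expectation pi n h x r] is the expectation of
   [r + R_h(S_h,A_h) + ... + R_{h+n-1}(S_{h+n-1},A_{h+n-1}) + F(S_{h+n})] for
   the chain started from [S_h = x] and driven by [pi], written as the iterated
   integral over [A_h, S_{h+1}, A_{h+1}, ..., S_{h+n}]. *)
Fixpoint return_expectation (pi : policy) (n h : nat) (x : S) (r : R) : R :=
  if n is n'.+1 then
    \int[pi h x]_a \int[trans D h.+1 (x, a)]_y
      return_expectation pi n' h.+1 y (r + reward D h (x, a))
  else r + term D x.

Definition Vstar (h : nat) (x : S) : R :=
  sup [set return_expectation pi (H - h) h x 0 | pi in [set: policy]].

Definition rho (z z' : S * A) : R := norm2 D (mdist z.1 z'.1, mdist z.2 z'.2).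

Definition Sigma_pr (h : nat) : 'M[R]_(Kpr D) := gram (mu D h) (gamma D).
Definition Sigma_du : 'M[R]_(Kdu D) := gram (PE D) (psi D).

(* [Vstar_meas] is what makes the expectations [P_h^a V_h^*] and the projection
   of [V_h^*] below meaningful when A is uncountable. *)
Record standing : Prop := Standing {
  horizon_gt0 : (0 < H)%N ;
  Kpr_gt0 : (0 < Kpr D)%N ;
  Kdu_gt0 : (0 < Kdu D)%N ;
  n_pr_gt0 : (0 < n_pr D)%N ;
  n_du_gt0 : (0 < n_du D)%N ;
  n_grid_gt0 : (0 < n_grid D)%N ;
  reward_meas : forall h, (h < H)%N -> measurable_fun [set: S * A] (reward D h) ;
  term_meas : measurable_fun [set: S] (term D) ;
  Vstar_meas : forall h, (h <= H)%N -> measurable_fun [set: S] (Vstar h) ;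
  gamma_meas : forall k, measurable_fun [set: S] (fun x => gamma D x k 0)
}.

Record B1 : Prop := MkB1 {
  step_meas : forall h, (1 <= h <= H)%N -> measurable_fun [set: S * A * E] (step D h) ;
  transE : forall h z B, (1 <= h <= H)%N -> measurable B ->
    trans D h z B = PE D [set e | B (step D h (z, e))] ;
  norm2P : is_norm_R2 (norm2 D) ;
  LK_ge0 : 0 <= LK D ;
  step_lip : forall h z z' e, (1 <= h <= H)%N ->
    mdist (step D h (z, e)) (step D h (z', e)) <= LK D * rho z z'
}.

Record B2 : Prop := MkB2 {
  reward_bd : forall h z, (h < H)%N -> `|reward D h z| <= Rmax D ;
  term_bd : forall x, `|term D x| <= Rmax D ;
  LR_ge0 : 0 <= LR D ;
  reward_lip : forall h x x' a, (h < H)%N ->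
    `|reward D h (x, a) - reward D h (x', a)| <= LR D * mdist x x'
}.

Record B3 : Prop := MkB3 {
  trans_ac : forall h z, (1 <= h <= H)%N -> trans D h z `<< mu D h ;
  Sigma_pr_unit : forall h, (h < H)%N -> Sigma_pr h \in unitmx ;
  (* the norm of a column vector is the sup norm *)
  Sigma_pr_bd : forall h x, (h < H)%N ->
    `|invmx (Sigma_pr h) *m gamma D x| <= Lambda_pr D ;
  Lgamma_gt0 : 0 < Lgamma D ;
  gamma_lip : forall x x', enorm (gamma D x - gamma D x') <= Lgamma D * mdist x x'
}.

Record B4 : Prop := MkB4 {
  psi_L2 : forall k, (fun e => psi D e k 0) \in Lfun (PE D) 2%:E ;
  psi_centered : forall k, \int[PE D]_e psi D e k 0 = 0 ;
  Sigma_du_unit : Sigma_du \in unitmx ;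
  Sigma_du_bd : forall e, `|invmx Sigma_du *m psi D e| <= Lambda_du D ;
  psi_varrho : (\int[PE D]_e (enorm (psi D e) ^+ 2)%:E <= (varrho D ^+ 2)%:E)%E
}.

(* [joint_law] says that the pairs [(prX h i, prE h i)] have law [mu h \x PE],
   that the [duE t m] have law [PE], and that all these draws (including the two
   components of each pair) are mutually independent: the joint law agrees with
   the product measure on measurable rectangles. *)
Record simulation : Prop := Simulation {
  prX_meas : forall h i, (h < H)%N -> measurable_fun [set: Omega] (prX D h i) ;
  prE_meas : forall h i, (h < H)%N -> measurable_fun [set: Omega] (prE D h i) ;
  duE_meas : forall t m, (1 <= t <= H)%N -> measurable_fun [set: Omega] (duE D t m) ;
  joint_law : forall (BX : nat -> 'I_(n_pr D) -> set S) (BE : nat -> 'I_(n_pr D) -> set E)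
      (BD : nat -> 'I_(n_du D) -> set E),
    (forall h i, measurable (BX h i)) -> (forall h i, measurable (BE h i)) ->
    (forall t m, measurable (BD t m)) ->
    PP D [set w |
        (forall h i, (h < H)%N -> BX h i (prX D h i w) /\ BE h i (prE D h i w)) /\
        (forall t m, (1 <= t <= H)%N -> BD t m (duE D t m w))] =
    ((\prod_(0 <= h < H) \prod_(i < n_pr D) (mu D h (BX h i) * PE D (BE h i))) *
     (\prod_(1 <= t < H.+1) \prod_(m < n_du D) PE D (BD t m)))%E
}.

Definition Ltilde (h : nat) : R := (H - h).+1%:R * Rmax D.
Definition Vmax : R := Ltilde 0.
Definition trunc (l r : R) : R := Num.max (- l) (Num.min l r).

(* [W] is the approximation of the value function at time [h + 1]. *)
Definition beta (W : S -> Omega -> R) (h : nat) (a : A) (w : Omega) : 'cV[R]_(Kpr D) :=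
  (n_pr D)%:R^-1 *: \sum_(i < n_pr D)
    W (step D h.+1 (prX D h i w, a, prE D h i w)) w *:
      (invmx (Sigma_pr h) *m gamma D (prX D h i w)).

Definition primal_objective (W : S -> Omega -> R) (h : nat) (x : S) (a : A)
    (w : Omega) : R :=
  reward D h (x, a) + trunc (Ltilde h.+1) (dot (beta W h a w) (gamma D x)).

(* The product of the sigma-algebra of S and of the one generated by the primal
   draws of the stages h, ..., H-1. *)
Definition stage_sigma (h : nat) : set (set (S * Omega)) :=
  <<s [set B | (exists2 U, measurable U & B = U `*` [set: Omega]) \/
         exists j (i : 'I_(n_pr D)), (h <= j < H)%N /\
         ((exists2 U, measurable U & B = [set: S] `*` (prX D j i @^-1` U)) \/
          (exists2 U, measurable U & B = [set: S] `*` (prE D j i @^-1` U)))] >>.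

(* The supremum over actions is an essential supremum, hence determines
   [V h x] only almost surely for each [x]. To be evaluated at random states,
   [V h] is required to be a jointly measurable function of the state and of
   the draws on which the recursion makes it depend. *)
Record primal_approximation (V : nat -> S -> Omega -> R) : Prop :=
  PrimalApproximation {
  primal_term : forall x w, V H x w = term D x ;
  primal_meas : forall h, (h < H)%N -> forall B : set R, measurable B ->
    stage_sigma h ((fun z => V h z.1 z.2) @^-1` B) ;
  primal_rec : forall h, (h < H)%N -> forall x,
    is_ess_sup (PP D) (fun a w => (primal_objective (V h.+1) h x a w)%:E)
      (fun w => (V h x w)%:E)
}.

Definition LV : R :=
  LR D + Vmax * Lambda_pr D * Lgamma D * Num.sqrt (Kpr D)%:R.

Definition c_dual (V : nat -> S -> Omega -> R) (t : nat) (z : S * A) (w : Omega) :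
    'cV[R]_(Kdu D) :=
  (n_du D)%:R^-1 *: \sum_(m < n_du D)
    V t.+1 (step D t.+1 (z, duE D t.+1 m w)) w *: (invmx Sigma_du *m psi D (duE D t.+1 m w)).

Definition Linterp : R := LV * LK D * Lambda_du D.

Definition grid (i : 'I_(n_grid D) * 'I_(n_grid D)) : S * A := (gridS D i.1, gridA D i.2).

Definition c_interp (V : nat -> S -> Omega -> R) (t : nat) (z : S * A) (w : Omega) :
    'cV[R]_(Kdu D) :=
  \col_k central_interpolant rho grid Linterp (fun z' => c_dual V t z' w k 0) z.

Definition eta_tilde (V : nat -> S -> Omega -> R) (t : nat) (z : S * A) (e : E)
    (w : Omega) : R :=
  dot (c_interp V t z w) (psi D e).

Definition proj_error (t : nat) (z : S * A) (c : 'cV[R]_(Kdu D)) : \bar R :=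
  (\int[PE D]_e ((Vstar t.+1 (step D t.+1 (z, e)) - dot c (psi D e)) ^+ 2)%:E)%E.

(* The minimizer, which exists and is unique as [Sigma_du] is invertible. *)
Definition c_proj (t : nat) (z : S * A) : 'cV[R]_(Kdu D) :=
  xget 0 [set c | forall c', (proj_error t z c <= proj_error t z c')%E].

Definition eta (t : nat) (z : S * A) (e : E) : R := dot (c_proj t z) (psi D e).

Definition density_norm (h : nat) (z : S * A) : \bar R :=
  ('N[mu D h]_(+oo)
    [Radon_Nikodym (charge_of_finite_measure (kernel_at (trans D h) z)) (mu D h)])%E.

Definition primal_error (V : nat -> S -> Omega -> R) (h : nat) : \bar R :=
  ('N[mu D h \x PP D]_(2%:E)[(fun z => (Vstar h z.1 - V h z.1 z.2)%:E)])%E.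

(* The interpolant with constant [Linterp] is meant for [Linterp]-Lipschitz
   functions. For [t + 1 < H] this holds up to modification as [V t.+1] inherits
   regularity from the rewards and from the primal basis, but for [t + 1 = H]
   it is a condition on the terminal reward, whose regularity is not part of
   [B2]. *)
Definition interpolable (V : nat -> S -> Omega -> R) (t : nat) : Prop :=
  {ae PP D, forall w, forall k,
     lipschitz_wrt rho Linterp (fun z => c_dual V t z w k 0)}.

Definition squared_error (V : nat -> S -> Omega -> R) (t : nat) (z : S * A)
    (ew : E * Omega) : \bar R :=
  (`|eta t z ew.1 - eta_tilde V t z ew.1 ew.2| ^+ 2)%:E.

Definition error_bound (V : nat -> S -> Omega -> R) (t : nat) : \bar R :=
  ((varrho D ^+ 2)%:E *
     ((Kdu D)%:R%:E *
      ((LV * LK D)%:E * entropy_integral rho + (LV * LK D)%:E * diameter rho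
        + Vmax%:E) ^+ 2 * (Lambda_du D ^+ 2)%:E * ((n_du D)%:R^-1)%:E)
   + ((Kdu D)%:R * Lambda_du D ^+ 2 * varrho D ^+ 2)%:E *
     ereal_sup [set density_norm t.+1 z | z in [set: S * A]] *
     primal_error V t.+1 ^+ 2
   + ((Kdu D)%:R * varrho D ^+ 2 * LV ^+ 2 * LK D ^+ 2 * Lambda_du D ^+ 2)%:E *
     covering_radius rho grid ^+ 2)%E.

End theory.

(* Main.v *)
(* By [c_dual], [mean] and [c_proj] the error of each coefficient splits into three parts.

   (1) The Monte Carlo error of [c_dual] is an empirical process indexed by the
   state-action pairs. Given the primal draws, its increments are centered averages
   of independent variables bounded by [Linterp D * rho D z z'], hence sub-Gaussian,
   and Dudley's chaining bounds the second moment of its supremum. The norm on R^2 need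
   not be monotone, so [rho D] may violate the triangle inequality, but the process
   itself does not and this is all that chaining needs. When [t.+1] is the horizon,
   the increments are bounded because otherwise all the draws would make the Lipschitz
   bound on [c_dual] fail with positive probability.

   (2) The bias due to the primal error is controlled by Cauchy-Schwarz and by a change
   of measure from the transition kernel to [mu D t.+1].

   (3) The interpolation error at a point only involves finitely many Lipschitz
   bounds, which hold almost surely.

   The sum of the three bounds is a measurable function that dominates the squared
   error almost surely at each state-action pair, hence dominates the essential
   supremum. *)
From HB Require Import structures.
Require Import Defs.
From mathcomp Require Import all_boot all_order all_algebra.
From mathcomp Require Import all_classical all_reals all_analysis measurable_realfun.
From mathcomp Require Import ess_sup_inf ring lra.

Set Implicit Arguments.
Unset Strict Implicit.
Unset Printing Implicit Defensive.

Import Order.TTheory GRing.Theory Num.Theory.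
Import numFieldNormedType.Exports.

Local Open Scope classical_set_scope.
Local Open Scope ring_scope.

(** * Independent draws *)

(** The supremum over state-action pairs is an essential one, so each bound is an almost sure
    inequality at one pair at a time, against a random variable that does not depend on the pair.
    The exceptional null set may move with the pair and no pathwise supremum is formed; null sets
    are only united over finite nets, grids and draws.

    Conditioning on the past is done without conditional expectations. A function of a fresh draw
    and of the past is measurable on [E * Og], where [Og] is [Omega] with the sigma-algebra
    generated by the past, and independence makes the law of such a pair a product.

    The primal recursion yields bounds and Lipschitz estimates that hold almost surely at fixed
    states only. The product law carries them over to random states, and truncation at [Vmax D]
    replaces the almost sure bound on the value function by one valid everywhere, as integrability
    and exponential moments require. *)

Section decoupling.
Local Open Scope ereal_scope.
Context d d' (Omega : measurableType d) (E : measurableType d') (R : realType).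
Variables (P : probability Omega R) (Q : probability E R) (eps : Omega -> E).
Variable G : set (set Omega).
Hypothesis meps : measurable_fun [set: Omega] eps.
Hypothesis Gm : G `<=` measurable.
Hypothesis GT : G [set: Omega].
Hypothesis GI : setI_closed G.
Hypothesis indep : forall A B, measurable A -> G B ->
  P (eps @^-1` A `&` B) = Q A * P B.

Local Notation Og := (g_sigma_algebraType G).

Lemma sub_g_sigma_algebra B : (<<s G >>) B -> measurable B.
Proof. by apply: smallest_sub => //; exact: sigma_algebra_measurable. Qed.

Lemma measurable_id_g_sigma_algebra : measurable_fun [set: Omega] (id : Omega -> Og).
Proof. by move=> _ B mB; rewrite setTI; exact: sub_g_sigma_algebra. Qed.

(** For fixed [A] both sides are finite measures in [B]. They agree on the pi-system [G], which
    contains the whole space, hence on the sigma-algebra it generates. *)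
Lemma indep_g_sigma_algebra A B : measurable A -> (<<s G >>) B ->
  P (eps @^-1` A `&` B) = Q A * P B.
Proof.
move=> mA sB.
have mepsA : measurable (eps @^-1` A) by rewrite -[X in measurable X]setTI; exact: meps.
have Q0 : (0 <= fine (Q A))%R by rewrite fine_ge0.
pose m1 := mrestr P mepsA.
pose m2 := mscale (NngNum Q0) P.
have m2E C : m2 C = Q A * P C by rewrite /m2 /mscale /= fineK// fin_num_measure.
have : m1 B = m2 B.
  apply: (@g_sigma_algebra_measure_unique _ _ _ G Gm (fun=> setT)) => //.
  - by rewrite bigcup_const.
  - by move=> C GC; rewrite [RHS]m2E -indep// /= /mrestr setIC.
  - move=> _; rewrite /= /mrestr; apply: le_lt_trans (probability_le1 P _) (ltry 1).
    exact: measurableI.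
by move=> mE; rewrite -m2E -mE /m1 /mrestr setIC.
Qed.

(** By independence the joint law of [eps] and of the identity into [Og] is the product of [Q] and
    the restriction of [P] to the generated sigma-algebra, and Tonelli's theorem applies. Typing the
    second argument by [Og] is what says that [g] sees only the past. *)
Lemma decouple (g : E * Og -> \bar R) : measurable_fun [set: E * Og] g ->
  (forall x, 0 <= g x) ->
  \int[P]_w g (eps w, w) = \int[P]_w \int[Q]_e g (e, w).
Proof.
move=> mg g0.
pose idm : {mfun Omega >-> Og} :=
  HB.pack (id : Omega -> Og) (isMeasurableFun.Build _ _ _ _ _ measurable_id_g_sigma_algebra).
pose Pg : probability Og R := distribution P idm.
have mpair : measurable_fun [set: Omega] (fun w => (eps w, w : Og)).
  by apply/measurable_fun_pairP; split => //; exact: measurable_id_g_sigma_algebra.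
pose pairm : {mfun Omega >-> (E * Og)%type} :=
  HB.pack (fun w => (eps w, w : Og)) (isMeasurableFun.Build _ _ _ _ _ mpair).
pose Ppair : probability (E * Og)%type R := distribution P pairm.
have PpairE X : measurable X -> (Q \x Pg) X = Ppair X.
  apply: product_measure_unique => A B mA mB.
  by rewrite /Ppair /Pg /distribution /pushforward -indep_g_sigma_algebra.
transitivity (\int[Ppair]_x g x).
  by rewrite /Ppair /distribution ge0_integral_pushforward.
transitivity (\int[Q \x Pg]_x g x).
  by apply: eq_measure_integral => X mX _; exact/esym/PpairE.
rewrite fubini_tonelli2//.
rewrite /Pg /distribution ge0_integral_pushforward //.
  exact: measurable_fun_fubini_tonelli_G.
by move=> w _; apply: integral_ge0 => e _.
Qed.

End decoupling.

Lemma measurable_map_snd d1 d2 d3 (T : measurableType d1) (X : measurableType d2)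
    (Y : measurableType d3) (f : X -> Y) : measurable_fun [set: X] f ->
  measurable_fun [set: T * X] (fun x => (x.1, f x.2)).
Proof.
move=> mf; apply: measurable_fun_pair; first exact: measurable_fst.
exact: (measurableT_comp mf measurable_snd).
Qed.

(* [G m] generates the information available before the [m]-th draw. *)
Record iid_draws d d' (Omega : measurableType d) (E : measurableType d') (R : realType)
    (P : probability Omega R) (Q : probability E R) (M : nat) (eps : 'I_M -> Omega -> E)
    (G : nat -> set (set Omega)) : Prop := IidDraws {
  draw_meas : forall m, measurable_fun [set: Omega] (eps m) ;
  gen_meas : forall n, G n `<=` measurable ;
  gen_setT : forall n, G n [set: Omega] ;
  gen_setI : forall n, setI_closed (G n) ;
  gen_mono : forall n, G 0%N `<=` G n ;
  gen_draw : forall (m : 'I_M) n A, (m < n)%N -> measurable A -> G n (eps m @^-1` A) ;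
  draw_indep : forall (m : 'I_M) A B, measurable A -> G m B ->
    P (eps m @^-1` A `&` B) = (Q A * P B)%E
}.

Arguments draw_meas {d d' Omega E R P Q M eps G}.
Arguments gen_meas {d d' Omega E R P Q M eps G}.
Arguments gen_setT {d d' Omega E R P Q M eps G}.
Arguments gen_setI {d d' Omega E R P Q M eps G}.
Arguments gen_mono {d d' Omega E R P Q M eps G}.
Arguments gen_draw {d d' Omega E R P Q M eps G}.
Arguments draw_indep {d d' Omega E R P Q M eps G}.

Section sampling.
Local Open Scope ereal_scope.
Context d d' (Omega : measurableType d) (E : measurableType d') (R : realType).
Variables (P : probability Omega R) (Q : probability E R) (M : nat).
Variables (eps : 'I_M -> Omega -> E) (G : nat -> set (set Omega)).
Hypothesis draws : iid_draws P Q eps G.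

Local Notation Og n := (g_sigma_algebraType (G n)).

Lemma measurable_gen_mono n : measurable_fun [set: Og n] (id : Og n -> Og 0).
Proof.
move=> _ B mB; rewrite setTI; apply: (sub_smallest2r _ _ mB); last exact: gen_mono draws n.
exact: smallest_sigma_algebra.
Qed.

Lemma measurable_gen_pair_mono d1 (T : measurableType d1) n (f : E * Omega -> T) :
  measurable_fun [set: E * Og 0] f -> measurable_fun [set: E * Og n] f.
Proof.
move=> mf.
have mid : measurable_fun [set: E * Og n] (fun x => (x.1, x.2 : Og 0)).
  exact: measurable_map_snd (@measurable_gen_mono n).
by apply: eq_measurable_fun (measurableT_comp mf mid) => -[].
Qed.

Lemma measurable_gen_pair d1 (T : measurableType d1) n (f : E * Omega -> T) :
  measurable_fun [set: E * Og n] f -> measurable_fun [set: E * Omega] f.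
Proof.
move=> mf.
have mid : measurable_fun [set: E * Omega] (fun x => (x.1, x.2 : Og n)).
  exact: measurable_map_snd (measurable_id_g_sigma_algebra (gen_meas draws n)).
by apply: eq_measurable_fun (measurableT_comp mf mid) => -[].
Qed.

Lemma measurable_draw d1 (T : measurableType d1) (f : E * Omega -> T) m :
  measurable_fun [set: E * Og 0] f -> measurable_fun [set: Omega] (fun w => f (eps m w, w)).
Proof.
move=> mf.
have mp : measurable_fun [set: Omega] (fun w => (eps m w, w)).
  by apply: measurable_fun_pair => //; exact: draw_meas draws m.
exact: (measurableT_comp (measurable_gen_pair mf) mp).
Qed.

Lemma integral_draw (g : E * Omega -> \bar R) m : measurable_fun [set: E * Og 0] g ->
  (forall x, 0 <= g x) ->
  \int[P]_w g (eps m w, w) = \int[P]_w \int[Q]_e g (e, w).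
Proof.
move=> mg g0; apply: (@decouple _ _ _ _ _ P Q (eps m) (G m)) => //.
- exact: draw_meas draws m.
- exact: gen_meas draws m.
- exact: gen_setT draws m.
- exact: gen_setI draws m.
- exact: draw_indep draws m.
- exact: measurable_gen_pair_mono.
Qed.

(** The draws are integrated out one at a time, the last one first. The product of the first [n]
    factors is measurable for [G n], so the next draw can be decoupled from it, and the inner
    integral is at most [c] whatever [w] is. *)
Lemma prod_draws_le (g : E * Omega -> R) (c : R) : measurable_fun [set: E * Og 0] g ->
  (forall x, 0 <= g x)%R -> (forall w, \int[Q]_e (g (e, w))%:E <= c%:E) ->
  \int[P]_w (\prod_(m < M) g (eps m w, w))%:E <= (c ^+ M)%:E.
Proof.
move=> mg g0 gc.
have c0 : (0 <= c)%R.
  rewrite -lee_fin (le_trans _ (gc point))//; apply: integral_ge0 => e _; exact: g0.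
(* Factors from [n] on are replaced by 1, so that the index type stays ['I_M] during the
   induction. *)
pose Pi n w := (\prod_(m < M) if (m < n)%N then g (eps m w, w) else 1)%R.
have Pi0 n w : (0 <= Pi n w)%R by apply: prodr_ge0 => m _; case: ifP.
suff H n : (n <= M)%N -> \int[P]_w (Pi n w)%:E <= (c ^+ n)%:E.
  have := H M (leqnn M); congr (_ <= _); apply: eq_integral => w _.
  by congr EFin; apply: eq_bigr => m _; rewrite ltn_ord.
elim: n => [_|n IH nM].
  rewrite expr0 (eq_integral (cst 1%E)); first by rewrite integral_cst//= probability_setT mule1.
  by move=> w _; rewrite /Pi big1.
pose n' := Ordinal nM.
have mPi : measurable_fun [set: Og n] (Pi n).
  apply: measurable_prod => m _; case: (boolP (m < n)%N) => mn; last exact: measurable_cst.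
  have mp : measurable_fun [set: Og n] (fun w => (eps m w, w : Og n)).
    apply: measurable_fun_pair => // _ A mA; rewrite setTI; apply: sub_sigma_algebra.
    exact: (gen_draw draws).
  exact: (measurableT_comp (measurable_gen_pair_mono mg) mp).
pose h (x : E * Omega) := ((Pi n x.2)%:E * (g x)%:E).
have PiE w : (Pi n.+1 w)%:E = h (eps n' w, w).
  rewrite /h -EFinM; congr EFin; rewrite /Pi (bigD1 n')//= ltnSn mulrC; congr (_ * _)%R.
  rewrite [RHS](bigD1 n')//= ltnn mul1r; apply: eq_bigr => m mn.
  by rewrite ltnS leq_eqVlt -[X in X || _]/(m == n' :> nat) val_eqE (negbTE mn).
under eq_integral do rewrite PiE.
have mh : measurable_fun [set: E * Og n] h.
  apply: emeasurable_funM; apply/measurable_EFinP.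
    exact: (measurableT_comp mPi).
  exact: measurable_gen_pair_mono.
rewrite (@decouple _ _ _ _ _ P Q (eps n') (G n))//.
- apply: (@le_trans _ _ (\int[P]_w ((Pi n w)%:E * c%:E))); last first.
    rewrite ge0_integralZr//.
    + rewrite exprS EFinM muleC; apply: lee_wpmul2l => //.
      by apply: IH; exact: ltnW.
    + apply/measurable_EFinP; exact: (measurableT_comp mPi (measurable_id_g_sigma_algebra (gen_meas draws n))).
    + by move=> w _; rewrite lee_fin.
  apply: ge0_le_integral => //.
  + by move=> w _; apply: integral_ge0 => e _; rewrite /h mule_ge0// lee_fin.
  + apply: (@measurable_fun_fubini_tonelli_G _ _ _ _ _ Q h).
    * exact: measurable_gen_pair mh.
    * by move=> x; rewrite /h mule_ge0// lee_fin.
  + apply: emeasurable_funM => //; apply/measurable_EFinP.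
    exact: (measurableT_comp mPi (measurable_id_g_sigma_algebra (gen_meas draws n))).
  + move=> w _; rewrite /h/= ge0_integralZl//.
    * by apply: lee_wpmul2l; rewrite ?lee_fin.
    * apply/measurable_EFinP; apply: (measurableT_comp (measurable_gen_pair mg)).
      exact: measurable_fun_pair.
    * by move=> e _; rewrite lee_fin.
    * by rewrite lee_fin.
- exact: draw_meas draws n'.
- exact: gen_meas draws n.
- exact: gen_setT draws n.
- exact: gen_setI draws n.
- exact: draw_indep draws n'.
- by move=> x; rewrite /h mule_ge0// lee_fin.
Qed.

End sampling.

(** * Null sets in products of probability spaces *)

Lemma ae_forall_fin d (T : measurableType d) (R : realType)
    (mu : {measure set T -> \bar R}) (I : finType) (A : I -> set T) :
  (forall i, {ae mu, forall x, A i x}) -> {ae mu, forall x, forall i, A i x}.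
Proof. by move=> H; apply: filter_forall. Qed.

Section product_ae.
Local Open Scope ereal_scope.
Context d d' (Omega : measurableType d) (E : measurableType d') (R : realType).
Variables (P : probability Omega R) (Q : probability E R).

Lemma ae_measure0 d1 (T : measurableType d1) (mu : {measure set T -> \bar R}) (A : set T) :
  measurable A -> {ae mu, forall x, A x} -> mu (~` A) = 0.
Proof.
move=> mA [N [mN N0 AN]]; apply/eqP; rewrite eq_le measure_ge0 andbT -N0.
by apply: le_measure; rewrite ?inE//; exact: measurableC.
Qed.

Lemma integral_section0 (A : set (E * Omega)) : measurable A ->
  {ae Q \x P, forall x, A x} ->
  \int[P]_w \int[Q]_e (\1_(~` A) (e, w) : R)%:E = 0.
Proof.
move=> mA /(ae_measure0 mA) A0.
rewrite -[RHS]A0 -[X in _ = _ X]setIT -integral_indic//; last exact: measurableC.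
rewrite fubini_tonelli2//.
by apply/measurable_EFinP; apply: measurable_indic; exact: measurableC.
Qed.

(** By Tonelli the indicator of the complement, whose integral is zero, has almost all its sections
    of integral zero. *)
Lemma ae_integral_indic0 (A : set (E * Omega)) : measurable A ->
  {ae Q \x P, forall x, A x} -> {ae P, forall w, {ae Q, forall e, A (e, w)}}.
Proof.
move=> mA AE; have mCA : measurable (~` A) by exact: measurableC.
have mind : measurable_fun [set: E * Omega] (fun x => (\1_(~` A) x : R)%:E).
  by apply/measurable_EFinP; exact: measurable_indic.
have mf : measurable_fun [set: Omega] (fun w => \int[Q]_e (\1_(~` A) (e, w) : R)%:E).
  exact: (@measurable_fun_fubini_tonelli_G _ _ _ _ _ Q (fun x => (\1_(~` A) x : R)%:E)).
have f0 w : 0 <= \int[Q]_e (\1_(~` A) (e, w) : R)%:E by exact: integral_ge0.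
have /(ae_eq_integral_abs P measurableT mf) : \int[P]_w `|\int[Q]_e (\1_(~` A) (e, w) : R)%:E| = 0.
  by under eq_integral do rewrite gee0_abs//; exact: integral_section0.
apply: filterS => w /(_ Logic.I) Aw.
have ms : measurable [set e | (~` A) (e, w)].
  have := measurable_ysection w mCA; congr measurable; apply/seteqP; split => e /=; rewrite /ysection/= inE//.
exists [set e | (~` A) (e, w)]; split => //.
by rewrite -[X in Q X]setIT -integral_indic// -[RHS]Aw; apply: eq_integral => e _.
Qed.

(** The null set may depend on [e]: every section of the complement is null, hence so is the
    complement. Combined with [ae_draw], this lets a property known almost surely at each fixed
    point be used at a random point. *)
Lemma ae_prod_section (A : set (E * Omega)) : measurable A ->
  (forall e, {ae P, forall w, A (e, w)}) -> {ae Q \x P, forall x, A x}.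
Proof.
move=> mA AE; exists (~` A); split => //; first exact: measurableC.
rewrite /product_measure1/= integral0_eq// => e _ /=.
rewrite (_ : xsection (~` A) e = ~` [set w | A (e, w)]); last first.
  by apply/seteqP; split => w /=; rewrite /xsection/= inE.
apply: ae_measure0 (AE e); have := measurable_xsection e mA; congr measurable.
by apply/seteqP; split => w /=; rewrite /xsection/= inE.
Qed.

Lemma ae_prod_fst (A : set E) :
  {ae Q, forall e, A e} -> {ae Q \x P, forall x, A x.1}.
Proof.
move=> [N [mN N0 AN]]; exists (N `*` setT); split.
- exact: measurableX.
- by rewrite product_measure1E// [X in X * _]N0 mul0e.
- by move=> x /= nA; split => //; apply: AN.
Qed.

Lemma ae_prod_snd (A : set Omega) :
  {ae P, forall w, A w} -> {ae Q \x P, forall x, A x.2}.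
Proof.
move=> [N [mN N0 AN]]; exists (setT `*` N); split.
- exact: measurableX.
- by rewrite product_measure1E// [X in _ * X]N0 mule0.
- by move=> x /= nA; split => //; apply: AN.
Qed.

End product_ae.

(** * Sub-Gaussian maxima of empirical processes *)

Section exponential_inequalities.
Context {R : realType}.
Implicit Types x y b l : R.

(** When averaged over a centered variable, the linear term disappears. For [x > 1] it is enough
    that [x <= 2 * x ^+ 2]. For [x <= 1], [1 - x / 2 <= expR (- (x / 2))] bounds [expR x] by the
    inverse of [(1 - x / 2) ^+ 2], and the rest is a polynomial inequality. *)
Lemma expR_le_addr_expR_sqr x : expR x <= x + expR (2 * x ^+ 2).
Proof.
have [x1|x1] := leP x 1; last first.
  have : expR x <= expR (2 * x ^+ 2) by rewrite ler_expR; nra.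
  lra.
have h : 1 - x / 2 <= expR (- (x / 2)) by have := expR_ge1Dx (- (x / 2)); lra.
have e1 : 1 + 2 * x ^+ 2 <= expR (2 * x ^+ 2) by exact: expR_ge1Dx.
have p0 := expR_gt0 (x / 2).
have inv : expR (- (x / 2)) * expR (x / 2) = 1 by rewrite -expRD addNr expR0.
have ex : expR x = expR (x / 2) ^+ 2 by rewrite expr2 -expRD; congr expR; lra.
have : (1 - x / 2) * expR (x / 2) <= 1 by rewrite -[leRHS]inv ler_pM2r.
have : 1 <= (1 + x + 2 * x ^+ 2) * (1 - x / 2) ^+ 2.
  have -> : (1 + x + 2 * x ^+ 2) * (1 - x / 2) ^+ 2
    = 1 + x ^+ 2 * ((1 - x) * (5 - 2 * x)) / 4 by field.
  by rewrite lerDl divr_ge0// mulr_ge0 ?sqr_ge0// mulr_ge0//; lra.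
move: (expR (x / 2)) p0 ex => u u0 -> poly le1.
have pq : 0 < 1 - x / 2 by lra.
have le2 : ((1 - x / 2) * u) ^+ 2 <= 1 by rewrite expr_le1// mulr_ge0 ?ltW.
suff : u ^+ 2 <= 1 + x + 2 * x ^+ 2 by lra.
rewrite -(ler_pM2r (exprn_gt0 2 pq)); apply: le_trans poly.
by rewrite mulrC -exprMn.
Qed.

Lemma sqr_le_8expR y : 0 <= y -> 2 * y ^+ 2 <= 8 * expR y.
Proof.
move=> y0; have := expR_ge1Dx (y / 2).
have -> : expR y = expR (y / 2) ^+ 2 by rewrite expr2 -expRD; congr expR; lra.
by nra.
Qed.

End exponential_inequalities.

Section hoeffding.
Local Open Scope ereal_scope.
Context d (E : measurableType d) (R : realType) (Q : probability E R).

Lemma bounded_integrable (f : E -> R) (b : R) : measurable_fun [set: E] f ->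
  (forall e, `|f e| <= b)%R -> Q.-integrable [set: E] (EFin \o f).
Proof.
move=> mf fb; apply: measurable_bounded_integrable => //.
  by rewrite (le_lt_trans (probability_le1 _ _)) ?ltry.
exists b; split; first exact: num_real.
by move=> x bx e _; exact: le_trans (fb e) (ltW bx).
Qed.

Lemma normr_Rintegral_le (f : E -> R) (b : R) : measurable_fun [set: E] f ->
  (forall e, `|f e| <= b)%R -> (`| (\int[Q]_e f e)%R | <= b)%R.
Proof.
move=> mf fb; have If := bounded_integrable mf fb.
rewrite (le_trans (le_normr_Rintegral measurableT If))//.
apply: (@le_trans _ _ (\int[Q]_e b)%R).
  apply: le_Rintegral => //.
    by apply: (@bounded_integrable _ b) => [|e]; [exact: measurableT_comp|rewrite normr_id].
  exact: finite_measure_integrable_cst.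
by rewrite Rintegral_cst// [X in fine X]probability_setT/= mulr1.
Qed.

(** [expR_le_addr_expR_sqr] is integrated at [l * (f e - m)]. Since [f] stays within [2 * b] of its
    mean [m], the exponent is at most [2 * l ^+ 2 * (2 * b) ^+ 2], whence the 8. *)
Lemma hoeffding (f : E -> R) (b l : R) : measurable_fun [set: E] f ->
  (forall e, `|f e| <= b)%R ->
  \int[Q]_e (expR (l * (f e - (\int[Q]_e f e)%R)))%:E <= (expR (8 * l ^+ 2 * b ^+ 2))%:E.
Proof.
move=> mf fb; set m := (\int[Q]_e f e)%R.
have If := bounded_integrable mf fb.
have mb : (`|m| <= b)%R by exact: normr_Rintegral_le.
pose x e := (l * (f e - m))%R.
have mx : measurable_fun [set: E] x.
  by apply: measurable_funM => //; exact: measurable_funB.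
pose c := expR (8 * l ^+ 2 * b ^+ 2).
have Ix : Q.-integrable [set: E] (EFin \o x).
  apply: (@bounded_integrable _ (`|l| * (b + b))%R) => // e.
  by rewrite normrM ler_wpM2l// (le_trans (ler_normB _ _))// lerD.
have ex e : (expR (x e) <= x e + c)%R.
  rewrite (le_trans (expR_le_addr_expR_sqr _))// lerD2l ler_expR /x.
  have := fb e; rewrite !ler_norml in mb * => /andP[f1 f2]; case/andP: mb => m1 m2.
  have sb : ((f e - m) ^+ 2 <= (2 * b) ^+ 2)%R.
    by rewrite -(real_normK (num_real (f e - m)%R)) ler_pXn2r ?nnegrE// ?ler_norml; lra.
  rewrite exprMn; have := sqr_ge0 l; move: sb; rewrite exprMn.
  by move: ((f e - m) ^+ 2)%R (l ^+ 2)%R (b ^+ 2)%R => s k q; nra.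
apply: (@le_trans _ _ (\int[Q]_e ((x e)%:E + c%:E))).
  apply: ge0_le_integral => //.
  - by apply/measurable_EFinP; exact: (measurableT_comp (@measurable_expR R) mx).
  - by apply: emeasurable_funD => //; apply/measurable_EFinP.
  - by move=> e _; rewrite -EFinD lee_fin; exact: ex.
rewrite integralD//; last first.
  exact: (finite_measure_integrable_cst Q c).
rewrite integral_cst// [X in _ * X]probability_setT mule1.
suff -> : \int[Q]_e (x e)%:E = 0 by rewrite add0e.
rewrite -[LHS]fineK; last exact: integrable_fin_num.
congr EFin; rewrite -/(Rintegral _ _ _) RintegralZl//; last first.
  apply: (@bounded_integrable _ (b + b)%R) => [|e]; first exact: measurable_funB.
  by rewrite (le_trans (ler_normB _ _))// lerD.
rewrite RintegralB//; last by apply: (@bounded_integrable _ b) => // e.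
by rewrite Rintegral_cst// [X in fine X]probability_setT/= mulr1 subrr mulr0.
Qed.

End hoeffding.

Section subgaussian_maximum.
Local Open Scope ereal_scope.
Context d (Omega : measurableType d) (R : realType) (P : probability Omega R).

Lemma subgaussian_max (I : finType) (i0 : I) (X : I -> Omega -> R) (s : R) : (0 < s)%R ->
  (forall i, measurable_fun [set: Omega] (X i)) ->
  (forall i l, \int[P]_w (expR (l * X i w))%:E <= (expR (l ^+ 2 * s ^+ 2 / 2))%:E) ->
  exists W : Omega -> R, [/\ measurable_fun [set: Omega] W, forall w, (0 <= W w)%R,
    forall i w, (X i w ^+ 2 <= W w)%R
    & \int[P]_w (W w)%:E <= (16 * s ^+ 2 * (1 + ln #|I|%:R))%:E].
Proof.
move=> s0 mX XE.
have I0 : (1 <= #|I|%:R :> R)%R by rewrite ler1n; apply/card_gt0P; exists i0.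
pose ell : R := (1 + ln #|I|%:R)%R.
have ell1 : (1 <= ell)%R by rewrite /ell lerDl ln_ge0.
(* The 1 in [ell] pays for the factor 2 of the two tails, as [2 <= expR 1]. *)
have Iell : (2 * #|I|%:R <= expR ell)%R.
  rewrite /ell expRD lnK ?posrE ?(lt_le_trans ltr01)//.
  by rewrite ler_wpM2r ?ler0n//; have := expR_ge1Dx (1 : R); lra.
pose q := Num.sqrt ell; have q1 : (1 <= q)%R by rewrite -sqrtr1 ler_wsqrtr.
have qE : (q ^+ 2 = ell)%R by rewrite sqr_sqrtr; lra.
(* Squares below the level [r] are bounded by [r ^+ 2], larger ones by exponentials of rate [l].
   Since [l * r = 2 * ell], the factor [expR (- (2 * ell))] in [k] outweighs the summed exponential
   moments, which are at most [expR (ell + ell / 2)]. Both parts of [W] then cost at most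
   [8 * s ^+ 2 * ell]. *)
pose l := (q / s)%R; pose r := (2 * s * q)%R.
have l0 : (0 < l)%R by rewrite divr_gt0//; lra.
have r0 : (0 <= r)%R by rewrite /r !mulr_ge0//; lra.
have lr : (l * r = 2 * ell)%R by rewrite /l /r -qE; field; rewrite gt_eqF.
pose k := (8 / l ^+ 2 * expR (- (2 * ell)))%R.
have k0 : (0 <= k)%R by rewrite /k mulr_ge0 ?expR_ge0// divr_ge0 ?sqr_ge0.
pose T i w := (expR (l * X i w) + expR (- l * X i w))%R.
have T0 i w : (0 <= T i w)%R by rewrite addr_ge0 ?expR_ge0.
have mT i : measurable_fun [set: Omega] (T i).
  by apply: measurable_funD; apply: (measurableT_comp (@measurable_expR R));
    exact: measurable_funM.
(* With [y = l * (x - r)], [x ^+ 2 <= 2 * r ^+ 2 + 2 * (x - r) ^+ 2] and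
   [2 * y ^+ 2 <= 8 * expR y] give the bound by [W] for [x >= r]. *)
pose W w := (2 * r ^+ 2 + k * \sum_i T i w)%R.
exists W; split.
- apply: measurable_funD => //; apply: measurable_funM => //.
  exact: measurable_sum.
- move=> w; apply: addr_ge0; first by rewrite mulr_ge0 ?sqr_ge0.
  by apply: mulr_ge0 => //; exact: sumr_ge0.
- move=> i w; apply: (@le_trans _ _ (2 * r ^+ 2 + k * T i w)%R); last first.
    by rewrite lerD2l ler_wpM2l// (bigD1 i)//= lerDl sumr_ge0.
  have tT : (expR (l * `|X i w|) <= T i w)%R.
    rewrite /T; have [x0|x0] := leP 0%R (X i w).
      by rewrite ger0_norm// lerDl expR_ge0.
    by rewrite ltr0_norm// mulrN -mulNr lerDr expR_ge0.
  rewrite -(real_normK (num_real (X i w))); move: tT; set t := `|X i w|%R => tT.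
  have t0 : (0 <= t)%R by exact: normr_ge0.
  have [tr|rt] := ltP t r.
    have : (t ^+ 2 <= r ^+ 2)%R by rewrite ler_pXn2r ?nnegrE// ltW.
    by have := mulr_ge0 k0 (T0 i w); have := sqr_ge0 r; lra.
  have y0 : (0 <= l * (t - r))%R by rewrite mulr_ge0 ?(ltW l0)// subr_ge0.
  have le8 := sqr_le_8expR y0.
  have kT : (8 / l ^+ 2 * expR (l * (t - r)) <= k * T i w)%R.
    rewrite /k -[leRHS]mulrA ler_wpM2l ?divr_ge0 ?sqr_ge0//.
    rewrite mulrBr lr addrC expRD ler_wpM2l ?expR_ge0//.
  have : (2 * (t - r) ^+ 2 <= 8 / l ^+ 2 * expR (l * (t - r)))%R.
    rewrite mulrAC ler_pdivlMr ?exprn_gt0//; move: le8; rewrite exprMn; lra.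
  by have := sqr_ge0 (t - 2 * r)%R; lra.
- rewrite (eq_integral (fun w => (2 * r ^+ 2)%:E + k%:E * \sum_i (T i w)%:E)); last first.
    by move=> w _; rewrite sumEFin -EFinM -EFinD.
  have mTE i : measurable_fun [set: Omega] (fun w => (T i w)%:E) by apply/measurable_EFinP.
  have TE0 i w : [set: Omega] w -> 0 <= (T i w)%:E by move=> _; rewrite lee_fin.
  rewrite ge0_integralD//; last 3 first.
  + by move=> w _; rewrite lee_fin mulr_ge0// sqr_ge0.
  + by move=> w _; rewrite mule_ge0//; apply: sume_ge0 => i _; exact: TE0.
  + by apply: emeasurable_funM => //; exact: emeasurable_sum.
  rewrite integral_cst//= [X in _ * X]probability_setT mule1.
  rewrite ge0_integralZl//; last 2 first.
  + exact: emeasurable_sum.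
  + by move=> w _; apply: sume_ge0 => i _; exact: TE0.
  rewrite ge0_integral_sum//.
  have TE i : \int[P]_w (T i w)%:E <= (2 * expR (ell / 2))%:E.
    have els : (l ^+ 2 * s ^+ 2 / 2 = ell / 2)%R.
      by rewrite -qE /l; field; rewrite gt_eqF.
    have mE c : measurable_fun [set: Omega] (fun w => (expR (c * X i w))%:E).
      by apply/measurable_EFinP; apply: (measurableT_comp (@measurable_expR R)); exact: measurable_funM.
    under eq_integral do rewrite EFinD.
    rewrite ge0_integralD//.
    rewrite mulr_natl mulr2n EFinD -els; apply: leeD; first exact: XE.
    by rewrite -(sqrrN l); exact: XE.
  apply: (@le_trans _ _ ((2 * r ^+ 2)%:E + k%:E * (#|I|%:R * (2 * expR (ell / 2)))%:E)).
    apply: leeD => //; apply: lee_wpmul2l => //.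
    apply: (le_trans (lee_sum _ (fun i _ => TE i))).
    by rewrite sumEFin sumr_const lee_fin -[leLHS]mulr_natl.
  rewrite -EFinM -EFinD lee_fin.
  have : (k * (#|I|%:R * (2 * expR (ell / 2))) <= 8 / l ^+ 2)%R.
    rewrite /k -[leLHS]mulrA -[leRHS]mulr1 ler_wpM2l ?divr_ge0 ?sqr_ge0//.
    rewrite [X in (_ * X)%R]mulrA [X in (_ * (X * _))%R]mulrC.
    apply: (@le_trans _ _ (expR (- (2 * ell)) * (expR ell * expR (ell / 2)))%R).
      by rewrite ler_wpM2l ?expR_ge0// ler_wpM2r ?expR_ge0.
    by rewrite -!expRD -[leRHS]expR0 ler_expR; lra.
  have -> : (8 / l ^+ 2 = 8 * s ^+ 2 / ell)%R.
    by rewrite -qE /l; field; rewrite !gt_eqF//; lra.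
  have -> : (2 * r ^+ 2 = 8 * s ^+ 2 * ell)%R by rewrite /r -qE; ring.
  have : (8 * s ^+ 2 / ell <= 8 * s ^+ 2 * ell)%R.
    rewrite ler_pdivrMr ?(lt_le_trans ltr01)//.
    have e2 : (1 <= ell * ell)%R by nra.
    by have := sqr_ge0 s; move: (s ^+ 2)%R => u u0; nra.
  rewrite -/ell; lra.
Qed.

End subgaussian_maximum.

Section empirical_process.
Local Open Scope ereal_scope.
Context d d' (Omega : measurableType d) (E : measurableType d') (R : realType).
Variables (P : probability Omega R) (Q : probability E R) (M : nat).
Variables (eps : 'I_M -> Omega -> E) (G : nat -> set (set Omega)).
Hypothesis draws : iid_draws P Q eps G.
Hypothesis M0 : (0 < M)%N.
Local Notation Og := (g_sigma_algebraType (G 0)).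

(** When [f] is measurable for [G 0] in its second argument, this is a version of the conditional
    expectation of [f (eps m w, w)] given the information before the draws. *)
Definition mean (f : E * Omega -> R) (w : Omega) : R := (\int[Q]_e f (e, w))%R.

Definition emp (f : E * Omega -> R) (w : Omega) : R :=
  (M%:R^-1 * \sum_(m < M) (f (eps m w, w) - mean f w))%R.

Lemma measurable_pairl (f : E * Omega -> R) w : measurable_fun [set: E * Og] f ->
  measurable_fun [set: E] (fun e => f (e, w)).
Proof.
move=> mf; apply: (measurableT_comp (measurable_gen_pair draws mf)).
exact: measurable_fun_pair.
Qed.

Lemma measurable_mean (f : E * Omega -> R) (b : R) : measurable_fun [set: E * Og] f ->
  (forall x, `|f x| <= b)%R -> measurable_fun [set: Og] (mean f).
Proof.
move=> mf fb.
(* The shift by [b] makes the integrand nonnegative, so that Tonelli's theorem gives measurability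
   in [w]. *)
have meanE w : mean f w = (fine (\int[Q]_e (f (e, w) + b)%:E) - b)%R.
  rewrite -/(Rintegral Q setT (fun e => f (e, w) + b)%R) RintegralD//.
  - by rewrite Rintegral_cst// [X in fine X]probability_setT/= mulr1 addrK.
  - by apply: (@bounded_integrable _ _ _ _ _ b) => //; exact: measurable_pairl.
  - exact: finite_measure_integrable_cst.
rewrite (_ : mean f = fun w => (fine (\int[Q]_e (f (e, w) + b)%:E) - b)%R); last exact/funext.
apply: measurable_funB => //; apply: (measurableT_comp (@fine_measurable R _ measurableT)).
apply: (@measurable_fun_fubini_tonelli_G _ _ _ _ _ Q (fun x : E * Og => (f x + b)%:E)).
- by apply/measurable_EFinP; exact: measurable_funD.
- by move=> x; rewrite lee_fin; have := fb x; rewrite ler_norml => /andP[]; lra.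
Qed.

Lemma measurable_emp (f : E * Omega -> R) (b : R) : measurable_fun [set: E * Og] f ->
  (forall x, `|f x| <= b)%R -> measurable_fun [set: Omega] (emp f).
Proof.
move=> mf fb; apply: measurable_funM => //; apply: measurable_sum => m.
apply: measurable_funB; first exact: (measurable_draw draws m mf).
exact: measurableT_comp (measurable_mean mf fb) (measurable_id_g_sigma_algebra (gen_meas draws 0)).
Qed.

Lemma emp_subgaussian (f : E * Omega -> R) (b l : R) : measurable_fun [set: E * Og] f ->
  (forall x, `|f x| <= b)%R ->
  \int[P]_w (expR (l * emp f w))%:E <= (expR (8 * l ^+ 2 * b ^+ 2 / M%:R))%:E.
Proof.
move=> mf fb; have M0R : (M%:R != 0 :> R)%R by rewrite pnatr_eq0 -lt0n.
pose g (x : E * Omega) : R := expR (l / M%:R * (f x - mean f x.2)).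
have -> : (expR (8 * l ^+ 2 * b ^+ 2 / M%:R) = expR (8 * (l / M%:R) ^+ 2 * b ^+ 2) ^+ M)%R.
  by rewrite -expRM_natl; congr expR; field.
have -> : \int[P]_w (expR (l * emp f w))%:E = \int[P]_w (\prod_(m < M) g (eps m w, w))%:E.
  apply: eq_integral => w _; congr EFin; rewrite /g -expR_sum -mulr_sumr /emp mulrA.
  by [].
apply: (prod_draws_le draws).
- apply: (measurableT_comp (@measurable_expR R)); apply: measurable_funM => //.
  apply: measurable_funB => //; exact: measurableT_comp (measurable_mean mf fb) _.
- by move=> x; exact: expR_ge0.
- by move=> w; apply: hoeffding => //; exact: measurable_pairl.
Qed.

Lemma emp_max (I : finType) (i0 : I) (F : I -> E * Omega -> R) (b : R) :
  (0 <= b)%R -> (forall i, measurable_fun [set: E * Og] (F i)) ->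
  (forall i x, `|F i x| <= b)%R ->
  exists W : Omega -> R, [/\ measurable_fun [set: Omega] W, forall w, (0 <= W w)%R,
    forall i w, (emp (F i) w ^+ 2 <= W w)%R
    & \int[P]_w (W w)%:E <= (256 * b ^+ 2 / M%:R * (1 + ln #|I|%:R))%:E].
Proof.
move=> b0 mF Fb; have M0R : (0 < M%:R :> R)%R by rewrite ltr0n.
have [b00|bN0] := eqVneq b 0%R.
  exists (cst 0%R); split => //.
  - move=> i w; have F0 x : F i x = 0%R by apply/eqP; rewrite -normr_le0 -b00.
    rewrite /emp big1 ?mulr0 ?expr0n//= => m _; rewrite F0 /mean.
    by under eq_Rintegral do rewrite F0; rewrite Rintegral_cst// mul0r subrr.
  - by rewrite integral0_eq// b00 expr0n/= mulr0 !mul0r.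
have bp : (0 < b)%R by rewrite lt_neqAle eq_sym bN0.
(* The exponent [8 * l ^+ 2 * b ^+ 2 / M%:R] of [emp_subgaussian] equals [l ^+ 2 * s ^+ 2 / 2] for
   this [s], and [16 * s ^+ 2] is then [256 * b ^+ 2 / M%:R]. *)
pose s := (4 * b / Num.sqrt M%:R)%R.
have sE : (s ^+ 2 = 16 * b ^+ 2 / M%:R)%R.
  by rewrite /s expr_div_n sqr_sqrtr ?ler0n// exprMn; congr (_ * _ / _)%R; ring.
have s0 : (0 < s)%R by rewrite divr_gt0 ?sqrtr_gt0// mulr_gt0.
have [||W [mW W0 XW WE]] := @subgaussian_max _ _ _ P I i0 (fun i => emp (F i)) s s0.
- by move=> i; exact: measurable_emp (mF i) (Fb i).
- move=> i l; apply: le_trans (emp_subgaussian l (mF i) (Fb i)) _.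
  by rewrite sE lee_fin ler_expR le_eqVlt; apply/orP; left; apply/eqP; field; rewrite gt_eqF.
exists W; split => //; apply: le_trans WE _.
by rewrite sE lee_fin le_eqVlt; apply/orP; left; apply/eqP; field; rewrite gt_eqF.
Qed.

End empirical_process.

Section truncation.
Context {R : realType}.
Implicit Types l x y : R.

Lemma normr_trunc_le l x : 0 <= l -> `|trunc l x| <= l.
Proof. by move=> l0; rewrite /trunc ler_norml le_max lexx/= ge_max ge_min lexx; lra. Qed.

Lemma trunc_id l x : `|x| <= l -> trunc l x = x.
Proof.
by rewrite ler_norml => /andP[h1 h2]; rewrite /trunc (min_idPr h2) (max_idPr h1).
Qed.

Lemma trunc_lip l x y : `|trunc l x - trunc l y| <= `|x - y|.
Proof.
have maxl (a u v : R) : `|Num.max a u - Num.max a v| <= `|u - v|.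
  have := ler_norm (u - v); have := ler_norm (- (u - v)); rewrite normrN.
  by case: (leP a u); case: (leP a v) => ? ? ? ?; rewrite ler_norml; apply/andP; split; lra.
have minl (a u v : R) : `|Num.min a u - Num.min a v| <= `|u - v|.
  have := ler_norm (u - v); have := ler_norm (- (u - v)); rewrite normrN.
  by case: (leP a u); case: (leP a v) => ? ? ? ?; rewrite ler_norml; apply/andP; split; lra.
exact: le_trans (maxl _ _ _) (minl _ _ _).
Qed.

Lemma measurable_trunc d (T : measurableType d) (f : T -> R) l : measurable_fun [set: T] f ->
  measurable_fun [set: T] (fun t => trunc l (f t)).
Proof. by move=> mf; apply: measurable_maxr => //; exact: measurable_minr. Qed.

End truncation.

(** Weighted Cauchy-Schwarz, which replaces Minkowski's inequality in L^2 in the chaining: if each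
    [y i ^+ 2] has expectation at most [a i ^+ 2], the right-hand side has expectation at most the
    square of the sum of the [a i]. It expresses that the weighted deviation of [y] from its
    proportional part [a i * (s / S)] is nonnegative. *)
Lemma sqr_sum_le_weighted (R : realType) (n : nat) (a y : 'I_n -> R) :
  (forall i, 0 < a i) ->
  (\sum_i y i) ^+ 2 <= (\sum_i a i) * \sum_i y i ^+ 2 / a i.
Proof.
move=> a0; case: n => [|n] in a y a0 *; first by rewrite !big_ord0 expr0n/= mul0r.
set s := \sum_i y i; set S := \sum_i a i.
have S0 : 0 < S.
  by rewrite /S (bigD1 ord0)//= ltr_pwDl// sumr_ge0// => i _; exact: ltW.
have : 0 <= \sum_i (y i - a i * (s / S)) ^+ 2 / a i.
  by apply: sumr_ge0 => i _; rewrite divr_ge0 ?sqr_ge0// ltW.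
have -> : \sum_i (y i - a i * (s / S)) ^+ 2 / a i = \sum_i y i ^+ 2 / a i - s ^+ 2 / S.
  under eq_bigr => i _.
    rewrite (_ : _ / _ = y i ^+ 2 / a i - (y i * (2 * (s / S)) - a i * (s / S) ^+ 2)); last first.
      by field; rewrite !gt_eqF.
    over.
  rewrite sumrB; congr (_ - _); rewrite sumrB -!mulr_suml -/s -/S.
  by field; rewrite gt_eqF.
by rewrite subr_ge0 ler_pdivrMr// mulrC.
Qed.

Section empirical_process_ae.
Local Open Scope ereal_scope.
Context d d' (Omega : measurableType d) (E : measurableType d') (R : realType).
Variables (P : probability Omega R) (Q : probability E R) (M : nat).
Variables (eps : 'I_M -> Omega -> E) (G : nat -> set (set Omega)).
Hypothesis draws : iid_draws P Q eps G.
Hypothesis M0 : (0 < M)%N.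
Local Notation Og := (g_sigma_algebraType (G 0)).
Local Notation emp := (emp Q eps).

Lemma measurable_ae_pairs (A : set (E * Omega)) :
  measurable (A : set (E * Og)) -> measurable A.
Proof.
move=> mA.
have := measurable_gen_pair draws (@measurable_indic _ _ R setT _ mA).
move=> /(_ measurableT [set 1%R]) => /(_ (measurable_set1 _)); congr measurable.
apply/seteqP; split => x; rewrite setTI /=.
  by rewrite indicE; have [/set_mem|_ /eqP] := boolP (x \in A); rewrite ?[_ == 1%R]eq_sym ?oner_eq0.
by move=> Ax; rewrite indicE mem_set.
Qed.

(** On the events of [E * Og] a draw and the past have the law [Q \x P], so they almost surely avoid
    its null sets. *)
Lemma ae_draw (A : set (E * Omega)) m : measurable (A : set (E * Og)) ->
  {ae Q \x P, forall x, A x} -> {ae P, forall w, A (eps m w, w)}.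
Proof.
move=> mA AE.
have mind : measurable_fun [set: E * Og] (fun x => (\1_(~` A) x : R)%:E).
  by apply/measurable_EFinP; apply: measurable_indic; exact: measurableC.
have mAO := measurable_ae_pairs mA.
have f0 w : 0 <= (\1_(~` A) (eps m w, w) : R)%:E by rewrite lee_fin.
have mdraw := measurable_draw draws m mind.
have /(ae_eq_integral_abs P measurableT mdraw) : \int[P]_w `|(\1_(~` A) (eps m w, w) : R)%:E| = 0.
  under eq_integral do rewrite gee0_abs//.
  by rewrite (integral_draw draws m mind)//; exact: integral_section0.
apply: filterS => w /(_ Logic.I) /= [] /eqP; rewrite indicE; case: (boolP (_ \in _)) => //=.
  by rewrite oner_eq0.
by move=> /negP; rewrite inE /= => /contrapT.
Qed.

Lemma measurable_norm_le (f : E * Omega -> R) (c : R) : measurable_fun [set: E * Og] f ->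
  measurable ([set x | (`|f x| <= c)%R] : set (E * Og)).
Proof.
move=> mf; have mnf : measurable_fun [set: E * Og] (fun x => `|f x|%R).
  exact: measurableT_comp.
have := mnf measurableT _ (measurable_itv `]-oo, c]).
by congr measurable; apply/seteqP; split => x; rewrite setTI /= in_itv.
Qed.

Lemma empB (f g : E * Omega -> R) (b c : R) w :
  measurable_fun [set: E * Og] f -> measurable_fun [set: E * Og] g ->
  (forall x, `|f x| <= b)%R -> (forall x, `|g x| <= c)%R ->
  emp (fun x => f x - g x)%R w = (emp f w - emp g w)%R.
Proof.
move=> mf mg fb gc; rewrite /emp -mulrBr -sumrB; congr (_ * _)%R; apply: eq_bigr => m _.
rewrite /mean RintegralB//; first ring.
- by apply: (@bounded_integrable _ _ _ _ _ b) => //; exact: (measurable_pairl draws).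
- by apply: (@bounded_integrable _ _ _ _ _ c) => //; exact: (measurable_pairl draws).
Qed.

Lemma normr_emp_le (f : E * Omega -> R) (b : R) w : measurable_fun [set: E * Og] f ->
  (forall x, `|f x| <= b)%R -> (`|emp f w| <= 2 * b)%R.
Proof.
move=> mf fb; have M0R : (0 < M%:R :> R)%R by rewrite ltr0n.
rewrite /emp normrM normfV (ger0_norm (ltW M0R)) mulrC ler_pdivrMr//.
apply: le_trans (ler_norm_sum _ _ _) _.
apply: (@le_trans _ _ (\sum_(m < M) 2 * b)%R); last by rewrite sumr_const card_ord mulr_natr.
apply: ler_sum => m _; apply: le_trans (ler_normB _ _) _; rewrite mulr_natl mulr2n lerD//.
by apply: normr_Rintegral_le => //; exact: (measurable_pairl draws).
Qed.

(** Almost surely, truncating [f] at [c] changes neither its values at the draws nor its mean, and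
    the truncated function is bounded by [c] everywhere. *)
Lemma emp_ae_small (f : E * Omega -> R) (b c : R) : (0 <= c)%R ->
  measurable_fun [set: E * Og] f -> (forall x, `|f x| <= b)%R ->
  {ae Q \x P, forall x, (`|f x| <= c)%R} -> {ae P, forall w, (`|emp f w| <= 2 * c)%R}.
Proof.
move=> c0 mf fb fc.
have mg : measurable_fun [set: E * Og] (fun x => trunc c (f x)) by exact: measurable_trunc.
have gb x : (`|trunc c (f x)| <= c)%R by exact: normr_trunc_le.
have mA := measurable_norm_le c mf.
have D1 : {ae P, forall w, forall m : 'I_M, trunc c (f (eps m w, w)) = f (eps m w, w)}.
  apply: filterS (ae_forall_fin (fun m => ae_draw m mA fc)) => w H m.
  exact: trunc_id (H m).
have D2 : {ae P, forall w, mean Q (fun x => trunc c (f x)) w = mean Q f w}.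
  have := ae_integral_indic0 (measurable_ae_pairs mA) fc; apply: filterS => w H.
  congr fine; apply: ae_eq_integral => //.
  - by apply/measurable_EFinP; exact: (measurable_pairl draws w mg).
  - by apply/measurable_EFinP; exact: (measurable_pairl draws w mf).
  - by apply: filterS H => e /= H _; rewrite trunc_id.
apply: filterS2 D1 D2 => w H1 H2.
have -> : emp f w = emp (fun x => trunc c (f x)) w.
  rewrite /emp; congr (_ * _)%R; apply: eq_bigr => m _.
  by rewrite H1 H2.
exact: normr_emp_le.
Qed.

End empirical_process_ae.

(** * Entropy and chaining *)

(* Unlike [ge0_le_integral], no measurability is required: the integral of a
   nonnegative function is a supremum over the simple functions below it. *)
Lemma ge0_le_integral_nomeas d (T : measurableType d) (R : realType)
    (mu : {measure set T -> \bar R}) (D : set T) (f g : T -> \bar R) :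
  (forall x, D x -> (0 <= f x)%E) -> (forall x, D x -> (f x <= g x)%E) ->
  (\int[mu]_(x in D) f x <= \int[mu]_(x in D) g x)%E.
Proof.
move=> f0 fg; rewrite !ge0_integralE//; last first.
  by move=> x Dx; exact: le_trans (f0 x Dx) (fg x Dx).
apply: le_ereal_sup => _ [h hf <-]; exists h => // x.
apply: le_trans (hf x) _; rewrite /patch; case: ifPn => // /set_mem; exact: fg.
Qed.

Section entropy.
Local Open Scope ereal_scope.
Context (R : realType) (T : Type) (rho : T -> T -> R) (z0 : T).
Local Notation cov := (covering_number rho).

Lemma covering_number_fin u : cov u < +oo ->
  exists n, ball_cover rho u n /\ cov u = n%:R%:E.
Proof.
move=> covfin.
have [n0 Bn0] : exists n, ball_cover rho u n.
  apply: contrapT => nB; move: covfin; rewrite /covering_number (_ : ball_cover rho u = set0).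
    by rewrite image_set0 ereal_inf0 ltxx.
  by apply/seteqP; split => // n Bn; apply: nB; exists n.
have exB : exists n, `[< ball_cover rho u n >] by exists n0; exact/asboolP.
case: (ex_minnP exB) => n /asboolP Bn minn; exists n; split => //.
apply/eqP; rewrite eq_le; apply/andP; split.
  by apply: ereal_inf_lbound; exists n.
apply: le_ereal_inf_tmp => _ [m Bm <-]; rewrite lee_fin ler_nat; apply: minn; exact/asboolP.
Qed.

Lemma covering_number_le u v : (u <= v)%R -> cov v <= cov u.
Proof.
move=> uv; apply: le_ereal_inf => _ [n [c cP] <-]; exists n => //; exists c => z.
by have [i ci] := cP z; exists i; exact: lt_le_trans uv.
Qed.

Lemma covering_number_ge1 u : 1 <= cov u.
Proof.
apply: le_ereal_inf_tmp => _ [[|n] [c cP] <-]; last by rewrite lee_fin ler1n.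
by have [[]] := cP z0.
Qed.

Let ent u := lne (cov u) `^ 2^-1.

Lemma sqrt_entropy_le u v : (u <= v)%R -> ent v <= ent u.
Proof.
move=> uv; have c1 w : 0 <= cov w by apply: le_trans (covering_number_ge1 w).
apply: gt0_ler_poweR; rewrite ?in_itv/= ?leey ?andbT ?lne_ge0 ?covering_number_ge1//.
by rewrite lee_lne ?in_itv/= ?c1 ?leey//; exact: covering_number_le.
Qed.

Lemma sqrt_entropy_fin u n : cov u = n%:R%:E -> ent u = (Num.sqrt (ln n%:R))%:E.
Proof.
move=> covE; have n1 : (1 <= n%:R :> R)%R by rewrite -lee_fin -covE covering_number_ge1.
by rewrite /ent covE lne_EFin ?(lt_le_trans ltr01)// poweR_EFin powR12_sqrt// ln_ge0.
Qed.

Section finite_diameter.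
Variable D : R.
Hypothesis D0 : (0 < D)%R.
Hypothesis diamD : diameter rho = D%:E.

Lemma entropy_integralE :
  entropy_integral rho = \int[lebesgue_measure]_(u in `]0%R, D]%classic) ent u.
Proof.
rewrite /entropy_integral diamD; congr integral; apply/seteqP; split => u /=.
  by rewrite in_itv/= lee_fin => -[-> ->].
by rewrite in_itv/= lee_fin => /andP[].
Qed.

(** Were the covering number infinite at [u], monotonicity would make the integrand infinite on the
    whole interval from 0 to [u], which has positive length. *)
Lemma covering_number_lty u : entropy_integral rho < +oo -> (0 < u <= D)%R -> cov u < +oo.
Proof.
move=> Ifin /andP[u0 uD]; rewrite ltey; apply/eqP => covy.
move: Ifin; rewrite entropy_integralE ltNge => /negP; apply.
pose h v : \bar R := +oo * (\1_`]0%R, u]%classic v : R)%:E.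
apply: (@le_trans _ _ (\int[lebesgue_measure]_(v in `]0%R, D]%classic) h v)).
  rewrite /h ge0_integralZl//; last by apply/measurable_EFinP; exact: measurable_indic.
  rewrite integral_indic//= setIidl; last first.
    by move=> x /=; rewrite !in_itv/= => /andP[-> /le_trans]; apply.
  rewrite lebesgue_measure_itv/= lte_fin u0 EFinN sube0 mulyr.
  by rewrite gtr0_sg// mul1e.
apply: ge0_le_integral_nomeas.
  by move=> v _; rewrite /h mule_ge0// lee_fin.
move=> v _; rewrite /h indicE; case: (boolP (v \in _)) => /=.
  rewrite inE/= in_itv/= mule1 => /andP[_ vu].
  apply: le_trans (sqrt_entropy_le vu); rewrite /ent covy [lne +oo]/=.
  by rewrite poweRyr// invr_eq0 pnatr_eq0.
by rewrite mule0 => _; exact: poweR_ge0.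
Qed.

(** The sum is the integral of a step function below the integrand: [D / 2 ^+ j.+2] is the length of
    the interval [A j] between the scales [j.+2] and [j.+1], on which the antitone integrand is at
    least its value at the right end, hence at least [s j.+1]. *)
Lemma entropy_step_sum (n : nat) (s : nat -> R) :
  (forall j, (0 <= s j)%R) ->
  (forall j, (s j)%:E <= ent (D / 2 ^+ j)) ->
  (\sum_(j < n) D / 2 ^+ j.+2 * s j.+1)%R%:E <= entropy_integral rho.
Proof.
move=> s0 sent; rewrite entropy_integralE.
pose u j : R := (D / 2 ^+ j)%R.
have u0 j : (0 < u j)%R by rewrite divr_gt0// exprn_gt0.
have uS j : (u j.+1 = u j / 2)%R by rewrite /u exprSr invfM mulrA.
have u_le i j : (i <= j)%N -> (u j <= u i)%R.
  by move=> ij; rewrite ler_pM2l// lef_pV2 ?posrE ?exprn_gt0// ler_weXn2l// ler1n.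
pose A j : set R := `]u j.+2, u j.+1]%classic.
pose h v : \bar R := \sum_(j < n) (s j.+1)%:E * (\1_(A j) v : R)%:E.
have mAj j : measurable (A j) by exact: measurable_itv.
have mA j : measurable_fun `]0%R, D]%classic (fun v => (\1_(A j) v : R)%:E).
  by apply/measurable_EFinP; apply: measurable_indic; exact: measurable_itv.
apply: (@le_trans _ _ (\int[lebesgue_measure]_(v in `]0%R, D]%classic) h v)).
  rewrite ge0_integral_sum//; last 2 first.
  - by move=> j; apply: emeasurable_funM; [exact: measurable_cst|exact: mA].
  - by move=> j v _; rewrite mule_ge0// lee_fin.
  rewrite -sumEFin; apply: lee_sum => j _.
  rewrite ge0_integralZl ?lee_fin//; last exact: mA.
  rewrite integral_indic//; last exact: mAj.
  have u_leD : (u j.+1 <= D)%R by rewrite [leRHS](_ : D = u 0%N) ?u_le// /u expr0 divr1.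
  have AD : A j `<=` `]0%R, D]%classic.
    move=> x; rewrite /A /= !in_itv/= => /andP[x1 x2]; apply/andP; split.
      exact: lt_trans x1.
    exact: le_trans x2 u_leD.
  rewrite (setIidl AD).
  have lA : lebesgue_measure (A j) = (u j.+2)%:E.
    rewrite /A lebesgue_measure_itv/= lte_fin -EFinB !uS ifT; last by have := u0 j; lra.
    by congr EFin; lra.
  have -> : (D / 2 ^+ j.+2 * s j.+1)%:E = (s j.+1)%:E * lebesgue_measure (A j).
    by rewrite lA -EFinM mulrC.
  exact: lexx.
apply: ge0_le_integral_nomeas.
  by move=> v _; rewrite sume_ge0// => j _; rewrite mule_ge0// lee_fin.
move=> v _; have [[i Aiv]|nA] := pselect (exists i : 'I_n, A i v); last first.
  rewrite /h big1 ?poweR_ge0// => j _; rewrite indicE memNset ?mule0// => Ajv.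
  by apply: nA; exists j.
rewrite /h (bigD1 i)//= big1 ?adde0 => [|j ji]; last first.
  rewrite indicE memNset ?mule0// => Ajv; move: ji Aiv Ajv; rewrite /A/= !in_itv/=.
  rewrite -val_eqE/= neq_ltn => /orP[] ij /andP[a1 a2] /andP[b1 b2].
    by have := lt_le_trans b1 a2; rewrite ltNge u_le.
  by have := lt_le_trans a1 b2; rewrite ltNge u_le.
rewrite indicE mem_set// mule1; apply: le_trans (sent _) _; apply: sqrt_entropy_le.
by move: Aiv; rewrite /A/= in_itv/= => /andP[].
Qed.

End finite_diameter.
End entropy.

Section chaining.
Local Open Scope ereal_scope.
Context d d' (Omega : measurableType d) (E : measurableType d') (R : realType).
Variables (P : probability Omega R) (Q : probability E R) (M : nat).
Variables (eps : 'I_M -> Omega -> E) (G : nat -> set (set Omega)).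
Hypothesis draws : iid_draws P Q eps G.
Hypothesis M0 : (0 < M)%N.
Local Notation Og := (g_sigma_algebraType (G 0)).
Local Notation emp := (emp Q eps).

Context (T : Type) (rho : T -> T -> R) (z0 : T) (xi : T -> E * Omega -> R) (b L : R).
Hypothesis L0 : (0 <= L)%R.
Hypothesis mxi : forall z, measurable_fun [set: E * Og] (xi z).
Hypothesis xib : forall z x, (`|xi z x| <= b)%R.
Hypothesis rho_ge0 : forall z z', (0 <= rho z z')%R.
Hypothesis xi_lip : forall z z',
  {ae Q \x P, forall x, (`|xi z x - xi z' x| <= L * rho z z')%R}.

Let MR0 : (0 < M%:R :> R)%R. Proof. by rewrite ltr0n. Qed.

Let b0 : (0 <= b)%R. Proof. by apply: le_trans (xib z0 point). Qed.

Lemma measurable_increment z z' : measurable_fun [set: E * Og] (fun x => xi z x - xi z' x)%R.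
Proof. exact: measurable_funB. Qed.

Lemma increment_bd z z' x : (`|xi z x - xi z' x| <= b + b)%R.
Proof. by apply: le_trans (ler_normB _ _) _; rewrite lerD. Qed.

Lemma emp_lip z z' : {ae P, forall w, (`|emp (xi z) w - emp (xi z') w| <= 2 * (L * rho z z'))%R}.
Proof.
have := @emp_ae_small _ _ _ _ _ P Q M eps G draws M0 _ (b + b)%R (L * rho z z')%R
  (mulr_ge0 L0 (rho_ge0 z z')) (measurable_increment z z') (increment_bd z z') (xi_lip z z').
by apply: filterS => w; rewrite (empB draws _ (mxi z) (mxi z') (xib z) (xib z')).
Qed.

(* The link between two levels is clamped, so that pairs of net points that are
   never linked cost nothing. Only the triangle inequality of the increments of
   [xi] is used here, never that of [rho]. *)
Lemma emp_link c z (s s' : T) : (L * (rho s z + rho s' z) <= c)%R ->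
  {ae P, forall w, emp (xi s') w - emp (xi s) w = emp (fun x => trunc c (xi s' x - xi s x)) w}%R.
Proof.
move=> rhoc.
have c0 : (0 <= c)%R by apply: le_trans rhoc; rewrite mulr_ge0 ?addr_ge0.
have tb x : (`|trunc c (xi s' x - xi s x)| <= c)%R by exact: normr_trunc_le.
have mt : measurable_fun [set: E * Og] (fun x => trunc c (xi s' x - xi s x))%R.
  exact: measurable_trunc (measurable_increment _ _).
have ae0 : {ae Q \x P, forall x,
    (`|(xi s' x - xi s x) - trunc c (xi s' x - xi s x)| <= 0)%R}.
  apply: filterS2 (xi_lip s z) (xi_lip s' z) => x h1 h2.
  rewrite trunc_id ?subrr ?normr0//; apply: le_trans rhoc.
  have -> : (xi s' x - xi s x = (xi s' x - xi z x) - (xi s x - xi z x))%R by ring.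
  by apply: le_trans (ler_normB _ _) _; rewrite mulrDr addrC lerD.
have := @emp_ae_small _ _ _ _ _ P Q M eps G draws M0 _ (b + b + c)%R 0%R (lexx _) _ _ ae0.
move=> /(_ _ _) => H; have {}H := H _ _.
have : {ae P, forall w, (`|emp (fun x => xi s' x - xi s x - trunc c (xi s' x - xi s x)) w| <= 2 * 0)%R}.
  apply: H; first exact: measurable_funB (measurable_increment _ _) mt.
  by move=> x; apply: le_trans (ler_normB _ _) _; rewrite lerD ?increment_bd.
apply: filterS => w; rewrite mulr0 normr_le0 => /eqP.
rewrite (empB draws _ (measurable_increment s' s) mt (increment_bd s' s) tb).
rewrite (empB draws _ (mxi s') (mxi s) (xib s') (xib s)).
by move/eqP; rewrite subr_eq0 => /eqP.
Qed.

Section nets.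
Variables (D : R) (n : nat) (N : nat -> nat) (c : forall j, 'I_(N j) -> T).
Hypothesis LD0 : (0 < L * D)%R.
Hypothesis N0 : N 0 = 1%N.
Hypothesis net : forall j z, exists i : 'I_(N j), (rho (c i) z <= D / 2 ^+ j)%R.

Let u j : R := (D / 2 ^+ j)%R.
(** [B j] bounds the increment between a point of net [j] and one of net [j.+1] that are near a
    common point. The square of [a j] below is the bound of [emp_max] for all pairs of points of
    these two nets, with increments clamped at [B j]. *)
Let B j : R := (L * (u j + u j.+1))%R.
Let a j : R := (16 * B j / Num.sqrt M%:R * Num.sqrt (1 + ln (N j * N j.+1)%:R))%R.

Let N_gt0 j : (0 < N j)%N.
Proof. by have [i _] := net j z0; exact: leq_ltn_trans (ltn_ord i). Qed.

Let NN_ge1 j : (1 <= (N j * N j.+1)%:R :> R)%R.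
Proof. by rewrite ler1n muln_gt0 !N_gt0. Qed.

Let Lu_gt0 j : (0 < L * u j)%R.
Proof. by rewrite /u mulrA divr_gt0// exprn_gt0. Qed.

Let B_gt0 j : (0 < B j)%R.
Proof. by rewrite /B mulrDr addr_gt0. Qed.

Let a_gt0 j : (0 < a j)%R.
Proof.
rewrite /a mulr_gt0//; last by rewrite sqrtr_gt0 ltr_pwDl// ln_ge0.
by rewrite divr_gt0 ?sqrtr_gt0// mulr_gt0.
Qed.

(** The three terms are the root, a single point because [N 0 = 1], the links over [n] levels, and
    the step from the finest net to [z]. The 3 comes from the square of a sum of three. *)
Lemma chaining_nets : exists W : Omega -> R,
  [/\ measurable_fun [set: Omega] W, forall w, (0 <= W w)%R,
    forall z, {ae P, forall w, (emp (xi z) w ^+ 2 <= W w)%R}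
    & \int[P]_w (W w)%:E <=
      (3 * (256 * b ^+ 2 / M%:R + (\sum_(j < n) a j) ^+ 2 + (2 * (L * u n)) ^+ 2))%:E].
Proof.
have [W0 [mW0 W00 W0P W0E]] : exists W : Omega -> R,
    [/\ measurable_fun [set: Omega] W, forall w, (0 <= W w)%R,
    forall (i : 'I_(N 0)) w, (emp (xi (c i)) w ^+ 2 <= W w)%R
    & \int[P]_w (W w)%:E <= (256 * b ^+ 2 / M%:R)%:E].
  have [i0 _] := net 0 z0.
  have [W [mW W0 WP WE]] :=
    @emp_max _ _ _ _ _ P Q M eps G draws M0 _ i0 (fun i => xi (c i)) b b0 (fun i => mxi (c i)) (fun i => xib (c i)).
  by exists W; split => //; move: WE; rewrite card_ord N0 ln1 addr0 mulr1.
have linkW j : exists W : Omega -> R,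
    [/\ measurable_fun [set: Omega] W, forall w, (0 <= W w)%R,
    forall (p : 'I_(N j) * 'I_(N j.+1)) w,
      (emp (fun x => trunc (B j) (xi (c p.2) x - xi (c p.1) x)) w ^+ 2 <= W w)%R
    & \int[P]_w (W w)%:E <= (a j ^+ 2)%:E].
  have [i0 _] := net j z0; have [i1 _] := net j.+1 z0.
  have [||W [mW W0' WP WE]] := @emp_max _ _ _ _ _ P Q M eps G draws M0 _ (i0, i1)
    (fun p x => trunc (B j) (xi (c p.2) x - xi (c p.1) x))%R (B j) (ltW (B_gt0 j)).
  - by move=> p; exact: measurable_trunc (measurable_increment _ _).
  - by move=> p x; apply: normr_trunc_le; exact: ltW.
  exists W; split => //; apply: le_trans WE _.
  rewrite card_prod !card_ord lee_fin /a !exprMn exprVn !sqr_sqrtr ?ler0n ?addr_ge0 ?ln_ge0//.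
  by rewrite le_eqVlt; apply/orP; left; apply/eqP; ring.
have [W WP] := choice linkW.
have mW j : measurable_fun [set: Omega] (W j) by have [] := WP j.
have Wge0 j w : (0 <= W j w)%R by have [_ + _ _] := WP j.
pose A := (\sum_(j < n) a j)%R.
have A0 : (0 <= A)%R by apply: sumr_ge0 => j _; exact: ltW.
pose r := (2 * (L * u n))%R.
have r0 : (0 <= r)%R by rewrite mulr_ge0// ltW.
have Wa0 j w : (0 <= W j w / a j)%R by rewrite divr_ge0// ltW.
have mWa j : measurable_fun [set: Omega] (fun w => W j w / a j)%R by exact: measurable_funM.
(* [W j] dominates the links of all pairs of net points, so this function does not involve [z]. As
   [W j / a j] has expectation at most [a j], the middle term has expectation at most [A ^+ 2]. *)
exists (fun w => 3 * (W0 w + A * (\sum_(j < n) W j w / a j) + r ^+ 2))%R; split.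
- apply: measurable_funM => //; apply: measurable_funD => //; apply: measurable_funD => //.
  by apply: measurable_funM => //; exact: measurable_sum.
- move=> w; rewrite mulr_ge0// addr_ge0 ?sqr_ge0// addr_ge0// mulr_ge0//.
  exact: sumr_ge0.
(* The chain of [z] takes at each level a net point near [z]. Consecutive ones are compared through
   [z] itself, which gives the hypothesis of [emp_link] with the clamp [B j]. *)
- move=> z; pose i j := sval (cid (net j z)).
  have iP j : (rho (c (i j)) z <= u j)%R by exact: svalP (cid (net j z)).
  have lip := emp_lip (c (i n)) z.
  have link : {ae P, forall w, forall j : 'I_n,
      (emp (xi (c (i j.+1))) w - emp (xi (c (i j))) w =
       emp (fun x => trunc (B j) (xi (c (i j.+1)) x - xi (c (i j)) x)) w)%R}.
    apply: ae_forall_fin => j; apply: (@emp_link _ z).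
    by rewrite ler_wpM2l// lerD.
  apply: filterS2 lip link => w h1 h2.
  have h0 := W0P (i 0%N) w.
  have tele : (emp (xi (c (i n))) w - emp (xi (c (i 0%N))) w =
      \sum_(j < n) emp (fun x => trunc (B j) (xi (c (i j.+1)) x - xi (c (i j)) x)) w)%R.
    rewrite -(@telescope_sumr _ 0 n (fun j => emp (xi (c (i j))) w))// big_mkord.
    by apply: eq_bigr => j _; exact: h2.
  have hS : ((emp (xi (c (i n))) w - emp (xi (c (i 0%N))) w) ^+ 2 <=
      A * \sum_(j < n) W j w / a j)%R.
    rewrite tele; apply: le_trans (sqr_sum_le_weighted _ (fun j : 'I_n => a_gt0 j)) _.
    apply: ler_wpM2l => //; apply: ler_sum => j _; rewrite ler_pM2r ?invr_gt0//.
    by have [_ _ + _] := WP j; move=> /(_ (i j, i j.+1) w).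
  have hr : ((emp (xi z) w - emp (xi (c (i n))) w) ^+ 2 <= r ^+ 2)%R.
    rewrite -(real_normK (num_real (_ - _)%R)) distrC ler_pXn2r ?nnegrE//.
    by apply: le_trans h1 _; rewrite ler_wpM2l// ler_wpM2l//; exact: iP.
  move: h0 hS hr.
  move: (emp (xi z) w) (emp (xi (c (i n))) w) (emp (xi (c (i 0%N))) w) => x y t.
  move: (W0 w) (A * _)%R (r ^+ 2)%R => p q s h0 hS hr.
  have := sqr_ge0 (t - (y - t))%R; have := sqr_ge0 (t - (x - y))%R.
  have := sqr_ge0 (y - t - (x - y))%R; nra.
- have EW j : \int[P]_w (W j w / a j)%:E <= (a j)%:E.
    have := WP j; case=> _ _ _ WE.
    under eq_integral do rewrite EFinM muleC.
    rewrite ge0_integralZl ?lee_fin ?invr_ge0 ?(ltW (a_gt0 j))//; last first.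
    + by move=> w _; rewrite lee_fin.
    + exact/measurable_EFinP.
    rewrite -(@lee_pmul2l _ (a j)%:E) ?lte_fin// muleA -EFinM divff ?gt_eqF// mul1e.
    by rewrite -EFinM -expr2.
  have mWE j : measurable_fun [set: Omega] (fun w => (W j w / a j)%:E).
    exact/measurable_EFinP.
  rewrite (eq_integral (fun w => 3%:E * ((W0 w)%:E + (A%:E * (\sum_(j < n) (W j w / a j)%:E) + (r ^+ 2)%:E)))); last first.
    by move=> w _; rewrite sumEFin -(EFinM A) -(EFinD _ (r ^+ 2)%R) -(EFinD (W0 w)) -EFinM addrA.
  have mS : measurable_fun [set: Omega] (fun w => \sum_(j < n) (W j w / a j)%:E).
    exact: emeasurable_sum.
  have S0 w : 0 <= \sum_(j < n) (W j w / a j)%:E by apply: sume_ge0 => j _; rewrite lee_fin.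
  have mAS : measurable_fun [set: Omega] (fun w => A%:E * \sum_(j < n) (W j w / a j)%:E).
    exact: emeasurable_funM.
  have mASr : measurable_fun [set: Omega] (fun w => A%:E * (\sum_(j < n) (W j w / a j)%:E) + (r ^+ 2)%:E).
    exact: emeasurable_funD.
  have mW0E : measurable_fun [set: Omega] (fun w => (W0 w)%:E) by exact/measurable_EFinP.
  rewrite ge0_integralZl//; first last.
  + move=> w _; rewrite !adde_ge0// ?lee_fin ?sqr_ge0// mule_ge0//.
  + exact: emeasurable_funD.
  rewrite [leRHS]EFinM lee_wpmul2l// -addrA [leRHS]EFinD ge0_integralD//; first last.
  + by move=> w _; rewrite adde_ge0// ?lee_fin ?sqr_ge0// mule_ge0.
  + by move=> w _; rewrite lee_fin.
  rewrite leeD// [leRHS]EFinD ge0_integralD//; first last.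
  + by move=> w _; rewrite lee_fin sqr_ge0.
  + by move=> w _; rewrite mule_ge0.
  rewrite leeD//; last by rewrite integral_cst// [X in _ * X]probability_setT mule1.
  rewrite ge0_integralZl// expr2 [leRHS]EFinM lee_wpmul2l//.
  rewrite ge0_integral_sum//; last by move=> j w _; rewrite lee_fin.
  by rewrite -/A /A -sumEFin; apply: lee_sum => j _; exact: EW.
Qed.

End nets.

Local Notation X := (L%:E * entropy_integral rho + L%:E * diameter rho + b%:E).

Let diameter_ge z z' : (rho z z')%:E <= diameter rho.
Proof. by apply: ereal_sup_ubound; exists (z, z'). Qed.

Let entropy_ge0 : 0 <= entropy_integral rho.
Proof. by apply: integral_ge0 => u _; exact: poweR_ge0. Qed.

Let diameter_ge0 : 0 <= diameter rho.
Proof. by apply: le_trans (diameter_ge z0 z0); rewrite lee_fin. Qed.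

Let X_ge : b%:E <= X.
Proof. by rewrite leeDr// adde_ge0// mule_ge0. Qed.

Lemma chaining_constant : (forall z z', L * rho z z' = 0)%R ->
  exists W : Omega -> R, [/\ measurable_fun [set: Omega] W, forall w, (0 <= W w)%R,
    forall z, {ae P, forall w, (emp (xi z) w ^+ 2 <= W w)%R}
    & \int[P]_w (W w)%:E <= (256 * b ^+ 2 / M%:R)%:E].
Proof.
move=> Lrho.
have [W [mW W0 WP WE]] := @emp_max _ _ _ _ _ P Q M eps G draws M0 _ tt (fun=> xi z0) b b0
  (fun=> mxi z0) (fun=> xib z0).
exists W; split => //; last by move: WE; rewrite card_unit ln1 addr0 mulr1.
move=> z; apply: filterS (emp_lip z z0) => w.
by rewrite Lrho mulr0 normr_le0 subr_eq0 => /eqP ->; exact: (WP tt).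
Qed.

Lemma chaining_dyadic (D I : R) : (0 < L)%R -> (0 < D)%R ->
  diameter rho = D%:E -> entropy_integral rho = I%:E ->
  exists W : Omega -> R, [/\ measurable_fun [set: Omega] W, forall w, (0 <= W w)%R,
    forall z, {ae P, forall w, (emp (xi z) w ^+ 2 <= W w)%R}
    & \int[P]_w (W w)%:E <= (400 ^+ 2 * (L * I + L * D + b) ^+ 2 / M%:R)%:E].
Proof.
move=> Lgt0 D0 diamD entI.
have I0 : (0 <= I)%R by rewrite -lee_fin -entI.
have u0 j : (0 < D / 2 ^+ j)%R by rewrite divr_gt0// exprn_gt0.
have uD j : (D / 2 ^+ j <= D)%R 
  by rewrite ler_pdivrMr ?exprn_gt0//; apply: ler_peMr; [exact: ltW|apply: exprn_ege1; lra].
(* At level 0 the single point [z0] is within [D] of everything. The covering number at [D] may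
   exceed 1, since its balls are open, hence the restriction to [0 < j] in the last clause. *)
have netF j : exists p : {k : nat & 'I_k -> T},
    [/\ (j = 0%N -> projT1 p = 1%N),
      forall z, exists i, (rho (projT2 p i) z <= D / 2 ^+ j)%R
    & (0 < j)%N -> covering_number rho (D / 2 ^+ j) = (projT1 p)%:R%:E].
  case: j => [|j].
    exists (existT _ 1%N (fun=> z0)); split => // z; exists ord0 => /=.
    by rewrite expr0 divr1 -lee_fin -diamD.
  have [|k [[c cP] kE]] := @covering_number_fin _ _ rho (D / 2 ^+ j.+1)%R.
    by apply: (covering_number_lty z0 diamD); rewrite ?entI ?ltry// u0 uD.
  exists (existT _ k c); split => //= z.
  by have [i ci] := cP z; exists i; exact: ltW.
have [F FP] := choice netF.
pose N j := projT1 (F j); pose c j : 'I_(N j) -> T := projT2 (F j).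
have N0 : N 0%N = 1%N by have [+ _ _] := FP 0%N; exact.
have net j z : exists i, (rho (c j i) z <= D / 2 ^+ j)%R by have [_ + _] := FP j; exact.
have Ncov j : (0 < j)%N -> covering_number rho (D / 2 ^+ j) = (N j)%:R%:E.
  by have [_ _ +] := FP j; exact.
have N_gt0 j : (0 < N j)%N by have [i _] := net j z0; exact: leq_ltn_trans (ltn_ord i).
have N_mono j : (N j <= N j.+1)%N.
  case: j => [|j]; first by rewrite N0.
  rewrite -(ler_nat R) -lee_fin -!Ncov//; apply: covering_number_le.
  by rewrite ler_pM2l// lef_pV2 ?posrE ?exprn_gt0// ler_weXn2l// ler1n.
pose s j : R := if j is _.+1 then Num.sqrt (ln (N j)%:R) else 0%R.
have s0 j : (0 <= s j)%R by case: j => [|j] //=; exact: sqrtr_ge0.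
have sumI : (\sum_(j < M) D / 2 ^+ j.+2 * s j.+1 <= I)%R.
  rewrite -lee_fin -entI; apply: (entropy_step_sum z0 D0 diamD) => //.
  case=> [|j]; first exact: poweR_ge0.
  by rewrite (sqrt_entropy_fin z0 (Ncov j.+1 isT)).
have sumD n : (\sum_(j < n) D / 2 ^+ j.+1 = D - D / 2 ^+ n)%R.
  elim: n => [|n IH]; first by rewrite big_ord0 expr0 divr1 subrr.
  rewrite big_ord_recr/= IH exprSr.
  by field; rewrite expf_neq0.
(* After [M] levels the remaining scale [D / 2 ^+ M] is below [D / sqrt M]. *)
have [W [mW W0 WP WE]] := chaining_nets M (mulr_gt0 Lgt0 D0) N0 net.
exists W; split => //; apply: le_trans WE _; rewrite lee_fin.
pose q := Num.sqrt M%:R : R; have q0 : (0 < q)%R by rewrite sqrtr_gt0.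
have qE : (q ^+ 2 = M%:R)%R by rewrite sqr_sqrtr// ler0n.
set A := (\sum_(j < M) _)%R.
have A0 : (0 <= A)%R.
  apply: sumr_ge0 => j _; rewrite mulr_ge0 ?sqrtr_ge0// divr_ge0 ?sqrtr_ge0// mulr_ge0//.
  by rewrite mulr_ge0// addr_ge0// ltW.
(* Since [B j] is [3 * L * (D / 2 ^+ j.+1)] and the square root is at most [2 * (1 + s j.+1)], each
   term is at most [96 * L / q * (D / 2 ^+ j.+1) * (1 + s j.+1)]. The parts without [s] sum
   geometrically to a multiple of [D]; those with [s], rewritten at half the scale with the factor
   192, are those of [entropy_step_sum]. *)
have AE : (A <= 192 * (L * D + L * I) / q)%R.
  apply: (@le_trans _ _ (\sum_(j < M) (96 * L / q * (D / 2 ^+ j.+1) +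
      192 * L / q * (D / 2 ^+ j.+2 * s j.+1)))%R); last first.
    have e1 : (\sum_(j < M) 96 * L / q * (D / 2 ^+ j.+1) = 96 * L / q * (D - D / 2 ^+ M))%R.
      by rewrite -sumD mulr_sumr.
    have e2 : (\sum_(j < M) 192 * L / q * (D / 2 ^+ j.+2 * s j.+1) =
        192 * L / q * \sum_(j < M) D / 2 ^+ j.+2 * s j.+1)%R.
      by rewrite mulr_sumr.
    rewrite big_split/= [X in (X + _ <= _)%R]e1 [X in (_ + X <= _)%R]e2.
    have Lq : (0 <= 96 * L / q)%R by rewrite divr_ge0 ?mulr_ge0// ltW.
    have h1 : (96 * L / q * (D - D / 2 ^+ M) <= 96 * L / q * D)%R.
      by rewrite ler_wpM2l// gerBl ltW.
    have h2 := ler_wpM2l (addr_ge0 Lq Lq) sumI.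
    have h3 : (0 <= 96 * L / q * D)%R by rewrite mulr_ge0// ltW.
    have -> : (192 * (L * D + L * I) / q = 96 * L / q * D + 96 * L / q * D + (96 * L / q + 96 * L / q) * I)%R.
      by ring.
    have -> : (192 * L / q = 96 * L / q + 96 * L / q)%R by ring.
    by lra.
  apply: ler_sum => j _.
  have Nj1 k : (1 <= (N k)%:R :> R)%R by rewrite ler1n.
  have lnN : (ln (N j * N j.+1)%:R <= 2 * s j.+1 ^+ 2)%R.
    rewrite /= sqr_sqrtr ?ln_ge0// natrM lnM ?posrE ?ltr0n//.
    rewrite mulr_natl mulr2n lerD2r ler_ln ?posrE ?ltr0n// ler_nat; exact: N_mono.
  have sq : (Num.sqrt (1 + ln (N j * N j.+1)%:R) <= 2 * (1 + s j.+1))%R.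
    rewrite -[leRHS]ger0_norm ?mulr_ge0 ?addr_ge0// -sqrtr_sqr ler_wsqrtr//.
    by have := s0 j.+1; nra.
  rewrite [leRHS](_ : _ = 48 * L * (D / 2 ^+ j.+1) / q * (2 * (1 + s j.+1)))%R; last first.
    by rewrite !exprS; field; rewrite expf_neq0// gt_eqF.
  rewrite (_ : 16 * _ / _ = 48 * L * (D / 2 ^+ j.+1) / q)%R; last first.
    by rewrite -/q !exprS; field; rewrite expf_neq0// gt_eqF.
  by rewrite ler_wpM2l// divr_ge0 ?mulr_ge0// ltW.
have M2 : (M%:R <= (2 ^+ M) ^+ 2 :> R)%R.
  have le1 : (M%:R <= 2 ^+ M :> R)%R by rewrite -natrX ler_nat ltnW// ltn_expl.
  by apply: le_trans le1 _; rewrite expr2 ler_peMr ?exprn_ge0// exprn_ege1//; lra.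
have resE : ((2 * (L * (D / 2 ^+ M))) ^+ 2 <= 4 * (L * D) ^+ 2 / M%:R)%R.
  rewrite (_ : (2 * (L * (D / 2 ^+ M))) ^+ 2 = 4 * (L * D) ^+ 2 / (2 ^+ M) ^+ 2)%R; last first.
    by field; rewrite expf_neq0.
  apply: ler_wpM2l; first by rewrite mulr_ge0 ?sqr_ge0.
  by rewrite lef_pV2 ?posrE ?MR0 ?exprn_gt0.
have A2 : (A ^+ 2 <= 192 ^+ 2 * (L * D + L * I) ^+ 2 / M%:R)%R.
  rewrite (_ : _ / M%:R = (192 * (L * D + L * I) / q) ^+ 2)%R; last first.
    by rewrite -qE; field; rewrite gt_eqF.
  by rewrite ler_pXn2r ?nnegrE// divr_ge0 ?mulr_ge0 ?addr_ge0 ?mulr_ge0// ltW.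
have LD0 : (0 <= L * D)%R by rewrite mulr_ge0// ltW.
have LI0 : (0 <= L * I)%R by rewrite mulr_ge0// ltW.
(* The constant 400 only has to satisfy [3 * (192 ^+ 2 + 4) <= 400 ^+ 2] and
   [3 * 256 <= 400 ^+ 2]. *)
rewrite ler_pdivlMr//.
move: A2 resE; rewrite !ler_pdivlMr//.
set t := (2 * (L * (D / 2 ^+ M)))%R.
move: (L * D)%R (L * I)%R LD0 LI0 => x y x0 y0.
rewrite (_ : 3 * _ * _ = 3 * (256 * b ^+ 2 + A ^+ 2 * M%:R + t ^+ 2 * M%:R))%R; last first.
  by field; rewrite gt_eqF.
have := mulr_ge0 x0 y0; have := mulr_ge0 x0 b0; have := mulr_ge0 y0 b0.
have := sqr_ge0 x; have := sqr_ge0 y; have := sqr_ge0 b.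
by move: (A ^+ 2 * _)%R (t ^+ 2 * _)%R => p r; lra.
Qed.

Lemma chaining : exists W : Omega -> R,
  [/\ measurable_fun [set: Omega] W, forall w, (0 <= W w)%R,
    forall z, {ae P, forall w, (emp (xi z) w ^+ 2 <= W w)%R}
    & \int[P]_w (W w)%:E <= (400 ^+ 2)%:E * (X ^+ 2 * (M%:R^-1)%:E)].
Proof.
have Mi : 0 < (M%:R^-1 : R)%:E by rewrite lte_fin invr_gt0.
(* This case covers [L = 0] and diameter zero, which [chaining_dyadic] excludes. The empirical
   process is then almost surely the same at all points. *)
have [Lr0|Lr] := pselect (forall z z', L * rho z z' = 0)%R.
  have [W [mW W0 WP WE]] := chaining_constant Lr0; exists W; split => //.
  apply: le_trans WE _.
  apply: (@le_trans _ _ ((400 ^+ 2)%:E * ((b%:E) ^+ 2 * (M%:R^-1)%:E))).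
    rewrite -EFin_expe -!EFinM lee_fin mulrA ler_wpM2r ?invr_ge0 ?ler0n//.
    by rewrite ler_wpM2r ?sqr_ge0//; lra.
  apply: lee_wpmul2l; first by rewrite lee_fin sqr_ge0.
  apply: lee_wpmul2r; first exact: ltW.
  by rewrite !expe2; apply: lee_pmul; rewrite ?lee_fin// X_ge.
have Lgt0 : (0 < L)%R.
  rewrite lt_neqAle L0 andbT; apply/eqP => Lz; apply: Lr => z z'; by rewrite -Lz mul0r.
have [z [z' rzz]] : exists z z', (0 < rho z z')%R.
  apply: contrapT => H; apply: Lr => z z'; apply/eqP; rewrite mulf_eq0; apply/orP; right.
  by rewrite eq_le rho_ge0 andbT leNgt; apply/negP => h; apply: H; exists z, z'.
have diam0 : 0 < diameter rho by apply: lt_le_trans (diameter_ge z z'); rewrite lte_fin.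
(* With an infinite entropy integral or diameter the right-hand side is infinite and the crude bound
   on [emp] suffices. Past this case both are real numbers. *)
have [Xy|Xfin] := eqVneq X +oo.
  exists (cst (2 * b) ^+ 2)%R; split => //.
  - by move=> w; exact: sqr_ge0.
  - move=> y; apply: aeW => w; rewrite -(real_normK (num_real (emp _ _))) ler_pXn2r ?nnegrE ?mulr_ge0//.
    exact: (normr_emp_le draws M0 _ (mxi y) (xib y)).
  - by rewrite Xy expe2 mulyy gt0_mulye// gt0_muley ?leey// lte_fin exprn_gt0.
have [I entI] : exists I, entropy_integral rho = I%:E.
  move: entropy_ge0 Xfin; case: (entropy_integral rho) => [I||]//; first by exists I.
  by rewrite gt0_muley ?lte_fin// !addye// ?eqxx// -ltNye (lt_le_trans (ltNyr 0))// mule_ge0// ltW.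
have [D diamD] : exists D, diameter rho = D%:E.
  move: diam0 Xfin; case: (diameter rho) => [D||]//; first by exists D.
  by rewrite gt0_muley ?lte_fin// entI -EFinM addey// addye// eqxx.
have D0 : (0 < D)%R by rewrite -lte_fin -diamD.
have [W [mW W0 WP WE]] := chaining_dyadic Lgt0 D0 diamD entI.
have XE : X = (L * I + L * D + b)%:E by rewrite entI diamD !EFinD !EFinM.
by exists W; split => //; rewrite XE -EFin_expe -(EFinM _ M%:R^-1) -EFinM mulrA.
Qed.


End chaining.

(** * Independence of the simulations *)

Section independent_pair.
Local Open Scope ereal_scope.
Context d d1 d2 (Omega : measurableType d) (S : measurableType d1) (E : measurableType d2).
Context (R : realType) (P : probability Omega R) (mu : probability S R) (Q : probability E R).
Variables (X : Omega -> S) (Y : Omega -> E).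
Hypothesis mX : measurable_fun [set: Omega] X.
Hypothesis mY : measurable_fun [set: Omega] Y.

(** With [B] fixed, both sides are finite measures in [A] that agree on rectangles, a pi-system
    generating the product sigma-algebra. *)
Lemma indep_pair (B : set Omega) : measurable B ->
  (forall A1 A2, measurable A1 -> measurable A2 ->
    P (X @^-1` A1 `&` Y @^-1` A2 `&` B) = mu A1 * Q A2 * P B) ->
  forall A, measurable A -> P ((fun w => (X w, Y w)) @^-1` A `&` B) = (mu \x Q) A * P B.
Proof.
move=> mB PB A mA.
have mXY : measurable_fun [set: Omega] (fun w => (X w, Y w)) by exact: measurable_fun_pair.
have PB0 : (0 <= fine (P B))%R by exact: fine_ge0.
pose m2 := mscale (NngNum PB0) (mu \x Q).
pose XY : {mfun Omega >-> (S * E)%type} :=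
  HB.pack (fun w => (X w, Y w)) (isMeasurableFun.Build _ _ _ _ _ mXY).
pose m1 := pushforward (mrestr P mB) XY.
have m2E C : m2 C = (mu \x Q) C * P B.
  by rewrite /m2 /mscale /= fineK ?fin_num_measure// muleC.
rewrite -m2E; change (m1 A = m2 A).
pose G := [set A1 `*` A2 | A1 in @measurable _ S & A2 in @measurable _ E].
apply: (@g_sigma_algebra_measure_unique _ R _ G _ (fun=> setT)) => //.
- by move=> _ [A1 mA1 [A2 mA2 <-]]; exact: measurableX.
- by move=> _; exists setT => //; exists setT => //; rewrite setXTT.
- by rewrite bigcup_const.
- move=> _ _ [A1 mA1 [A2 mA2 <-]] [A3 mA3 [A4 mA4 <-]].
  rewrite -setXI; exists (A1 `&` A3); first exact: measurableI.
  by exists (A2 `&` A4) => //; exact: measurableI.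
- move=> _ [A1 mA1 [A2 mA2 <-]]; rewrite [RHS]m2E product_measure1E// -PB//.
- move=> _; rewrite /m1 /pushforward /= /mrestr; apply: le_lt_trans (probability_le1 P _) (ltry 1).
  by rewrite preimage_setT setTI.
- by rewrite -measurable_prod_measurableType.
Qed.

End independent_pair.

Section stage_generators.
Context (R : realType) (dS dA dE dO : measure_display).
Context (S : metricMeasurableType dS R) (A : metricMeasurableType dA R).
Context (E : measurableType dE) (Omega : measurableType dO).
Variable D : setting S A E Omega.
Hypothesis Dsim : simulation D.
Local Notation H := (horizon D).

Definition rect (BX : nat -> 'I_(n_pr D) -> set S) (BE : nat -> 'I_(n_pr D) -> set E)
    (BD : nat -> 'I_(n_du D) -> set E) : set Omega :=
  [set w | (forall h i, (h < H)%N -> BX h i (prX D h i w) /\ BE h i (prE D h i w)) /\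
    (forall t m, (1 <= t <= H)%N -> BD t m (duE D t m w))].

(* The draws of the stages [h0, ..., H-1] and the [k] first dual draws of time [t]. *)
Definition stage_gen (h0 t k : nat) : set (set Omega) := [set B |
  exists BX BE BD, [/\
    [/\ forall h i, measurable (BX h i), forall h i, measurable (BE h i)
      & forall t m, measurable (BD t m)],
    forall h i, (h < h0)%N -> BX h i = setT /\ BE h i = setT,
    forall t' (m : 'I_(n_du D)), ~~ ((t' == t) && (m < k)%N) -> BD t' m = setT
    & B = rect BX BE BD]].

Lemma measurable_rect BX BE BD :
  (forall h i, measurable (BX h i)) -> (forall h i, measurable (BE h i)) ->
  (forall t m, measurable (BD t m)) -> measurable (rect BX BE BD).
Proof.
move=> mX mE mD.
have -> : rect BX BE BD =
    (\bigcap_(h in `I_H) \bigcap_(i in [set: 'I_(n_pr D)])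
      (prX D h i @^-1` BX h i `&` prE D h i @^-1` BE h i)) `&`
    (\bigcap_(t in [set t | (1 <= t <= H)%N]) \bigcap_(m in [set: 'I_(n_du D)])
      (duE D t m @^-1` BD t m)).
  apply/seteqP; split => w [h1 h2]; split.
  - by move=> h hH i _; exact: h1.
  - by move=> t tH m _; exact: h2.
  - by move=> h i hH; exact: (h1 h hH i).
  - by move=> t m tH; exact: (h2 t tH m).
apply: measurableI.
  apply: fin_bigcap_measurable => // h hH; apply: fin_bigcap_measurable => // i _.
  apply: measurableI; rewrite -[X in measurable X]setTI.
    exact: (prX_meas Dsim i hH measurableT).
  exact: (prE_meas Dsim i hH measurableT).
apply: fin_bigcap_measurable.
  by apply: (sub_finite_set _ (finite_II H.+1)) => t /= /andP[].
move=> t tH; apply: fin_bigcap_measurable => // m _; rewrite -[X in measurable X]setTI.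
exact: (duE_meas Dsim m tH measurableT).
Qed.

Lemma rectI BX BE BD BX' BE' BD' :
  rect BX BE BD `&` rect BX' BE' BD' =
  rect (fun h i => BX h i `&` BX' h i) (fun h i => BE h i `&` BE' h i)
    (fun t m => BD t m `&` BD' t m).
Proof.
apply/seteqP; split => w.
  move=> [[h1 h2] [h3 h4]]; split.
    by move=> h i hH; have [] := h1 h i hH; have [] := h3 h i hH.
  by move=> t m tH; split; [exact: h2|exact: h4].
move=> [h1 h2]; split; split.
- by move=> h i hH; have [[? ?] [? ?]] := h1 h i hH.
- by move=> t m tH; have [] := h2 t m tH.
- by move=> h i hH; have [[? ?] [? ?]] := h1 h i hH.
- by move=> t m tH; have [] := h2 t m tH.
Qed.

Lemma stage_gen_meas h0 t k : stage_gen h0 t k `<=` measurable.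
Proof. by move=> _ [BX [BE [BD [[mX mE mD] _ _ ->]]]]; exact: measurable_rect. Qed.

Lemma stage_gen_setT h0 t k : stage_gen h0 t k setT.
Proof.
exists (fun _ _ => setT), (fun _ _ => setT), (fun _ _ => setT); split => //.
by apply/seteqP; split.
Qed.

Lemma stage_gen_setI h0 t k : setI_closed (stage_gen h0 t k).
Proof.
move=> _ _ [BX [BE [BD [[mX mE mD] T1 T2 ->]]]] [BX' [BE' [BD' [[mX' mE' mD'] T1' T2' ->]]]].
rewrite rectI; do 3 eexists; split; last reflexivity.
- by split => *; exact: measurableI.
- by move=> h i hh /=; have [-> ->] := T1 h i hh; have [-> ->] := T1' h i hh; rewrite !setTI.
- by move=> t' m tm /=; rewrite T2// T2'// setTI.
Qed.

Lemma stage_gen_mono h0 t k : stage_gen h0 t 0 `<=` stage_gen h0 t k.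
Proof.
move=> _ [BX [BE [BD [mB T1 T2 ->]]]]; exists BX, BE, BD; split => //.
by move=> t' m _; apply: T2; rewrite ltn0 andbF.
Qed.

Lemma preimage_duE_rect t (m : 'I_(n_du D)) (B : set E) : (1 <= t <= H)%N -> duE D t m @^-1` B =
  rect (fun _ _ => setT) (fun _ _ => setT)
    (fun t' m' => if (t' == t) && (m' == m) then B else setT).
Proof.
move=> tH; apply/seteqP; split => w.
  by move=> Bw; split => // t' m' _; case: ifPn => // /andP[/eqP -> /eqP ->].
by move=> [_ /(_ t m tH)]; rewrite !eqxx.
Qed.

Lemma stage_gen_duE h0 t k (m : 'I_(n_du D)) (B : set E) : (1 <= t <= H)%N -> (m < k)%N -> measurable B ->
  stage_gen h0 t k (duE D t m @^-1` B).
Proof.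
move=> tH mk mB; rewrite preimage_duE_rect//; do 3 eexists; split; last reflexivity.
- by split => // t' m' /=; case: ifP.
- by [].
- move=> t' m' /=; case: (boolP ((t' == t) && (m' == m))) => // /andP[/eqP -> /eqP ->].
  by rewrite eqxx mk.
Qed.

Lemma preimage_prXE_rect h (i : 'I_(n_pr D)) (BX : set S) (BE : set E) : (h < H)%N ->
  prX D h i @^-1` BX `&` prE D h i @^-1` BE =
  rect (fun h' i' => if (h' == h) && (i' == i) then BX else setT)
    (fun h' i' => if (h' == h) && (i' == i) then BE else setT) (fun _ _ => setT).
Proof.
move=> hH; apply/seteqP; split => w.
  by move=> [w1 w2]; split => // h' i' _; case: ifPn => // /andP[/eqP -> /eqP ->].
by move=> [/(_ h i hH) + _]; rewrite !eqxx => -[].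
Qed.

Lemma stage_gen_prXE h0 t k h (i : 'I_(n_pr D)) (BX : set S) (BE : set E) : (h0 <= h < H)%N -> measurable BX -> measurable BE ->
  stage_gen h0 t k (prX D h i @^-1` BX `&` prE D h i @^-1` BE).
Proof.
move=> /andP[h0h hH] mX mE; rewrite preimage_prXE_rect//; do 3 eexists; split; last reflexivity.
- by split => // h' i' /=; case: ifP.
- move=> h' i' hh'; have hN : (h' == h) && (i' == i) = false.
    by apply/negbTE; rewrite negb_and neq_ltn (leq_trans hh' h0h).
  by rewrite /= hN.
- by [].
Qed.

(** Independence is read off [joint_law] by changing one factor of a double product. The draw
    concerned is unconstrained beforehand, so its factor is 1. *)
Lemma prod_update (I J : eqType) (s : seq I) (r : seq J) (F F' : I -> J -> \bar R) i0 j0 :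
  uniq s -> uniq r -> i0 \in s -> j0 \in r -> F i0 j0 = 1%E ->
  (forall i j, ~~ ((i == i0) && (j == j0)) -> F' i j = F i j) ->
  (\prod_(i <- s) \prod_(j <- r) F' i j = F' i0 j0 * \prod_(i <- s) \prod_(j <- r) F i j)%E.
Proof.
move=> us ur is0 jr0 F1 FF'.
rewrite (bigD1_seq i0)//= (bigD1_seq j0 jr0)//= [in RHS](bigD1_seq i0)//= [in RHS](bigD1_seq j0 jr0)//=.
rewrite F1 mul1e muleA; congr (_ * _ * _)%E.
  by apply: eq_bigr => j jj; apply: FF'; rewrite eqxx.
by apply: eq_bigr => i ii; apply: eq_bigr => j _; apply: FF'; rewrite (negbTE ii).
Qed.

Lemma duE_indep h0 t (k : 'I_(n_du D)) B1 B : (1 <= t <= H)%N -> measurable B1 ->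
  stage_gen h0 t k B -> (PP D (duE D t k @^-1` B1 `&` B) = PE D B1 * PP D B)%E.
Proof.
move=> tH mB1 [BX [BE [BD [[mX mE mD] T1 T2 ->]]]].
have BDk : BD t k = setT by apply: T2; rewrite ltnn andbF.
have -> : duE D t k @^-1` B1 `&` rect BX BE BD =
    rect BX BE (fun t' m' => if (t' == t) && (m' == k) then B1 else BD t' m').
  rewrite preimage_duE_rect// rectI; congr rect; apply/funext => t'; apply/funext => m'.
  - by rewrite setTI.
  - by rewrite setTI.
  - by case: ifPn => [/andP[/eqP -> /eqP ->]|_]; rewrite ?BDk ?setIT ?setTI.
rewrite (joint_law Dsim mX mE mD).
etransitivity; first apply: (joint_law Dsim mX mE); first by move=> t' m'; case: ifP.
rewrite muleCA; congr (_ * _)%E.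
rewrite (@prod_update _ _ _ _ (fun t' m' => PE D (BD t' m')) _ t k)//.
- by rewrite !eqxx.
- exact: iota_uniq.
- exact: index_enum_uniq.
- by rewrite mem_index_iota ltnS.
- exact: mem_index_enum.
- by rewrite BDk probability_setT.
- by move=> t' m' tm; rewrite (negbTE tm).
Qed.

Lemma prXE_indep h t i BX1 BE1 B : (h < H)%N -> measurable BX1 -> measurable BE1 ->
  stage_gen h.+1 t 0 B ->
  (PP D (prX D h i @^-1` BX1 `&` prE D h i @^-1` BE1 `&` B) = mu D h BX1 * PE D BE1 * PP D B)%E.
Proof.
move=> hH mB1 mB2 [BX [BE [BD [[mX mE mD] T1 T2 ->]]]].
have [BXh BEh] : BX h i = setT /\ BE h i = setT by apply: T1.
have -> : prX D h i @^-1` BX1 `&` prE D h i @^-1` BE1 `&` rect BX BE BD =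
    rect (fun h' i' => if (h' == h) && (i' == i) then BX1 else BX h' i')
      (fun h' i' => if (h' == h) && (i' == i) then BE1 else BE h' i') BD.
  rewrite preimage_prXE_rect// rectI; congr rect; apply/funext => h'; apply/funext => i'.
  - by case: ifPn => [/andP[/eqP -> /eqP ->]|_]; rewrite ?BXh ?setIT ?setTI.
  - by case: ifPn => [/andP[/eqP -> /eqP ->]|_]; rewrite ?BEh ?setIT ?setTI.
  - by rewrite setTI.
rewrite (joint_law Dsim mX mE mD).
etransitivity; first by apply: (joint_law Dsim _ _ mD) => h' i'; case: ifP.
rewrite muleA; congr (_ * _)%E.
rewrite (@prod_update _ _ _ _ (fun h' i' => mu D h' (BX h' i') * PE D (BE h' i'))%E _ h i)//.
- by rewrite !eqxx.
- exact: iota_uniq.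
- exact: index_enum_uniq.
- by rewrite mem_index_iota.
- exact: mem_index_enum.
- by rewrite BXh BEh !probability_setT mule1.
- by move=> t' m' tm; rewrite (negbTE tm).
Qed.

Lemma dual_draws h0 t : (1 <= t <= H)%N ->
  iid_draws (PP D) (PE D) (duE D t) (stage_gen h0 t).
Proof.
move=> tH; split.
- by move=> m; exact: duE_meas.
- by move=> n; exact: stage_gen_meas.
- by move=> n; exact: stage_gen_setT.
- by move=> n; exact: stage_gen_setI.
- by move=> n; exact: stage_gen_mono.
- by move=> m n B mn mB; exact: stage_gen_duE.
- by move=> m B1 B mB1 GB; exact: duE_indep GB.
Qed.

End stage_generators.

(** * Regularity of the primal approximation *)

(** This makes [ae_draw] applicable to a primal pair, seen as a sequence of one draw: [G] is the
    information before it, and every measurable event is known afterwards. *)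
Lemma iid_draws_single d d' (Omega : measurableType d) (E : measurableType d') (R : realType)
    (P : probability Omega R) (Q : probability E R) (eps : Omega -> E) (G : set (set Omega)) :
  measurable_fun [set: Omega] eps -> G `<=` measurable -> G setT -> setI_closed G ->
  (forall A B, measurable A -> G B -> P (eps @^-1` A `&` B) = (Q A * P B)%E) ->
  iid_draws P Q (fun _ : 'I_1 => eps) (fun n => if n is 0%N then G else measurable).
Proof.
move=> meps Gm GT GI ind; split => //.
- by case=> [|n]; [exact: Gm|exact: subset_refl].
- by case=> [|n].
- by case=> [|n] //; move=> B C mB mC; exact: measurableI.
- by case=> [|n]; [exact: subset_refl|exact: Gm].
- by move=> m [//|n] A mn mA; rewrite -[X in measurable X]setTI; exact: meps.
- by move=> m A B mA; rewrite (ord1 m)/=; exact: ind.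
Qed.

(** Cauchy-Schwarz against a vector bounded entrywise; the factor [Num.sqrt (Kpr D)%:R] of [LV]
    originates here. *)
Lemma dot_le (R : realType) n (u v : 'cV[R]_n) (c : R) : 0 <= c ->
  (forall i, `|u i 0| <= c) -> `|dot u v| <= c * Num.sqrt n%:R * enorm v.
Proof.
move=> c0 uc; rewrite /dot; apply: le_trans (ler_norm_sum _ _ _) _.
apply: (@le_trans _ _ (\sum_(i < n) c * `|v i 0|)).
  by apply: ler_sum => i _; rewrite normrM ler_wpM2r.
rewrite -mulr_sumr -mulrA ler_wpM2l//.
have S0 : 0 <= \sum_(i < n) `|v i 0| by exact: sumr_ge0.
rewrite -(ger0_norm S0) -sqrtr_sqr /enorm -sqrtrM ?ler0n// ler_wsqrtr//.
apply: le_trans (sqr_sum_le_weighted _ (fun _ => ltr01)) _.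
rewrite sumr_const card_ord ler_wpM2l ?ler0n// le_eqVlt; apply/orP; left; apply/eqP.
by apply: eq_bigr => i _; rewrite divr1 real_normK ?num_real.
Qed.

Lemma normr_entry_le (R : realType) n (v : 'cV[R]_n) i : `|v i 0| <= `|v|.
Proof.
rewrite [leRHS]/Num.norm/= mx_normrE.
exact: (le_bigmax _ (fun p : 'I_n * 'I_1 => `|v p.1 p.2|) (i, 0)).
Qed.

Section primal.
Context (R : realType) (dS dA dE dO : measure_display).
Context (S : metricMeasurableType dS R) (A : metricMeasurableType dA R).
Context (E : measurableType dE) (Omega : measurableType dO).
Variable D : setting S A E Omega.
Hypotheses (Dst : standing D) (D1 : B1 D) (D2 : B2 D) (D3 : B3 D) (Dsim : simulation D).
Variable V : nat -> S -> Omega -> R.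
Hypothesis PV : primal_approximation D V.
Local Notation H := (horizon D).

(** Nonnegativity is not among the axioms of [is_norm_R2]; it follows from the triangle inequality
    for a vector and its opposite. *)
Lemma norm2_ge0 z : 0 <= norm2 D z.
Proof.
have [tri hom _] := norm2P D1.
have n0 : norm2 D (0, 0) = 0 by have := hom 0 (0, 0); rewrite /= !mul0r normr0 mul0r.
have nN : norm2 D (- z.1, - z.2) = norm2 D z.
  by have := hom (-1) z; rewrite !mulN1r normrN1 mul1r => ->; case: (z).
have := tri z (- z.1, - z.2); rewrite /= !subrr n0 nN; lra.
Qed.

Lemma rho_ge0 z z' : 0 <= rho D z z'.
Proof. exact: norm2_ge0. Qed.

Lemma rhoC z z' : rho D z z' = rho D z' z.
Proof. by rewrite /rho metric_sym [X in (_, X)]metric_sym. Qed.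

Lemma Rmax_ge0 : 0 <= Rmax D.
Proof. by apply: le_trans (term_bd D2 point). Qed.

Lemma Ltilde_ge0 h : 0 <= Ltilde D h.
Proof. by rewrite /Ltilde mulr_ge0 ?ler0n// Rmax_ge0. Qed.

Lemma Ltilde_le_Vmax h : Ltilde D h <= Vmax D.
Proof. by rewrite /Vmax /Ltilde ler_wpM2r ?Rmax_ge0// ler_nat ltnS leq_sub2l. Qed.

Lemma Vmax_ge0 : 0 <= Vmax D. Proof. exact: Ltilde_ge0. Qed.

Lemma LtildeS h : (h < H)%N -> Ltilde D h = Rmax D + Ltilde D h.+1.
Proof.
move=> hH; rewrite /Ltilde (_ : (H - h)%N = (H - h.+1).+1); last by rewrite -subSn.
by rewrite -[in LHS]addn1 natrD mulrDl mul1r addrC.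
Qed.

Lemma Lambda_pr_ge0 : 0 <= Lambda_pr D.
Proof. by apply: le_trans (Sigma_pr_bd D3 point (horizon_gt0 Dst)). Qed.

Lemma LV_ge0 : 0 <= LV D.
Proof.
rewrite addr_ge0 ?(LR_ge0 D2)// mulr_ge0 ?sqrtr_ge0// mulr_ge0 ?(ltW (Lgamma_gt0 D3))//.
by rewrite mulr_ge0 ?Vmax_ge0 ?Lambda_pr_ge0.
Qed.

Lemma primal_objective_bd (W : S -> Omega -> R) h x a w : (h < H)%N ->
  `|primal_objective D W h x a w| <= Ltilde D h.
Proof.
move=> hH; rewrite /primal_objective (LtildeS hH) (le_trans (ler_normD _ _))// lerD//.
  exact: reward_bd.
by apply: normr_trunc_le; exact: Ltilde_ge0.
Qed.

Lemma measurable_stage_section h t : (h <= H)%N ->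
  measurable_fun [set: S * g_sigma_algebraType (stage_gen D h t 0)] (fun z => V h z.1 z.2).
Proof.
rewrite leq_eqVlt => /orP[/eqP ->|hH].
  rewrite (_ : (fun z => _) = term D \o fst); last by apply/funext => z /=; rewrite primal_term.
  by apply: measurableT_comp (term_meas Dst) _; exact: measurable_fst.
move=> _ B mB; rewrite setTI.
have := primal_meas PV hH mB; apply: smallest_sub; first exact: sigma_algebra_measurable.
move=> C [[U mU ->]|[j [i [hj [[U mU ->]|[U mU ->]]]]]].
- exact: measurableX.
- apply: measurableX => //; apply: sub_sigma_algebra.
  by have := stage_gen_prXE t 0 i hj mU (@measurableT _ E); rewrite preimage_setT setIT.
- apply: measurableX => //; apply: sub_sigma_algebra.
  by have := stage_gen_prXE t 0 i hj (@measurableT _ S) mU; rewrite preimage_setT setTI.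
Qed.

Lemma measurable_V h : (h <= H)%N -> measurable_fun [set: S * Omega] (fun z => V h z.1 z.2).
Proof.
move=> hH; have m1 := @measurable_stage_section h 0 hH.
have m2 := @measurable_map_snd _ _ _ S _ _ _
  (measurable_id_g_sigma_algebra (@stage_gen_meas _ _ _ _ _ _ _ _ _ D Dsim h 0 0)).
exact: measurableT_comp m1 m2.
Qed.

Lemma measurable_Vx h x : (h <= H)%N -> measurable_fun [set: Omega] (V h x).
Proof.
move=> hH; have mp : measurable_fun [set: Omega] (fun w => (x, w)) by exact: measurable_fun_pair.
exact: measurableT_comp (measurable_V hH) mp.
Qed.

(** From above, the constant is an upper bound of the family and the essential supremum is the least
    one; from below, the essential supremum dominates the objective at one action. *)
Lemma V_bounded h x : (h <= H)%N -> {ae PP D, forall w, `|V h x w| <= Ltilde D h}.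
Proof.
rewrite leq_eqVlt => /orP[/eqP ->|hH].
  apply: aeW => w; rewrite (primal_term PV) /Ltilde subnn mul1r; exact: term_bd.
have [_ ub lub] := primal_rec PV hH x.
have le1 : {ae PP D, forall w, ((V h x w)%:E <= (Ltilde D h)%:E)%E}.
  apply: lub => // a; apply: aeW => w; rewrite lee_fin.
  exact: le_trans (ler_norm _) (primal_objective_bd _ _ _ _ hH).
apply: filterS2 le1 (ub point) => w; rewrite !lee_fin => h1 h2.
rewrite ler_norml h1 andbT; apply: le_trans h2.
by have := primal_objective_bd (V h.+1) x point w hH; rewrite ler_norml => /andP[].
Qed.

(** [V h.+1] depends only on the draws of later stages, of which the pair of stage [h] is
    independent, so the bound at each fixed state passes to the random next state. *)
Lemma V_next_bounded h a i : (h < H)%N ->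
  {ae PP D, forall w, `|V h.+1 (step D h.+1 (prX D h i w, a, prE D h i w)) w| <= Vmax D}.
Proof.
move=> hH; have mX := prX_meas Dsim i hH; have mE := prE_meas Dsim i hH.
have mXE : measurable_fun [set: Omega] (fun w => (prX D h i w, prE D h i w)).
  exact: measurable_fun_pair.
pose XE : {mfun Omega >-> (S * E)%type} :=
  HB.pack (fun w => (prX D h i w, prE D h i w)) (isMeasurableFun.Build _ _ _ _ _ mXE).
pose Q : probability (S * E)%type R := distribution (PP D) XE.
have stm := @stage_gen_meas _ _ _ _ _ _ _ _ _ D Dsim h.+1 0 0.
have ind B C : measurable B -> stage_gen D h.+1 0 0 C ->
    (PP D (XE @^-1` B `&` C) = Q B * PP D C)%E.
  move=> mB GC; rewrite /Q /distribution /pushforward -[X in (PP D X * _)%E]setIT.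
  rewrite !(@indep_pair _ _ _ _ _ _ _ (PP D) (mu D h) (PE D) _ _ mX mE)//.
  - by rewrite probability_setT mule1.
  - by move=> A1 A2 mA1 mA2; exact: (prXE_indep Dsim _ hH mA1 mA2 (stage_gen_setT _ _ _ _)).
  - exact: stm.
  - by move=> A1 A2 mA1 mA2; exact: (prXE_indep Dsim _ hH mA1 mA2 GC).
have draws := iid_draws_single mXE stm (stage_gen_setT _ _ _ _) (@stage_gen_setI _ _ _ _ _ _ _ _ _ D _ _ _) ind.
pose B : set ((S * E) * Omega) := [set z | `|V h.+1 (step D h.+1 (z.1.1, a, z.1.2)) z.2| <= Vmax D].
have mf : measurable_fun [set: (S * E) * g_sigma_algebraType (stage_gen D h.+1 0 0)]
    (fun z => V h.+1 (step D h.+1 (z.1.1, a, z.1.2)) z.2).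
  have m1 : measurable_fun [set: (S * E) * g_sigma_algebraType (stage_gen D h.+1 0 0)]
      (fun z => (z.1.1, a, z.1.2)).
    apply: measurable_fun_pair; last exact: (measurableT_comp measurable_snd measurable_fst).
    apply: measurable_fun_pair; last exact: measurable_cst.
    exact: (measurableT_comp measurable_fst measurable_fst).
  have m2 := measurableT_comp (@step_meas _ _ _ _ _ _ _ _ _ _ D1 h.+1 hH) m1.
  exact: (measurableT_comp (@measurable_stage_section h.+1 0 hH)
    (measurable_fun_pair m2 measurable_snd)).
pose G n := if n is 0%N then stage_gen D h.+1 0 0 else measurable.
have mB := @measurable_norm_le _ _ _ _ _ G _ (Vmax D) mf.
apply: (ae_draw draws ord0 mB).
apply: ae_prod_section; first exact: (measurable_ae_pairs draws mB).
move=> e; apply: filterS (V_bounded (step D h.+1 (e.1, a, e.2)) hH) => w Vw; exact: le_trans Vw (Ltilde_le_Vmax _).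
Qed.

(** The entries of [beta] are almost surely at most [Vmax D * Lambda_pr D], which makes the
    objective of each action Lipschitz in the state. Then [V h y'] plus the Lipschitz term is an
    almost sure upper bound of the family at [y], and minimality of the essential supremum compares
    it with [V h y]. *)
Lemma V_lip h x x' : (h < H)%N ->
  {ae PP D, forall w, `|V h x w - V h x' w| <= LV D * mdist x x'}.
Proof.
move=> hH.
have objlip y y' a : {ae PP D, forall w,
    `|primal_objective D (V h.+1) h y a w - primal_objective D (V h.+1) h y' a w| <= LV D * mdist y y'}.
  apply: filterS (ae_forall_fin (fun i => V_next_bounded a i hH)) => w Hw.
  rewrite /primal_objective opprD addrACA /LV mulrDl; apply: le_trans (ler_normD _ _) _.
  apply: lerD; first exact: reward_lip.
  apply: le_trans (trunc_lip _ _ _) _.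
  have -> : dot (beta D (V h.+1) h a w) (gamma D y) - dot (beta D (V h.+1) h a w) (gamma D y') =
      dot (beta D (V h.+1) h a w) (gamma D y - gamma D y').
    by rewrite /dot -sumrB; apply: eq_bigr => k _; rewrite !mxE mulrBr.
  have VL0 : 0 <= Vmax D * Lambda_pr D by rewrite mulr_ge0 ?Vmax_ge0 ?Lambda_pr_ge0.
  apply: le_trans (dot_le _ VL0 _) _.
    move=> k; rewrite /beta mxE summxE.
    have n0 : 0 < (n_pr D)%:R :> R by rewrite ltr0n n_pr_gt0.
    rewrite normrM normfV (ger0_norm (ltW n0)) mulrC ler_pdivrMr//.
    apply: le_trans (ler_norm_sum _ _ _) _.
    apply: (@le_trans _ _ (\sum_(i < n_pr D) Vmax D * Lambda_pr D)); last first.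
      by rewrite sumr_const card_ord mulr_natr.
    apply: ler_sum => i _; rewrite mxE normrM ler_pM//.
    by apply: le_trans (normr_entry_le _ _) _; exact: Sigma_pr_bd.
  rewrite [leRHS](_ : _ = Vmax D * Lambda_pr D * Num.sqrt (Kpr D)%:R * (Lgamma D * mdist y y')).
    by apply: ler_wpM2l; [rewrite mulr_ge0 ?sqrtr_ge0|exact: gamma_lip].
  by ring.
have half y y' : {ae PP D, forall w, V h y w <= V h y' w + LV D * mdist y y'}.
  have [_ _ lub] := primal_rec PV hH y; have [_ ub _] := primal_rec PV hH y'.
  suff : {ae PP D, forall w, ((V h y w)%:E <= (V h y' w + LV D * mdist y y')%:E)%E}.
    by apply: filterS => w; rewrite lee_fin.
  apply: lub.
    apply/measurable_EFinP; apply: measurable_funD => //; exact: measurable_Vx (ltnW hH).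
  move=> a; apply: filterS2 (ub a) (objlip y y' a) => w; rewrite !lee_fin ler_norml.
  by move=> h1 /andP[_ h2]; lra.
apply: filterS2 (half x x') (half x' x) => w; rewrite (metric_sym x') => h1 h2.
by rewrite ler_norml; apply/andP; split; lra.
Qed.

End primal.

(** * The projection *)

Section bounded_measurable.
Context d (E : measurableType d) (R : realType) (Q : probability E R).
Implicit Types f g : E -> R.

(** A class closed under sums and products on which the integral is finite and linear. It contains
    the basis and the value functions, so it settles all integrability conditions of the
    projection. *)
Definition bounded_measurable f : Prop :=
  measurable_fun [set: E] f /\ exists b : R, forall e, `|f e| <= b.

Lemma bounded_measurable_integrable f : bounded_measurable f ->
  Q.-integrable [set: E] (EFin \o f).
Proof. by move=> [mf [b fb]]; exact: bounded_integrable fb. Qed.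

Lemma bounded_measurable_cst (c : R) : bounded_measurable (fun=> c).
Proof. by split => //; exists `|c|. Qed.

Lemma bounded_measurableD f g : bounded_measurable f -> bounded_measurable g ->
  bounded_measurable (fun e => f e + g e).
Proof.
move=> [mf [b fb]] [mg [c gc]]; split; first exact: measurable_funD.
by exists (b + c) => e; rewrite (le_trans (ler_normD _ _))// lerD.
Qed.

Lemma bounded_measurableB f g : bounded_measurable f -> bounded_measurable g ->
  bounded_measurable (fun e => f e - g e).
Proof.
move=> [mf [b fb]] [mg [c gc]]; split; first exact: measurable_funB.
by exists (b + c) => e; rewrite (le_trans (ler_normB _ _))// lerD.
Qed.

Lemma bounded_measurableM f g : bounded_measurable f -> bounded_measurable g ->
  bounded_measurable (fun e => f e * g e).
Proof.
move=> [mf [b fb]] [mg [c gc]]; split; first exact: measurable_funM.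
by exists (b * c) => e; rewrite normrM ler_pM.
Qed.

Lemma bounded_measurable_sum (I : Type) (s : seq I) (F : I -> E -> R) :
  (forall i, bounded_measurable (F i)) -> bounded_measurable (fun e => \sum_(i <- s) F i e).
Proof.
move=> bF; elim: s => [|i s IH].
  by under eq_fun do rewrite big_nil; exact: bounded_measurable_cst.
by under eq_fun do rewrite big_cons; exact: bounded_measurableD.
Qed.

Lemma bounded_measurable_sqr f : bounded_measurable f -> bounded_measurable (fun e => f e ^+ 2).
Proof. by move=> bf; under eq_fun do rewrite expr2; exact: bounded_measurableM. Qed.

Lemma Rintegral_add f g : bounded_measurable f -> bounded_measurable g ->
  \int[Q]_e (f e + g e) = \int[Q]_e f e + \int[Q]_e g e.
Proof. by move=> bf bg; rewrite RintegralD//; exact: bounded_measurable_integrable. Qed.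

Lemma Rintegral_scale f (c : R) : bounded_measurable f ->
  \int[Q]_e (c * f e) = c * \int[Q]_e f e.
Proof. by move=> bf; rewrite RintegralZl//; exact: bounded_measurable_integrable. Qed.

Lemma Rintegral_sum (I : Type) (s : seq I) (F : I -> E -> R) :
  (forall i, bounded_measurable (F i)) ->
  \int[Q]_e (\sum_(i <- s) F i e) = \sum_(i <- s) \int[Q]_e F i e.
Proof.
move=> bF; elim: s => [|i s IH].
  by under eq_Rintegral do rewrite big_nil; rewrite big_nil Rintegral_cst// mul0r.
under eq_Rintegral do rewrite big_cons.
by rewrite big_cons Rintegral_add ?IH//; exact: bounded_measurable_sum.
Qed.

Lemma Rintegral_EFin f : bounded_measurable f ->
  (\int[Q]_e (f e)%:E)%E = (\int[Q]_e f e)%:E.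
Proof.
move=> bf; rewrite /Rintegral fineK//.
by apply: integrable_fin_num => //; exact: bounded_measurable_integrable.
Qed.

(** The variance of [f e * g e] is nonnegative; then [g e ^+ 2] is bounded by [c ^+ 2]. *)
Lemma sqr_Rintegral_le f (c : R) (g : E -> R) : bounded_measurable f -> bounded_measurable g ->
  (forall e, `|g e| <= c) ->
  (\int[Q]_e (f e * g e)) ^+ 2 <= c ^+ 2 * \int[Q]_e (f e ^+ 2).
Proof.
move=> bf bg gc; set m := \int[Q]_e (f e * g e).
have bfg : bounded_measurable (fun e => f e * g e) by exact: bounded_measurableM.
have : 0 <= \int[Q]_e ((f e * g e - m) ^+ 2) by apply: Rintegral_ge0 => e _; exact: sqr_ge0.
have -> : \int[Q]_e ((f e * g e - m) ^+ 2) = \int[Q]_e ((f e * g e) ^+ 2) - m ^+ 2.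
  rewrite (@eq_Rintegral _ _ _ Q setT
    (fun e => (f e * g e) ^+ 2 + ((- 2 * m) * (f e * g e) + m ^+ 2))); last by move=> e _; ring.
  rewrite Rintegral_add//; last 2 first.
  - exact: bounded_measurable_sqr.
  - apply: bounded_measurableD; last exact: bounded_measurable_cst.
    by apply: bounded_measurableM => //; exact: bounded_measurable_cst.
  rewrite Rintegral_add//; last 2 first.
  - by apply: bounded_measurableM => //; exact: bounded_measurable_cst.
  - exact: bounded_measurable_cst.
  rewrite Rintegral_scale// Rintegral_cst// [X in fine X]probability_setT/= mulr1 -/m.
  by ring.
rewrite subr_ge0 => /le_trans; apply.
rewrite -Rintegral_scale; last exact: bounded_measurable_sqr.
apply: le_Rintegral => //.
- by apply: bounded_measurable_integrable; exact: bounded_measurable_sqr.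
- apply: bounded_measurable_integrable; apply: bounded_measurableM; last exact: bounded_measurable_sqr.
  exact: bounded_measurable_cst.
- move=> e _; rewrite exprMn mulrC ler_wpM2r ?sqr_ge0//.
  rewrite -(real_normK (num_real (g e))) ler_pXn2r ?nnegrE//.
  exact: le_trans (normr_ge0 _) (gc e).
Qed.

End bounded_measurable.

Section least_squares.
Context d (E : measurableType d) (R : realType) (Q : probability E R).
Variables (K : nat) (psi : E -> 'cV[R]_K) (f : E -> R).
Hypothesis bf : bounded_measurable f.
Hypothesis bpsi : forall i, bounded_measurable (fun e => psi e i 0).
Hypothesis gram_unit : gram Q psi \in unitmx.

Let err (c : 'cV[R]_K) : R := \int[Q]_e ((f e - dot c (psi e)) ^+ 2).

Definition projection : 'cV[R]_K := invmx (gram Q psi) *m \col_i \int[Q]_e (f e * psi e i 0).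

Let bdot c : bounded_measurable (fun e => dot c (psi e)).
Proof.
apply: bounded_measurable_sum => i; apply: bounded_measurableM => //.
exact: bounded_measurable_cst.
Qed.

Let integral_mul_dot g c : bounded_measurable g ->
  \int[Q]_e (g e * dot c (psi e)) = \sum_i c i 0 * \int[Q]_e (g e * psi e i 0).
Proof.
move=> bg; have bgp i : bounded_measurable (fun e => g e * psi e i 0).
  exact: bounded_measurableM.
under eq_Rintegral do rewrite /dot mulr_sumr.
rewrite Rintegral_sum; last first.
  move=> i; apply: bounded_measurableM => //; apply: bounded_measurableM => //.
  exact: bounded_measurable_cst.
apply: eq_bigr => i _; under eq_Rintegral do rewrite mulrCA.
by rewrite Rintegral_scale.
Qed.

Lemma projection_normal i :
  \int[Q]_e (psi e i 0 * (f e - dot projection (psi e))) = 0.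
Proof.
have gE : gram Q psi *m projection = \col_i \int[Q]_e (f e * psi e i 0).
  by rewrite /projection mulKVmx.
under eq_Rintegral do rewrite mulrBr mulrC.
rewrite RintegralB//; last 2 first.
- by apply: bounded_measurable_integrable; exact: bounded_measurableM.
- by apply: bounded_measurable_integrable; exact: bounded_measurableM.
rewrite integral_mul_dot//.
have := congr1 (fun m : 'cV_K => m i 0) gE; rewrite !mxE => <-.
apply/eqP; rewrite subr_eq0; apply/eqP; apply: eq_bigr => j _.
by rewrite mxE mulrC.
Qed.

(** Pythagoras: by the normal equations the residual is orthogonal to the span of the basis, so the
    cross term vanishes. *)
Lemma err_projection c :
  err c = err projection + \int[Q]_e (dot (c - projection) (psi e) ^+ 2).
Proof.
have bU : bounded_measurable (fun e => f e - dot projection (psi e)) by exact: bounded_measurableB.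
set U := fun e => f e - dot projection (psi e); set dd := c - projection.
have bUd : bounded_measurable (fun e => U e * dot dd (psi e)) by exact: bounded_measurableM.
have bd2 : bounded_measurable (fun e => dot dd (psi e) ^+ 2) by exact: bounded_measurable_sqr.
have bU2 : bounded_measurable (fun e => U e ^+ 2) by exact: bounded_measurable_sqr.
have bM2 : bounded_measurable (fun e => (- 2) * (U e * dot dd (psi e))).
  by apply: bounded_measurableM => //; exact: bounded_measurable_cst.
rewrite /err (@eq_Rintegral _ _ _ Q setT
  (fun e => U e ^+ 2 + ((- 2) * (U e * dot dd (psi e)) + dot dd (psi e) ^+ 2))); last first.
  move=> e _; rewrite (_ : f e - dot c (psi e) = U e - dot dd (psi e)); first by ring.
  rewrite /U -addrA -opprD; congr (_ - _); rewrite /dot -big_split/=; apply: eq_bigr => i _.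
  by rewrite !mxE; ring.
rewrite Rintegral_add//; last exact: bounded_measurableD.
rewrite Rintegral_add// Rintegral_scale// integral_mul_dot// big1 ?mulr0 ?add0r// => i _.
by under eq_Rintegral do rewrite mulrC; rewrite projection_normal mulr0.
Qed.

Lemma err_projection_unique c : err c <= err projection -> c = projection.
Proof.
rewrite err_projection gerDl; set dd := c - projection => d2.
have b2 : bounded_measurable (fun e => dot dd (psi e) ^+ 2) by exact: bounded_measurable_sqr.
have d20 : \int[Q]_e (dot dd (psi e) ^+ 2) = 0.
  by apply/eqP; rewrite eq_le d2 Rintegral_ge0// => e _; exact: sqr_ge0.
(* A function of zero second moment is orthogonal to every basis function, hence [gram Q psi *m dd]
   vanishes. Orthogonality follows from the sign of a quadratic in [s]. *)
have psid i : \int[Q]_e (psi e i 0 * dot dd (psi e)) = 0.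
  set a := LHS; pose b := \int[Q]_e (psi e i 0 ^+ 2).
  have b0 : 0 <= b by apply: Rintegral_ge0 => e _; exact: sqr_ge0.
  have bp2 : bounded_measurable (fun e => psi e i 0 ^+ 2) by exact: bounded_measurable_sqr.
  have bpd : bounded_measurable (fun e => psi e i 0 * dot dd (psi e)) by exact: bounded_measurableM.
  have quad s : 0 <= 2 * s * a + s ^+ 2 * b.
    have -> : 2 * s * a + s ^+ 2 * b = \int[Q]_e ((dot dd (psi e) + s * psi e i 0) ^+ 2).
      rewrite (@eq_Rintegral _ _ _ Q setT (fun e => dot dd (psi e) ^+ 2 +
        (2 * s * (psi e i 0 * dot dd (psi e)) + s ^+ 2 * psi e i 0 ^+ 2))); last first.
        by move=> e _; ring.
      have bm1 : bounded_measurable (fun e => 2 * s * (psi e i 0 * dot dd (psi e))).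
        by apply: bounded_measurableM => //; exact: bounded_measurable_cst.
      have bm2 : bounded_measurable (fun e => s ^+ 2 * psi e i 0 ^+ 2).
        by apply: bounded_measurableM => //; exact: bounded_measurable_cst.
      rewrite Rintegral_add//; last exact: bounded_measurableD.
      by rewrite Rintegral_add// !Rintegral_scale// d20 add0r.
    by apply: Rintegral_ge0 => e _; exact: sqr_ge0.
  have b1 : 0 < b + 1 by rewrite ltr_wpDl.
  (* Dividing by [b + 1] instead of [b] avoids a separate case [b = 0]. *)
  have := quad (- a / (b + 1)).
  rewrite (_ : _ + _ = - (a ^+ 2 * ((b + 2) / (b + 1) ^+ 2))); last by field; rewrite gt_eqF.
  rewrite oppr_ge0 pmulr_lle0; last by rewrite divr_gt0 ?exprn_gt0// ltr_wpDl.
  by move=> a2; apply/eqP; rewrite -sqrf_eq0 eq_le a2 sqr_ge0.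
suff /eqP : dd = 0 by rewrite subr_eq0 => /eqP.
have : gram Q psi *m dd = 0.
  apply/matrixP => i j; rewrite !mxE (ord1 j) -[RHS](psid i) integral_mul_dot//.
  by apply: eq_bigr => k _; rewrite mxE mulrC.
by move=> /(congr1 (mulmx (invmx (gram Q psi)))); rewrite mulKmx// mulmx0.
Qed.

(** The set of minimizers is exactly the singleton of the projection, so the default value 0 of
    [xget] is not reached. *)
Lemma xget_projection : xget 0 [set c | forall c',
    (\int[Q]_e ((f e - dot c (psi e)) ^+ 2)%:E <= \int[Q]_e ((f e - dot c' (psi e)) ^+ 2)%:E)%E] =
  projection.
Proof.
have errE c : (\int[Q]_e ((f e - dot c (psi e)) ^+ 2)%:E)%E = (err c)%:E.
  by rewrite Rintegral_EFin//; apply: bounded_measurable_sqr; exact: bounded_measurableB.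
case: xgetP => [c _ /(_ projection)|/(_ projection)].
  by rewrite !errE lee_fin; exact: err_projection_unique.
move=> H; exfalso; apply: H => c /=; rewrite !errE lee_fin (err_projection c) lerDl.
by apply: Rintegral_ge0 => e _; exact: sqr_ge0.
Qed.

End least_squares.

(* [f] need not be measurable: [return_expectation] integrates functions whose
   measurability is not known beforehand. *)
Lemma normr_Rintegral_le_nomeas d (T : measurableType d) (R : realType)
    (m : {measure set T -> \bar R}) (f : T -> R) (c : R) : m setT = 1%E -> 0 <= c ->
  (forall x, `|f x| <= c) -> `|\int[m]_x f x| <= c.
Proof.
move=> m1 c0 fc.
have bd (g : T -> \bar R) : (forall x, (0 <= g x)%E) -> (forall x, (g x <= c%:E)%E) ->
    exists2 r : R, (\int[m]_x g x)%E = r%:E & 0 <= r <= c.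
  move=> g0 gc.
  have i0 : (0 <= \int[m]_x g x)%E by exact: integral_ge0.
  have ic : (\int[m]_x g x <= c%:E)%E.
    apply: le_trans (ge0_le_integral_nomeas (g := cst c%:E) m _ _) _ => //.
    by rewrite integral_cst// m1 mule1.
  move: i0 ic; case: (\int[m]_x g x)%E => [r||]// i0 ic; exists r => //.
  by rewrite -!lee_fin i0 ic.
have fpos x : (((EFin \o f)^\+)%E x <= c%:E)%E.
  rewrite funeposE /= -EFin_max lee_fin ge_max c0 andbT.
  exact: le_trans (ler_norm _) (fc x).
have fneg x : (((EFin \o f)^\-)%E x <= c%:E)%E.
  rewrite funenegE /= -EFin_max lee_fin ge_max c0 andbT.
  by apply: le_trans (ler_norm _) _; rewrite normrN.
have [p pE /andP[p0 pc]] := bd _ (fun x => funepos_ge0 _ x) fpos.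
have [q qE /andP[q0 qc]] := bd _ (fun x => funeneg_ge0 _ x) fneg.
rewrite /Rintegral integralE [X in (X - _)%E]pE [X in (_ - X)%E]qE /= ler_norml.
by apply/andP; split; lra.
Qed.

Lemma normr_sup_le (R : realType) (B : set R) (c : R) : B !=set0 ->
  (forall x, B x -> `|x| <= c) -> `|sup B| <= c.
Proof.
move=> B0 Bc; rewrite ler_norml; apply/andP; split; last first.
  by apply: ge_sup => // x /Bc /(le_trans (ler_norm _)).
have [x Bx] := B0; apply: (@le_trans _ _ x).
  by have := Bc x Bx; rewrite ler_norml => /andP[].
apply: ub_le_sup => //; exists c => y /Bc; exact: le_trans (ler_norm _).
Qed.

(** * Change of measure from the transition kernel, and the exact dual coefficients *)

Section densities.
Local Open Scope ereal_scope.
Context (R : realType) (dS dA dE dO : measure_display).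
Context (S : metricMeasurableType dS R) (A : metricMeasurableType dA R).
Context (E : measurableType dE) (Omega : measurableType dO).
Variable D : setting S A E Omega.
Hypotheses (D1 : B1 D) (D3 : B3 D).
Local Notation H := (horizon D).

Lemma measurable_step h z : (1 <= h <= H)%N ->
  measurable_fun [set: E] (fun e => step D h (z, e)).
Proof.
move=> hH; apply: (measurableT_comp (@step_meas _ _ _ _ _ _ _ _ _ _ D1 h hH)).
exact: measurable_fun_pair.
Qed.

Lemma integral_trans h z (f : S -> \bar R) : (1 <= h <= H)%N ->
  measurable_fun [set: S] f -> (forall x, 0 <= f x) ->
  \int[kernel_at (trans D h) z]_x f x = \int[PE D]_e f (step D h (z, e)).
Proof.
move=> hH mf f0; have ms := measurable_step z hH.
pose st : {mfun E >-> S} := HB.pack (fun e => step D h (z, e)) (isMeasurableFun.Build _ _ _ _ _ ms).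
transitivity (\int[distribution (PE D) st]_x f x).
  apply: eq_measure_integral => B mB _.
  by rewrite /kernel_at /= (transE D1 z hH mB).
by rewrite /distribution ge0_integral_pushforward.
Qed.

(** The left-hand side is an integral against the transition kernel, hence one against [mu D h] with
    the Radon-Nikodym derivative as a factor. Absolute values are taken because [density_norm]
    bounds the absolute value of the derivative almost everywhere. *)
Lemma integral_trans_le h z (f : S -> R) (b : R) : (1 <= h <= H)%N ->
  measurable_fun [set: S] f -> (forall x, 0 <= f x <= b)%R ->
  \int[PE D]_e (f (step D h (z, e)))%:E <= density_norm D h z * \int[mu D h]_x (f x)%:E.
Proof.
move=> hH mf fb.
have f0 x : (0 <= f x)%R by have /andP[] := fb x.
have mfE : measurable_fun [set: S] (fun x => (f x)%:E) by exact/measurable_EFinP.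
pose nu := [the probability _ _ of kernel_at (trans D h) z].
rewrite -(@integral_trans h z (fun x => (f x)%:E))//.
have nu_mu : nu `<< mu D h by exact: trans_ac.
have If : nu.-integrable [set: S] (fun x => (f x)%:E).
  by apply: (@bounded_integrable _ _ _ nu f b) => // x; rewrite ger0_norm//; have /andP[] := fb x.
rewrite -(Radon_Nikodym_change_of_variables nu_mu measurableT If).
set rn := Radon_Nikodym _ _.
have mrn : measurable_fun [set: S] rn.
  by apply: measurable_int; exact: Radon_Nikodym_integrable.
have mfrn : measurable_fun [set: S] (fun x => (f x)%:E * rn x) by exact: emeasurable_funM.
apply: le_trans (lee_abs _) _.
apply: le_trans (le_abse_integral (mu D h) measurableT mfrn) _.
have dn0 : 0 <= density_norm D h z by exact: Lnorm_ge0.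
rewrite -ge0_integralZl//; last by move=> x _; rewrite lee_fin.
apply: ae_ge0_le_integral => //.
- exact: measurableT_comp.
- by move=> x _; rewrite mule_ge0// lee_fin.
- exact: emeasurable_funM.
have : \forall x \ae mu D h, (abse \o rn) x <= density_norm D h z.
  have := @ess_sup_ge _ _ _ (mu D h) (abse \o rn).
  by rewrite /density_norm unlock /= probability_setT lte01.
apply: filterS => x rnx _; rewrite abseM gee0_abs ?lee_fin// muleC.
by apply: lee_wpmul2r => //; rewrite lee_fin.
Qed.

End densities.

Section projections.
Context (R : realType) (dS dA dE dO : measure_display).
Context (S : metricMeasurableType dS R) (A : metricMeasurableType dA R).
Context (E : measurableType dE) (Omega : measurableType dO).
Variable D : setting S A E Omega.
Hypotheses (Dst : standing D) (D1 : B1 D) (D2 : B2 D) (D4 : B4 D).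
Local Notation H := (horizon D).

Lemma return_expectation_bd pi n h x r : (h + n = H)%N ->
  `|return_expectation D pi n h x r| <= `|r| + n.+1%:R * Rmax D.
Proof.
have R0 := Rmax_ge0 D2.
elim: n h x r => [|n IH] h x r hn /=.
  by rewrite mul1r (le_trans (ler_normD _ _))// lerD//; exact: term_bd.
have hH : (h < H)%N by rewrite -hn -addSnnS leq_addr.
apply: normr_Rintegral_le_nomeas => [||a].
- exact: prob_kernel.
- by rewrite addr_ge0 ?mulr_ge0.
apply: normr_Rintegral_le_nomeas => [||y].
- exact: prob_kernel.
- by rewrite addr_ge0 ?mulr_ge0.
apply: le_trans (IH _ _ _ _) _; first by rewrite addSnnS.
have := ler_normD r (reward D h (x, a)); have := reward_bd D2 (x, a) hH.
rewrite -[in X in _ -> _ -> _ <= X]natr1 mulrDl mul1r; lra.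
Qed.

Lemma Vstar_bd h x : (h <= H)%N -> `|Vstar D h x| <= Ltilde D h.
Proof.
move=> hH; apply: normr_sup_le.
  (* A constant Dirac policy shows that the set of returns is nonempty. *)
  pose pi0 : policy S A := fun=> kdirac (measurable_cst point).
  by exists (return_expectation D pi0 (H - h) h x 0), pi0.
move=> _ [pi _ <-].
by apply: le_trans (return_expectation_bd _ _ _ _) _; rewrite ?subnKC// normr0 add0r.
Qed.

Lemma Lambda_du_ge0 : 0 <= Lambda_du D.
Proof. by apply: le_trans (Sigma_du_bd D4 point). Qed.

Lemma measurable_psi k : measurable_fun [set: E] (fun e => psi D e k 0).
Proof. by have := psi_L2 D4 k; move=> /sub_Lfun_mfun; rewrite inE. Qed.

Local Notation wpsi e := (invmx (Sigma_du D) *m psi D e).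

Lemma wpsi_bd e k : `|wpsi e k 0| <= Lambda_du D.
Proof. by apply: le_trans (normr_entry_le _ _) _; exact: Sigma_du_bd. Qed.

Lemma measurable_wpsi k : measurable_fun [set: E] (fun e => wpsi e k 0).
Proof.
under eq_fun do rewrite mxE; apply: measurable_sum => i.
by apply: measurable_funM => //; exact: measurable_psi.
Qed.

(** [Sigma_du_bd] bounds the basis after multiplication by the inverse Gram matrix. Multiplying back
    gives some bound on the basis itself, which is enough for integrability. *)
Lemma bounded_psi k : bounded_measurable (fun e => psi D e k 0).
Proof.
split; first exact: measurable_psi.
exists (\sum_j `|Sigma_du D k j| * Lambda_du D) => e.
rewrite -[psi D e](mulKVmx (Sigma_du_unit D4)) mxE; apply: le_trans (ler_norm_sum _ _ _) _.
by apply: ler_sum => j _; rewrite normrM ler_wpM2l// wpsi_bd.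
Qed.

Lemma bounded_wpsi k : bounded_measurable (fun e => wpsi e k 0).
Proof. by split; [exact: measurable_wpsi|exists (Lambda_du D) => e; exact: wpsi_bd]. Qed.

Lemma bounded_Vstar_step t z : (t < H)%N ->
  bounded_measurable (fun e => Vstar D t.+1 (step D t.+1 (z, e))).
Proof.
move=> tH; split; last by exists (Ltilde D t.+1) => e; exact: Vstar_bd.
have ms : measurable_fun [set: E] (fun e => step D t.+1 (z, e)) by exact: measurable_step.
exact: (measurableT_comp (Vstar_meas Dst tH) ms).
Qed.

(** This is the mean of a summand of [c_dual] with [Vstar] in place of [V], so that the bias becomes
    the integral of the difference of the two value functions. *)
Lemma c_projE t z k : (t < H)%N ->
  c_proj D t z k 0 = \int[PE D]_e (Vstar D t.+1 (step D t.+1 (z, e)) * wpsi e k 0).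
Proof.
move=> tH; have bV := bounded_Vstar_step z tH.
rewrite /c_proj /proj_error (xget_projection bV bounded_psi (Sigma_du_unit D4)).
rewrite /projection mxE.
have bVp i : bounded_measurable (fun e => Vstar D t.+1 (step D t.+1 (z, e)) * psi D e i 0).
  by apply: bounded_measurableM => //; exact: bounded_psi.
rewrite (@eq_Rintegral _ _ _ (PE D) setT (fun e => \sum_i invmx (Sigma_du D) k i *
  (Vstar D t.+1 (step D t.+1 (z, e)) * psi D e i 0))); last first.
  by move=> e _; rewrite mxE mulr_sumr; apply: eq_bigr => i _; rewrite mulrCA.
rewrite Rintegral_sum; last first.
  by move=> i; apply: bounded_measurableM => //; exact: bounded_measurable_cst.
by apply: eq_bigr => i _; rewrite mxE Rintegral_scale.
Qed.

End projections.

(** * The dual error *)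

Lemma dot_sqr_le (R : realType) n (u v : 'cV[R]_n) :
  dot u v ^+ 2 <= (\sum_i u i 0 ^+ 2) * enorm v ^+ 2.
Proof.
rewrite /enorm sqr_sqrtr; last by apply: sumr_ge0 => i _; exact: sqr_ge0.
set U := \sum_i u i 0 ^+ 2; set W := \sum_i v i 0 ^+ 2; set X := dot u v.
have W0 : 0 <= W by apply: sumr_ge0 => i _; exact: sqr_ge0.
have : 0 <= \sum_i (W * u i 0 - X * v i 0) ^+ 2 by apply: sumr_ge0 => i _; exact: sqr_ge0.
have -> : \sum_i (W * u i 0 - X * v i 0) ^+ 2 = W * (U * W - X ^+ 2).
  transitivity (\sum_i (W ^+ 2 * u i 0 ^+ 2 + ((- 2 * W * X) * (u i 0 * v i 0) + X ^+ 2 * v i 0 ^+ 2))).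
    by apply: eq_bigr => i _; ring.
  by rewrite !big_split/= -!mulr_sumr -/U -/W -/(dot u v) -/X; ring.
have [W00|Wp] := eqVneq W 0; last first.
  by rewrite pmulr_rge0 ?subr_ge0// lt_neqAle eq_sym Wp.
have v0 i : v i 0 = 0.
  apply/eqP; rewrite -sqrf_eq0; apply/eqP.
  exact: (psumr_eq0P (fun j _ => sqr_ge0 (v j 0)) W00).
by rewrite W00 mulr0 /X /dot big1 ?expr0n//= => i _; rewrite v0 mulr0.
Qed.

Section central_interpolation.
Context (R : realType) (T : Type) (rho : T -> T -> R) (I : finType) (g : I -> T) (i0 : I).
Variables (L : R) (f : T -> R) (z : T).
Hypothesis L0 : 0 <= L.
Hypothesis rho_ge0 : forall z z', 0 <= rho z z'.
Hypothesis f_lip : forall i, `|f z - f (g i)| <= L * rho z (g i).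

(** [f z] lies between the two envelopes. To bound the average on one side, one envelope is compared
    with [f z] and the other with its cone at [g i]. *)
Lemma central_interpolant_le i :
  `|f z - central_interpolant rho g L f z| <= L * rho z (g i).
Proof.
have fl j : f (g j) - L * rho z (g j) <= f z <= f (g j) + L * rho z (g j).
  by have := f_lip j; rewrite ler_norml => /andP[h1 h2]; apply/andP; split; lra.
have low1 : interp_low rho g L f z <= f z.
  apply: ge_sup; first by exists (f (g i0) - L * rho z (g i0)), i0.
  by move=> _ [j _ <-]; have /andP[] := fl j.
have low2 : f (g i) - L * rho z (g i) <= interp_low rho g L f z.
  apply: ub_le_sup; last by exists i.
  by exists (f z) => _ [j _ <-]; have /andP[] := fl j.
have up1 : f z <= interp_up rho g L f z.
  apply: lb_le_inf; first by exists (f (g i0) + L * rho z (g i0)), i0.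
  by move=> _ [j _ <-]; have /andP[] := fl j.
have up2 : interp_up rho g L f z <= f (g i) + L * rho z (g i).
  apply: ge_inf; last by exists i.
  by exists (f z) => _ [j _ <-]; have /andP[] := fl j.
have := f_lip i; rewrite /central_interpolant !ler_norml => /andP[h1 h2].
by apply/andP; split; lra.
Qed.

Lemma sqr_central_interpolant_le :
  (((f z - central_interpolant rho g L f z) ^+ 2)%:E <=
   (L ^+ 2)%:E * covering_radius rho g ^+ 2)%E.
Proof.
set e := f z - _; set m := inf [set rho z (g i) | i in [set: I]].
have m0 : 0 <= m.
  apply: lb_le_inf; first by exists (rho z (g i0)), i0.
  by move=> _ [i _ <-].
have em : `|e| <= L * m.
  have [L00|Ln0] := eqVneq L 0.
    by have := central_interpolant_le i0; rewrite -/e L00 !mul0r.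
  have Lp : 0 < L by rewrite lt_neqAle eq_sym Ln0.
  rewrite mulrC -ler_pdivrMr//; apply: lb_le_inf; first by exists (rho z (g i0)), i0.
  by move=> _ [i _ <-]; rewrite ler_pdivrMr// mulrC central_interpolant_le.
have mcov : (m%:E <= covering_radius rho g)%E by apply: ereal_sup_ubound; exists z.
apply: (@le_trans _ _ ((L ^+ 2)%:E * m%:E ^+ 2)%E).
  rewrite -EFin_expe -EFinM lee_fin -exprMn -(real_normK (num_real e)).
  by rewrite ler_pXn2r ?nnegrE ?mulr_ge0.
apply: lee_wpmul2l; first by rewrite lee_fin sqr_ge0.
by rewrite !expe2; apply: lee_pmul; rewrite ?lee_fin.
Qed.

End central_interpolation.

Section draws_in_set.
Local Open Scope ereal_scope.
Context d d' (Omega : measurableType d) (E : measurableType d') (R : realType).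
Variables (P : probability Omega R) (Q : probability E R) (M : nat).
Variables (eps : 'I_M -> Omega -> E) (G : nat -> set (set Omega)).
Hypothesis draws : iid_draws P Q eps G.

(** The event that the first [n] draws lie in [B] belongs to [G n], hence is independent of the next
    draw. *)
Lemma all_draws_in (B : set E) : measurable B ->
  P [set w | forall m, B (eps m w)] = Q B ^+ M.
Proof.
move=> mB; pose A n : set Omega := [set w | forall m : 'I_M, (m < n)%N -> B (eps m w)].
have AS n (nM : (n < M)%N) : A n.+1 = eps (Ordinal nM) @^-1` B `&` A n.
  apply/seteqP; split => w.
    by move=> Aw; split => [|m mn]; apply: Aw => //=; exact: ltnW.
  move=> [Bw Aw] m; rewrite ltnS leq_eqVlt => /orP[/eqP mn|]; last exact: Aw.
  by have -> : m = Ordinal nM by exact: val_inj.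
have GA n j : (j <= n)%N -> (j <= M)%N -> G n (A j).
  elim: j => [_ _|j IH jn jM].
    rewrite (_ : A 0%N = setT); first exact: (gen_setT draws).
    by apply/seteqP; split.
  rewrite (AS _ jM); apply: (gen_setI draws); first exact: (gen_draw draws).
  by apply: IH; exact: ltnW.
have PA n : (n <= M)%N -> P (A n) = Q B ^+ n.
  elim: n => [_|n IH nM].
    rewrite (_ : A 0%N = setT) ?probability_setT ?expe0//.
    by apply/seteqP; split.
  rewrite (AS _ nM) (draw_indep draws)//; last exact: GA (ltnW nM).
  by rewrite expeS IH// ltnW.
rewrite -PA//; congr (P _); apply/seteqP; split => w /= h m; first by move=> _; exact: h.
exact: h.
Qed.

End draws_in_set.

Section dual.
Context (R : realType) (dS dA dE dO : measure_display).
Context (S : metricMeasurableType dS R) (A : metricMeasurableType dA R).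
Context (E : measurableType dE) (Omega : measurableType dO).
Variable D : setting S A E Omega.
Hypotheses (Dst : standing D) (D1 : B1 D) (D2 : B2 D) (D3 : B3 D) (D4 : B4 D).
Hypothesis Dsim : simulation D.
Variable V : nat -> S -> Omega -> R.
Hypothesis PV : primal_approximation D V.
Variable t : nat.
Hypothesis tH : (t < horizon D)%N.
Hypothesis Vint : t.+1 = horizon D -> interpolable D V t.
Local Notation H := (horizon D).
Local Notation wpsi e := (invmx (Sigma_du D) *m psi D e).
Local Notation Og := (g_sigma_algebraType (stage_gen D t.+1 t.+1 0)).
Local Notation emp := (emp (PE D) (duE D t.+1)).

Lemma t_draws : iid_draws (PP D) (PE D) (duE D t.+1) (stage_gen D t.+1 t.+1).
Proof. exact: dual_draws. Qed.

(* For each [x], [V t.+1 x] is bounded by [Vmax D] only almost surely. *)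
Definition Vtrunc (x : S) (w : Omega) : R := trunc (Vmax D) (V t.+1 x w).

(** The truncated summand of [c_dual], as a function of a dual draw and of the primal randomness;
    its empirical process is the one that is chained. *)
Definition xi (k : 'I_(Kdu D)) (z : S * A) (x : E * Omega) : R :=
  Vtrunc (step D t.+1 (z, x.1)) x.2 * wpsi x.1 k 0.

Lemma Vtrunc_bd x w : `|Vtrunc x w| <= Vmax D.
Proof. exact: normr_trunc_le (Vmax_ge0 D2). Qed.

Lemma xi_bd k z x : `|xi k z x| <= Vmax D * Lambda_du D.
Proof. by rewrite normrM ler_pM// ?Vtrunc_bd// wpsi_bd. Qed.

Lemma measurable_Vstep z :
  measurable_fun [set: E * Og] (fun x => V t.+1 (step D t.+1 (z, x.1)) x.2).
Proof.
have ms : measurable_fun [set: E] (fun e => step D t.+1 (z, e)) by exact: measurable_step.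
have m1 : measurable_fun [set: E * Og] (fun x => step D t.+1 (z, x.1)).
  exact: (measurableT_comp ms measurable_fst).
exact: (measurableT_comp (@measurable_stage_section _ _ _ _ _ _ _ _ _ _ Dst _ PV t.+1 t.+1 tH)
  (measurable_fun_pair m1 measurable_snd)).
Qed.

Lemma measurable_xi k z : measurable_fun [set: E * Og] (xi k z).
Proof.
apply: measurable_funM; first exact: measurable_trunc (measurable_Vstep z).
exact: (measurableT_comp (measurable_wpsi D4 k) measurable_fst).
Qed.

(** At the dual draws [V t.+1] is almost surely within [Vmax D], so the truncation has no effect. *)
Lemma c_dualE z : {ae PP D, forall w, forall k,
  c_dual D V t z w k 0 = (n_du D)%:R^-1 * \sum_(m < n_du D) xi k z (duE D t.+1 m w, w)}.
Proof.
have mA := @measurable_norm_le _ _ _ _ _ (stage_gen D t.+1 t.+1) _ (Vmax D) (measurable_Vstep z).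
have VA : {ae (PE D \x PP D)%E, forall x, `|V t.+1 (step D t.+1 (z, x.1)) x.2| <= Vmax D}.
  apply: ae_prod_section; first exact: (measurable_ae_pairs t_draws mA).
  move=> e; apply: filterS (V_bounded D2 PV (step D t.+1 (z, e)) tH) => w Vw.
  exact: le_trans Vw (Ltilde_le_Vmax D2 _).
apply: filterS (ae_forall_fin (fun m => ae_draw t_draws m mA VA)) => w Vw k.
rewrite /c_dual mxE summxE; congr (_ * _); apply: eq_bigr => m _.
by rewrite mxE /xi /Vtrunc trunc_id//; exact: Vw.
Qed.

Lemma c_dual_emp z : {ae PP D, forall w, forall k,
  c_dual D V t z w k 0 - mean (PE D) (xi k z) w = emp (xi k z) w}.
Proof.
apply: filterS (c_dualE z) => w h k; rewrite h /emp sumrB mulrBr; congr (_ - _).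
rewrite sumr_const card_ord -[X in _ * X]mulr_natl mulrA mulVf ?mul1r//.
by rewrite pnatr_eq0 -lt0n n_du_gt0.
Qed.

Lemma Linterp_ge0 : 0 <= Linterp D.
Proof. by rewrite !mulr_ge0 ?LV_ge0// ?LK_ge0// Lambda_du_ge0. Qed.

(** The bound is one-sided so that the differences at draws violating it have the same sign and
    cannot cancel in the average. Exchanging [z] and [z'] gives the other side. *)
Lemma xi_lip_terminal k z z' : t.+1 = H ->
  {ae PE D, forall e, Vtrunc (step D t.+1 (z, e)) point * wpsi e k 0 -
    Vtrunc (step D t.+1 (z', e)) point * wpsi e k 0 <= Linterp D * rho D z z'}.
Proof.
move=> tH1; have M0 : 0 < (n_du D)%:R :> R by rewrite ltr0n n_du_gt0.
pose phi e := Vtrunc (step D t.+1 (z, e)) point * wpsi e k 0 -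
  Vtrunc (step D t.+1 (z', e)) point * wpsi e k 0.
(* At the horizon [V] is the terminal reward, so any [w] may be replaced by [point]. *)
have xiE z1 e w : xi k z1 (e, w) = Vtrunc (step D t.+1 (z1, e)) point * wpsi e k 0.
  by rewrite /xi /Vtrunc/= tH1 !(primal_term PV).
have mphi : measurable_fun [set: E] phi.
  have -> : phi = fun e => xi k z (e, point) - xi k z' (e, point).
    by apply/funext => e; rewrite !xiE.
  by apply: measurable_funB; exact: (measurable_pairl t_draws _ (measurable_xi k _)).
pose c := Linterp D * rho D z z'.
pose B : set E := [set e | c < phi e].
have mB : measurable B.
  have := mphi measurableT _ (measurable_itv `]c, +oo[).
  by congr measurable; apply/seteqP; split => e; rewrite setTI /= in_itv/= andbT.
(* All the [n_du D] draws fall into [B] with probability [PE D B ^+ n_du D], and then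
   the averages [c_dual] violate their Lipschitz bound. *)
pose F : set Omega := [set w | forall m, B (duE D t.+1 m w)].
have mF : measurable F.
  rewrite (_ : F = \bigcap_(m in [set: 'I_(n_du D)]) (duE D t.+1 m @^-1` B)); last first.
    by apply/seteqP; split => w /= h m; [move=> _; exact: h|exact: h].
  apply: fin_bigcap_measurable => // m _; rewrite -[X in measurable X]setTI.
  exact: (duE_meas Dsim m (_ : (1 <= t.+1 <= H)%N) measurableT).
have FAE : {ae PP D, forall w, (~` F) w}.
  apply: filterS2 (Vint tH1) (ae_forall_fin (fun b : bool => c_dualE (if b then z else z'))) => w lip cE Fw.
  have := lip k z z'; rewrite (cE true) (cE false) -mulrBr -sumrB.
  apply/negP; rewrite -ltNge; apply: lt_le_trans (ler_norm _).
  rewrite [X in _ < X]mulrC ltr_pdivlMr// mulr_natr -[X in _ *+ X]card_ord -sumr_const.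
  apply: ltr_sum => [|m _]; first by apply/hasP; exists (Ordinal (n_du_gt0 Dst)); rewrite ?mem_index_enum.
  by rewrite !xiE; exact: Fw.
have QB : (PE D B ^+ n_du D = 0)%E.
  rewrite -(all_draws_in t_draws mB) -[X in PP D X](setCK F).
  by apply: ae_measure0 FAE; exact: measurableC.
exists B; split => //.
  by move/eqP: QB; rewrite expe_eq0 => /andP[_ /eqP].
by move=> e /= /negP; rewrite -ltNge.
Qed.

(** Before the horizon, [Linterp] is the product of the Lipschitz constants of [V] and of [step]
    with the bound on the dual weights. The estimate is almost sure for each fixed [e], and
    [ae_prod_section] makes it joint. *)
Lemma xi_lip k z z' : {ae (PE D \x PP D)%E, forall x,
  `|xi k z x - xi k z' x| <= Linterp D * rho D z z'}.
Proof.
have mA : measurable ([set x | `|xi k z x - xi k z' x| <= Linterp D * rho D z z'] : set (E * Omega)).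
  apply: (measurable_ae_pairs t_draws); apply: measurable_norm_le.
  by apply: measurable_funB; exact: measurable_xi.
have [tH1|tH1] := eqVneq t.+1 H.
  have ae1 : {ae PE D, forall e, `|Vtrunc (step D t.+1 (z, e)) point * wpsi e k 0 -
      Vtrunc (step D t.+1 (z', e)) point * wpsi e k 0| <= Linterp D * rho D z z'}.
    apply: filterS2 (xi_lip_terminal k z z' tH1) (xi_lip_terminal k z' z tH1) => e.
    by rewrite (rhoC D z' z) ler_norml => h1 h2; apply/andP; split; lra.
  apply: filterS (ae_prod_fst (PP D) ae1) => x.
  by rewrite /xi /Vtrunc tH1 !(primal_term PV).
have tH2 : (t.+1 < H)%N by rewrite ltn_neqAle tH1.
apply: ae_prod_section => // e.
apply: filterS (V_lip Dst D1 D2 D3 Dsim PV (step D t.+1 (z, e)) (step D t.+1 (z', e)) tH2) => w Vw.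
rewrite /xi /= -mulrBl normrM /Linterp mulrAC; apply: ler_pM => //; last exact: wpsi_bd.
apply: le_trans (trunc_lip _ _ _) _; apply: le_trans Vw _.
by rewrite -mulrA; apply: ler_wpM2l; [exact: LV_ge0|exact: step_lip].
Qed.

End dual.

Section dual_errors.
Context (R : realType) (dS dA dE dO : measure_display).
Context (S : metricMeasurableType dS R) (A : metricMeasurableType dA R).
Context (E : measurableType dE) (Omega : measurableType dO).
Variable D : setting S A E Omega.
Hypotheses (Dst : standing D) (D1 : B1 D) (D2 : B2 D) (D3 : B3 D) (D4 : B4 D).
Hypothesis Dsim : simulation D.
Variable V : nat -> S -> Omega -> R.
Hypothesis PV : primal_approximation D V.
Variable t : nat.
Hypothesis tH : (t < horizon D)%N.
Hypothesis Vint : t.+1 = horizon D -> interpolable D V t.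
Local Notation H := (horizon D).
Local Notation wpsi e := (invmx (Sigma_du D) *m psi D e).
Local Notation emp := (emp (PE D) (duE D t.+1)).
Local Notation xi := (xi V t).
Local Notation Vtrunc := (Vtrunc D V t).
Local Notation gridD := (@grid R dS dA dE dO S A E Omega D).
Local Notation draws := (t_draws Dsim tH).

(** The Lipschitz bounds between [z] and the grid come from [xi_lip] at the draws, hence are also
    available before the horizon, where [interpolable] is not assumed. *)
Lemma c_interp_error z : {ae PP D, forall w, forall k,
  (((c_dual D V t z w k 0 - c_interp D V t z w k 0) ^+ 2)%:E <=
   (Linterp D ^+ 2)%:E * covering_radius (rho D) gridD ^+ 2)%E}.
Proof.
have M0 : 0 < (n_du D)%:R :> R by rewrite ltr0n n_du_gt0.
have ae1 : {ae PP D, forall w, forall p : ('I_(n_grid D) * 'I_(n_grid D)) * 'I_(Kdu D) * 'I_(n_du D),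
    `|xi p.1.2 z (duE D t.+1 p.2 w, w) - xi p.1.2 (gridD p.1.1) (duE D t.+1 p.2 w, w)| <=
      Linterp D * rho D z (gridD p.1.1)}.
  apply: ae_forall_fin => -[[i k] m] /=.
  have lip := xi_lip Dst D1 D2 D3 D4 Dsim PV tH Vint k z (gridD i).
  apply: (ae_draw draws m _ lip); apply: measurable_norm_le.
  by apply: measurable_funB; exact: measurable_xi.
have ae2 := c_dualE Dst D1 D2 Dsim PV tH z.
have ae3 := ae_forall_fin (fun i => c_dualE Dst D1 D2 Dsim PV tH (gridD i)).
apply: filterS2 (filterI ae1 ae2) ae3 => w [h1 h2] h3 k.
rewrite /c_interp [X in _ - X]mxE.
pose i0 := Ordinal (n_grid_gt0 Dst).
apply: (@sqr_central_interpolant_le _ _ _ _ _ (i0, i0) _ (fun z' => c_dual D V t z' w k 0)).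
- exact: (Linterp_ge0 Dst D1 D2 D3 D4).
- exact: (rho_ge0 D1).
move=> i; rewrite h2 h3 -mulrBr -sumrB normrM normfV (ger0_norm (ltW M0)) mulrC ler_pdivrMr//.
apply: le_trans (ler_norm_sum _ _ _) _.
rewrite mulr_natr -[X in _ *+ X]card_ord -sumr_const; apply: ler_sum => m _.
exact: (h1 (i, k, m)).
Qed.

(** The primal error with the simulations frozen: it bounds the bias for each [w], and its
    expectation is the squared [primal_error]. *)
Definition primal_sqerr (w : Omega) : \bar R :=
  (\int[mu D t.+1]_x ((Vstar D t.+1 x - Vtrunc x w) ^+ 2)%:E)%E.

Lemma measurable_Vtrunc : measurable_fun [set: S * Omega] (fun z => Vtrunc z.1 z.2).
Proof. exact: measurable_trunc (measurable_V Dst Dsim PV tH). Qed.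

Lemma measurable_sqerr :
  measurable_fun [set: S * Omega] (fun z => (Vstar D t.+1 z.1 - Vtrunc z.1 z.2) ^+ 2).
Proof.
apply: measurable_funX; apply: measurable_funB; last exact: measurable_Vtrunc.
exact: (measurableT_comp (Vstar_meas Dst tH) measurable_fst).
Qed.

Lemma measurable_primal_sqerr : measurable_fun [set: Omega] primal_sqerr.
Proof.
apply: (@measurable_fun_fubini_tonelli_G _ _ _ _ _ (mu D t.+1)
  (fun z => ((Vstar D t.+1 z.1 - Vtrunc z.1 z.2) ^+ 2)%:E)).
- by apply/measurable_EFinP; exact: measurable_sqerr.
- by move=> z; rewrite lee_fin sqr_ge0.
Qed.

Lemma primal_sqerr_ge0 w : (0 <= primal_sqerr w)%E.
Proof. by apply: integral_ge0 => x _; rewrite lee_fin sqr_ge0. Qed.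

Lemma integral_primal_sqerr : (\int[PP D]_w primal_sqerr w = primal_error D V t.+1 ^+ 2)%E.
Proof.
have mV := measurable_V Dst Dsim PV tH.
have mVs : measurable_fun [set: S * Omega] (fun z => Vstar D t.+1 z.1).
  exact: (measurableT_comp (Vstar_meas Dst tH) measurable_fst).
have p0 : (0 <= primal_error D V t.+1)%E by exact: Lnorm_ge0.
have -> : (primal_error D V t.+1 ^+ 2 =
    \int[mu D t.+1 \x PP D]_z ((Vstar D t.+1 z.1 - V t.+1 z.1 z.2) ^+ 2)%:E)%E.
  transitivity (primal_error D V t.+1 `^ 2)%E.
    move: p0; case: (primal_error D V t.+1) => [r r0||//].
      by rewrite -EFin_expe poweR_EFin powR_mulrn// -lee_fin.
    by rewrite poweRyr ?pnatr_eq0// expe2 mulyy.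
  rewrite /primal_error powR_Lnorm ?pnatr_eq0//; apply: eq_integral => z _.
  by rewrite abse_EFin poweR_EFin powR_mulrn// real_normK ?num_real.
transitivity (\int[mu D t.+1 \x PP D]_z ((Vstar D t.+1 z.1 - Vtrunc z.1 z.2) ^+ 2)%:E)%E.
  rewrite fubini_tonelli2//; last by move=> z; rewrite lee_fin sqr_ge0.
  by apply/measurable_EFinP; exact: measurable_sqerr.
apply: ae_eq_integral => //.
- by apply/measurable_EFinP; exact: measurable_sqerr.
- by apply/measurable_EFinP; apply: measurable_funX; exact: measurable_funB.
have : {ae (mu D t.+1 \x PP D)%E, forall z, `|V t.+1 z.1 z.2| <= Vmax D}.
  apply: ae_prod_section.
    have mn : measurable_fun [set: S * Omega] (fun z => `|V t.+1 z.1 z.2|) by exact: measurableT_comp.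
    have := mn measurableT _ (measurable_itv `]-oo, Vmax D]).
    by congr measurable; apply/seteqP; split => z; rewrite setTI /= in_itv.
  move=> x; apply: filterS (V_bounded D2 PV x tH) => w Vw.
  exact: le_trans Vw (Ltilde_le_Vmax D2 _).
by apply: filterS => z Vz _; rewrite /Vtrunc trunc_id.
Qed.

(** The bias integrates the difference of the value functions against a weight bounded by
    [Lambda_du D]; [sqr_Rintegral_le] and [integral_trans_le] then apply. Truncation makes this
    valid for every [w]. *)
Lemma c_proj_error z k w :
  (((c_proj D t z k 0 - mean (PE D) (xi k z) w) ^+ 2)%:E <=
   (Lambda_du D ^+ 2)%:E * (density_norm D t.+1 z * primal_sqerr w))%E.
Proof.
have bV := bounded_Vstar_step Dst D1 D2 z tH.
have mVt : measurable_fun [set: S] (fun x => Vtrunc x w).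
  exact: (measurableT_comp measurable_Vtrunc (measurable_fun_pair (@measurable_id _ _ setT) (measurable_cst w))).
have ms : measurable_fun [set: E] (fun e => step D t.+1 (z, e)) by exact: measurable_step.
have bVt : bounded_measurable (fun e => Vtrunc (step D t.+1 (z, e)) w).
  split; first exact: (measurableT_comp mVt ms).
  by exists (Vmax D) => e; exact: Vtrunc_bd.
have bw := bounded_wpsi D4 k.
have -> : c_proj D t z k 0 - mean (PE D) (xi k z) w =
    \int[PE D]_e ((Vstar D t.+1 (step D t.+1 (z, e)) - Vtrunc (step D t.+1 (z, e)) w) * wpsi e k 0).
  rewrite (c_projE Dst D1 D2 D4 z k tH) /mean.
  under [RHS]eq_Rintegral do rewrite mulrBl.
  by rewrite RintegralB//; apply: bounded_measurable_integrable; exact: bounded_measurableM.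
have bd := bounded_measurableB bV bVt.
apply: (@le_trans _ _ ((Lambda_du D ^+ 2)%:E *
    (\int[PE D]_e ((Vstar D t.+1 (step D t.+1 (z, e)) - Vtrunc (step D t.+1 (z, e)) w) ^+ 2)%:E))%E).
  rewrite Rintegral_EFin; last exact: bounded_measurable_sqr.
  by rewrite -EFinM lee_fin; apply: sqr_Rintegral_le => // e; exact: wpsi_bd.
apply: lee_wpmul2l; first by rewrite lee_fin sqr_ge0.
apply: (@integral_trans_le _ _ _ _ _ _ _ _ _ _ D1 D3 t.+1 z
  (fun x => (Vstar D t.+1 x - Vtrunc x w) ^+ 2) ((Ltilde D t.+1 + Vmax D) ^+ 2)) => //.
- by apply: measurable_funX; apply: measurable_funB => //; exact: (Vstar_meas Dst tH).
- move=> x; rewrite sqr_ge0/= -(real_normK (num_real (_ - _))).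
  rewrite ler_pXn2r ?nnegrE ?addr_ge0 ?Ltilde_ge0 ?Vmax_ge0//.
  rewrite (le_trans (ler_normB _ _))// lerD ?Vtrunc_bd//; exact: Vstar_bd.
Qed.

End dual_errors.

Section conclusion.
Local Open Scope ereal_scope.
Context (R : realType) (dS dA dE dO : measure_display).
Context (S : metricMeasurableType dS R) (A : metricMeasurableType dA R).
Context (E : measurableType dE) (Omega : measurableType dO).
Variable D : setting S A E Omega.
Hypotheses (Dst : standing D) (D1 : B1 D) (D2 : B2 D) (D3 : B3 D) (D4 : B4 D).
Hypothesis Dsim : simulation D.
Variable V : nat -> S -> Omega -> R.
Hypothesis PV : primal_approximation D V.
Variable t : nat.
Hypothesis tH : (t < horizon D)%N.
Hypothesis Vint : t.+1 = horizon D -> interpolable D V t.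
Local Notation gridD := (@grid R dS dA dE dO S A E Omega D).
Local Notation K := (Kdu D).
Local Notation cov := (covering_radius (rho D) gridD).
Local Notation N := (ereal_sup [set density_norm D t.+1 z | z in [set: S * A]]).
Local Notation X := ((Linterp D)%:E * entropy_integral (rho D) +
  (Linterp D)%:E * diameter (rho D) + (Vmax D * Lambda_du D)%:E).
Local Notation X0 := ((LV D * LK D)%:E * entropy_integral (rho D) +
  (LV D * LK D)%:E * diameter (rho D) + (Vmax D)%:E).

Let entropy_ge0 : 0 <= entropy_integral (rho D).
Proof. by apply: integral_ge0 => u _; exact: poweR_ge0. Qed.

Let diameter_ge0 : 0 <= diameter (rho D).
Proof.
apply: le_trans (ereal_sup_ubound _); last by exists (point, point).
by rewrite lee_fin; exact: rho_ge0.
Qed.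

Let N_ge0 : 0 <= N.
Proof.
apply: (@le_trans _ _ (density_norm D t.+1 point)); first exact: Lnorm_ge0.
by apply: ereal_sup_ubound; exists point.
Qed.

Let X0_ge0 : 0 <= X0.
Proof.
have l0 : (0 <= LV D * LK D)%R by rewrite mulr_ge0 ?LV_ge0 ?LK_ge0.
by rewrite !adde_ge0 ?mule_ge0 ?lee_fin ?Vmax_ge0.
Qed.

Let XE : X ^+ 2 = (Lambda_du D ^+ 2)%:E * X0 ^+ 2.
Proof.
have l0 : (0 <= LV D * LK D)%R by rewrite mulr_ge0 ?LV_ge0 ?LK_ge0.
have v0 : 0 <= (Vmax D)%:E by rewrite lee_fin Vmax_ge0.
have -> : X = (Lambda_du D)%:E * X0.
  move: entropy_ge0 diameter_ge0; move: (entropy_integral _) (diameter _) => I d I0 d0.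
  have lI0 : 0 <= (LV D * LK D)%:E * I by rewrite mule_ge0 ?lee_fin.
  have ld0 : 0 <= (LV D * LK D)%:E * d by rewrite mule_ge0 ?lee_fin.
  rewrite ge0_muleDr ?adde_ge0// ge0_muleDr//.
  by rewrite !muleA -!EFinM /Linterp !(mulrC _ (Lambda_du D)).
by rewrite !expe2 muleACA -EFinM expr2.
Qed.

(** [G] depends neither on the state-action pair nor on the fresh draw. The 3 comes from splitting
    each coefficient error into three, and the factors [K] from adding the same bound for all
    coefficients. *)
Lemma coefficient_error_bound : exists G : Omega -> \bar R,
  [/\ measurable_fun [set: Omega] G, forall w, 0 <= G w,
    forall z, {ae PP D, forall w, (\sum_k (c_proj D t z - c_interp D V t z w) k 0 ^+ 2)%:E <= G w}
    & \int[PP D]_w G w <= 3%:E * ((K%:R * 400 ^+ 2 * (n_du D)%:R^-1 * Lambda_du D ^+ 2)%:E * X0 ^+ 2 +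
        (K%:R * Lambda_du D ^+ 2)%:E * (N * primal_error D V t.+1 ^+ 2) +
        (K%:R * Linterp D ^+ 2)%:E * cov ^+ 2)].
Proof.
have [W WP] := choice (fun k => @chaining _ _ _ _ _ (PP D) (PE D) (n_du D) (duE D t.+1)
  (stage_gen D t.+1 t.+1) (t_draws Dsim tH) (n_du_gt0 Dst) (S * A)%type (rho D) point
  (xi V t k) (Vmax D * Lambda_du D)%R (Linterp D) (Linterp_ge0 Dst D1 D2 D3 D4)
  (fun z => measurable_xi Dst D1 D4 PV tH k z) (fun z x => xi_bd D2 D4 V t k z x)
  (rho_ge0 D1) (fun z z' => xi_lip Dst D1 D2 D3 D4 Dsim PV tH Vint k z z')).
pose Qe := primal_sqerr D V t.
have Q0 w : 0 <= Qe w by exact: primal_sqerr_ge0.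
have mQ : measurable_fun [set: Omega] Qe by exact: measurable_primal_sqerr.
have cov0 : 0 <= cov ^+ 2 by rewrite expe2; case: cov => [r||]; rewrite -?EFinM ?lee_fin -?expr2 ?sqr_ge0.
have W0 k w : 0 <= (W k w)%:E by rewrite lee_fin; have [_ + _ _] := WP k.
have mW k : measurable_fun [set: Omega] (fun w => (W k w)%:E).
  by apply/measurable_EFinP; have [] := WP k.
pose c2 : \bar R := (K%:R * Lambda_du D ^+ 2)%:E * N.
have c20 : 0 <= c2 by rewrite mule_ge0// lee_fin mulr_ge0 ?sqr_ge0.
pose c3 : \bar R := (K%:R * Linterp D ^+ 2)%:E * cov ^+ 2.
have c30 : 0 <= c3 by rewrite mule_ge0// lee_fin mulr_ge0 ?sqr_ge0.
have S0 w : 0 <= \sum_k (W k w)%:E by apply: sume_ge0.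
have mS : measurable_fun [set: Omega] (fun w => \sum_k (W k w)%:E) by exact: emeasurable_sum.
have mcQ : measurable_fun [set: Omega] (fun w => c2 * Qe w) by exact: emeasurable_funM.
have mSQ : measurable_fun [set: Omega] (fun w => \sum_k (W k w)%:E + c2 * Qe w).
  exact: emeasurable_funD.
have mSQ3 : measurable_fun [set: Omega] (fun w => \sum_k (W k w)%:E + c2 * Qe w + c3).
  exact: emeasurable_funD.
have cQ0 w : 0 <= c2 * Qe w by rewrite mule_ge0.
have SQ0 w : 0 <= \sum_k (W k w)%:E + c2 * Qe w by rewrite adde_ge0.
have SQ30 w : 0 <= \sum_k (W k w)%:E + c2 * Qe w + c3 by rewrite adde_ge0.
exists (fun w => 3%:E * (\sum_k (W k w)%:E + c2 * Qe w + c3)); split.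
- exact: emeasurable_funM.
- by move=> w; rewrite mule_ge0.
- move=> z.
  have ae1 := ae_forall_fin (fun k => let: And4 _ _ h _ := WP k in h z).
  have ae2 := c_dual_emp Dst D1 D2 Dsim PV tH z.
  have ae3 := c_interp_error Dst D1 D2 D3 D4 Dsim PV tH Vint z.
  apply: filterS2 (filterI ae1 ae2) ae3 => w [h1 h2] h3.
  have h k : (((c_proj D t z - c_interp D V t z w) k 0) ^+ 2)%:E <=
      3%:E * ((W k w)%:E + (Lambda_du D ^+ 2)%:E * (N * Qe w) + (Linterp D ^+ 2)%:E * cov ^+ 2).
    pose a1 := (c_dual D V t z w k 0 - mean (PE D) (xi V t k z) w)%R.
    pose a2 := (c_proj D t z k 0 - mean (PE D) (xi V t k z) w)%R.
    pose a3 := (c_dual D V t z w k 0 - c_interp D V t z w k 0)%R.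
    apply: (@le_trans _ _ (3%:E * ((a1 ^+ 2)%:E + (a2 ^+ 2)%:E + (a3 ^+ 2)%:E))).
      rewrite -!EFinD -EFinM lee_fin 2!mxE.
      have -> : (c_proj D t z k 0 - c_interp D V t z w k 0 = a2 - a1 + a3)%R by rewrite /a1 /a2 /a3; ring.
      by have := sqr_ge0 (a1 + a2)%R; have := sqr_ge0 (a1 + a3)%R; have := sqr_ge0 (a2 - a3)%R; lra.
    apply: lee_wpmul2l => //; apply: leeD; last exact: h3.
    apply: leeD; first by rewrite lee_fin /a1 h2; exact: h1.
    apply: le_trans (c_proj_error Dst D1 D2 D3 D4 Dsim PV tH z k w) _.
    apply: lee_wpmul2l; first by rewrite lee_fin sqr_ge0.
    by apply: lee_wpmul2r => //; apply: ereal_sup_ubound; exists z.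
  rewrite -sumEFin; apply: le_trans (lee_sum _ (fun k _ => h k)) _.
  have B0 : 0 <= (Lambda_du D ^+ 2)%:E * (N * Qe w) by rewrite !mule_ge0 ?lee_fin ?sqr_ge0.
  have C0 : 0 <= (Linterp D ^+ 2)%:E * cov ^+ 2 by rewrite mule_ge0 ?lee_fin ?sqr_ge0.
  rewrite -ge0_sume_distrr; last by move=> k _; rewrite !adde_ge0.
  apply: lee_wpmul2l => //; rewrite !big_split/=.
  have sum_cst (y : \bar R) : \sum_(k < K) y = (K%:R)%:E * y.
    by rewrite big_const_ord iter_addr_0 mule_natl.
  rewrite !sum_cst /c2 /c3 !EFinM !muleA//.
- rewrite ge0_integralZl//.
  apply: lee_wpmul2l => //.
  rewrite ge0_integralD//.
  rewrite integral_cst// [X in c3 * X]probability_setT mule1; apply: leeD => //.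
  rewrite ge0_integralD//.
  have QE : \int[PP D]_w Qe w = primal_error D V t.+1 ^+ 2.
    exact: (integral_primal_sqerr Dst D2 Dsim PV tH).
  apply: leeD; last by rewrite ge0_integralZl// QE /c2 -[leLHS]muleA.
  rewrite ge0_integral_sum//.
  have WE k : \int[PP D]_w (W k w)%:E <= (400 ^+ 2)%:E * (X ^+ 2 * ((n_du D)%:R^-1)%:E).
    by have [_ _ _] := WP k.
  apply: le_trans (lee_sum _ (fun k _ => WE k)) _.
  have sum_cst (y : \bar R) : \sum_(k < K) y = (K%:R)%:E * y.
    by rewrite big_const_ord iter_addr_0 mule_natl.
  rewrite sum_cst XE; move: (X0 ^+ 2) => y.
  rewrite [_ * y * _]muleAC !muleA -!EFinM.
  by rewrite le_eqVlt; apply/orP; left; apply/eqP; congr (_%:E * _); ring.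
Qed.

(** Cauchy-Schwarz on coefficient vectors separates the fresh draw from the simulations: the bound
    [Y] is a product of a function of each, so its integral factorizes and [psi_varrho] applies. *)
Lemma expected_error_bound (Z : E * Omega -> \bar R) :
  is_ess_sup (PE D \x PP D) (squared_error D V t) Z ->
  \int[PE D \x PP D]_ew Z ew <= (3 * 400 ^+ 2)%:E * error_bound D V t.
Proof.
move=> [mZ _ Zlub]; have [G [mG G0 Gub GE]] := coefficient_error_bound.
pose Y (x : E * Omega) : \bar R := (enorm (psi D x.1) ^+ 2)%:E * G x.2.
have menorm : measurable_fun [set: E] (fun e => (enorm (psi D e) ^+ 2)%:E).
  apply/measurable_EFinP.
  rewrite (_ : (fun e => _) = fun e => \sum_i psi D e i 0 ^+ 2)%R; last first.
    by apply/funext => e; rewrite /enorm sqr_sqrtr// sumr_ge0// => i _; exact: sqr_ge0.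
  by apply: measurable_sum => i; apply: measurable_funX; exact: measurable_psi.
have enorm0 e : 0 <= (enorm (psi D e) ^+ 2)%:E by rewrite lee_fin sqr_ge0.
have mY : measurable_fun [set: E * Omega] Y.
  apply: emeasurable_funM; first exact: (measurableT_comp menorm measurable_fst).
  exact: (measurableT_comp mG measurable_snd).
have Y0 x : 0 <= Y x by rewrite mule_ge0.
have ZY : {ae PE D \x PP D, forall x, Z x <= Y x}.
  apply: Zlub => // z; apply: filterS (ae_prod_snd (PE D) (Gub z)) => x Gx.
  apply: (@le_trans _ _ ((enorm (psi D x.1) ^+ 2)%:E *
      (\sum_k (c_proj D t z - c_interp D V t z x.2) k 0 ^+ 2)%:E)); last exact: lee_wpmul2l.
  rewrite /squared_error -EFinM lee_fin mulrC real_normK ?num_real//.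
  apply: le_trans (dot_sqr_le _ _); rewrite le_eqVlt; apply/orP; left; apply/eqP; congr (_ ^+ 2)%R.
  by rewrite /eta /eta_tilde /dot -sumrB; apply: eq_bigr => k _; rewrite !mxE mulrBl.
apply: (@le_trans _ _ (\int[PE D \x PP D]_x Y x)).
  (* The sign of [Z] is not given, but its positive part is also almost everywhere below the
     nonnegative [Y]. *)
  apply: (@le_trans _ _ (\int[PE D \x PP D]_x Z^\+ x)).
    by rewrite integralE geeDl// oppe_le0 integral_ge0.
  apply: ae_ge0_le_integral => //.
  - exact: measurable_funepos.
  - apply: filterS ZY => x Zx _; by rewrite funeposE ge_max Zx Y0.
rewrite fubini_tonelli2//.
have -> : \int[PP D]_w fubini_G (PE D) Y w =
    \int[PP D]_w ((\int[PE D]_e (enorm (psi D e) ^+ 2)%:E) * G w).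
  by apply: eq_integral => w _; rewrite /fubini_G /Y/= ge0_integralZr.
have I0 : 0 <= \int[PE D]_e (enorm (psi D e) ^+ 2)%:E by apply: integral_ge0.
rewrite ge0_integralZl//.
apply: (@le_trans _ _ ((varrho D ^+ 2)%:E * \int[PP D]_w G w)).
  by apply: lee_wpmul2r; [exact: integral_ge0|exact: psi_varrho].
apply: le_trans (lee_wpmul2l _ GE) _; first by rewrite lee_fin sqr_ge0.
rewrite /error_bound.
set a := X0 ^+ 2; set p := primal_error D V t.+1 ^+ 2; set c := cov ^+ 2.
have a0 : 0 <= a by rewrite /a expe2 mule_ge0.
have p0 : 0 <= p by rewrite /p expe2 mule_ge0// Lnorm_ge0.
have c0 : 0 <= c by rewrite /c expe2; case: cov => [r||]; rewrite -?EFinM ?lee_fin -?expr2 ?sqr_ge0.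
clearbody a p c; move: N N_ge0 => n n0.
rewrite (_ : Linterp D ^+ 2 = LV D ^+ 2 * LK D ^+ 2 * Lambda_du D ^+ 2)%R; last first.
  by rewrite /Linterp !exprMn.
have := sqr_ge0 (varrho D); have := sqr_ge0 (Lambda_du D).
have := sqr_ge0 (LV D); have := sqr_ge0 (LK D).
move: (varrho D ^+ 2)%R (Lambda_du D ^+ 2)%R (LV D ^+ 2)%R (LK D ^+ 2)%R => v q l k k0 l0 q0 v0.
have : (0 <= (n_du D)%:R^-1 :> R)%R by rewrite invr_ge0.
have : (0 <= K%:R :> R)%R by [].
move: (K%:R : R)%R ((n_du D)%:R^-1 : R)%R => K m K0 m0.
rewrite [v%:E * (_ * _ * _ * _)](_ : _ = (v * K * q * m)%:E * a); last first.
  by rewrite [K%:E * a]muleC -!muleA -!EFinM muleCA -EFinM muleC; congr (_%:E * _); ring.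
have EF0 (x : R) (y : \bar R) : (0 <= x)%R -> 0 <= y -> 0 <= x%:E * y.
  by move=> x0 y0; rewrite mule_ge0// lee_fin.
have Kq0 : (0 <= K * q)%R by rewrite mulr_ge0.
have Kl0 : (0 <= K * (l * k * q))%R by rewrite !mulr_ge0.
have c400 : (0 <= 400 ^+ 2 :> R)%R by exact: sqr_ge0.
have np0 : 0 <= n * p by rewrite mule_ge0.
rewrite -[(K * q * v)%:E * n * p]muleA.
have h1 : 0 <= (K * 400 ^+ 2 * m * q)%:E * a by rewrite EF0// !mulr_ge0.
have h2 : 0 <= (K * q)%:E * (n * p) by rewrite EF0.
have h3 : 0 <= (K * (l * k * q))%:E * c by rewrite EF0.
have g1 : 0 <= (v * K * q * m)%:E * a by rewrite EF0// !mulr_ge0.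
have g2 : 0 <= (K * q * v)%:E * (n * p) by rewrite EF0// !mulr_ge0.
have g3 : 0 <= (K * v * l * k * q)%:E * c by rewrite EF0// !mulr_ge0.
have mulEE (x y : R) (z : \bar R) : x%:E * (y%:E * z) = (x * y)%:E * z.
  by rewrite EFinM muleA.
rewrite mulEE (ge0_muleDr _ (adde_ge0 h1 h2) h3) (ge0_muleDr _ h1 h2).
rewrite (ge0_muleDr _ (adde_ge0 g1 g2) g3) (ge0_muleDr _ g1 g2).
rewrite !mulEE; apply: leeD; first apply: leeD.
- by rewrite le_eqVlt; apply/orP; left; apply/eqP; congr (_%:E * _); ring.
- apply: lee_wpmul2r => //; rewrite lee_fin.
  rewrite (_ : v * 3 * (K * q) = 3 * (K * q * v))%R; last by ring.
  by apply: ler_wpM2r; [rewrite !mulr_ge0|lra].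
- apply: lee_wpmul2r => //; rewrite lee_fin.
  rewrite (_ : v * 3 * (K * (l * k * q)) = 3 * (K * v * l * k * q))%R; last by ring.
  by apply: ler_wpM2r; [rewrite !mulr_ge0|lra].
Qed.

End conclusion.

Theorem theorem5 (R : realType) :
  exists C : R, 0 < C /\
  forall (dS dA dE dO : measure_display)
    (S : metricMeasurableType dS R) (A : metricMeasurableType dA R)
    (E : measurableType dE) (Omega : measurableType dO)
    (D : setting S A E Omega),
  standing D -> B1 D -> B2 D -> B3 D -> B4 D -> simulation D ->
  forall V : nat -> S -> Omega -> R, primal_approximation D V ->
  forall t : nat, (t < horizon D)%N ->
  (t.+1 = horizon D -> interpolable D V t) ->
  forall Z : E * Omega -> \bar R,
    is_ess_sup (PE D \x PP D)%E (squared_error D V t) Z ->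
    (\int[PE D \x PP D]_ew Z ew <= C%:E * error_bound D V t)%E.
Proof.
(* The factor 3 is from the splitting of the coefficient error and [400 ^+ 2] from [chaining]; the
   bias and interpolation terms need only the 3. *)
exists (3 * 400 ^+ 2); split; first by rewrite mulr_gt0// exprn_gt0.
move=> dS dA dE dO S A E Omega D Dst D1 D2 D3 D4 Dsim V PV t tH Vint Z.
exact: expected_error_bound.
Qed.
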